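(* Let $\rho:\mathbb{R}\to\mathbb{R}$ be globally Lipschitz continuous with $|\rho(u)|^2=\lambda^2(\varsigma^2+u^2)$ for all $u\in\mathbb{R}$, where $\lambda\neq0$ and $\varsigma\ge0$ are constants, and let $\mu$ be the Dirac delta measure with unit mass at zero. Let $u$ be the random field solution of the stochastic heat equation with initial data $\mu$. Then for all $t>0$ and $x,y\in\mathbb{R}$, $$\begin{aligned}\mathbb{E}[u(t,x)u(t,y)]=\ &G_\nu(t,x)G_\nu(t,y)-\varsigma^2\operatorname{erfc}\left(\frac{|x-y|}{2\sqrt{\nu t}}\right)\\&+\left(\frac{\lambda^2}{4\nu}G_{\nu/2}\left(t,\frac{x+y}{2}\right)+\varsigma^2\right)\exp\left(\frac{\lambda^4t-2\lambda^2|x-y|}{4\nu}\right)\operatorname{erfc}\left(\frac{|x-y|-\lambda^2t}{2\sqrt{\nu t}}\right)\end{aligned}$$ and $$\mathbb{E}\left[|u(t,x)|^2\right]=\frac{1}{\lambda^2}\mathcal{K}(t,x)+\varsigma^2\mathcal{H}(t).$$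
   Context: Notation. $\nu>0$ is fixed, $\mathbb{R}_+^*=\,]0,\infty[$, $G_\nu(t,x)=\frac{1}{\sqrt{2\pi\nu t}}e^{-x^2/(2\nu t)}$ for $t>0$, $G_\nu(t,\cdot)\equiv0$ for $t\le0$; $\Phi(x)=\int_{-\infty}^x(2\pi)^{-1/2}e^{-y^2/2}dy$; $\operatorname{erfc}(x)=1-\frac{2}{\sqrt\pi}\int_0^xe^{-y^2}dy$; $\|\cdot\|_p$ is the $L^p(\Omega)$-norm; $(f\star g)(t,x)=\int_0^tds\int_{\mathbb{R}}dy\,f(s,y)g(t-s,x-y)$. Kernels. $\mathcal{K}(t,x)=\sum_{n\ge0}\mathcal{L}_n(t,x)$ where $\mathcal{L}_0=\lambda^2G_\nu^2$ and $\mathcal{L}_n$ is the $\star$-convolution of $n+1$ copies of $\mathcal{L}_0$; explicitly $\mathcal{K}(t,x)=G_{\nu/2}(t,x)\left(\frac{\lambda^2}{\sqrt{4\pi\nu t}}+\frac{\lambda^4}{2\nu}e^{\lambda^4t/(4\nu)}\Phi\left(\lambda^2\sqrt{t/(2\nu)}\right)\right)$. $\mathcal{H}(t)=(1\star\mathcal{K})(t,x)=2e^{\lambda^4t/(4\nu)}\Phi\left(\lambda^2\sqrt{t/(2\nu)}\right)-1$. Equation. $W$ is space-time white noise on $\mathbb{R}_+\times\mathbb{R}$ on a complete probability space $(\Omega,\mathcal{F},P)$, with natural filtration $(\mathcal{F}_t)$ augmented by null sets. The stochastic heat equation $\left(\frac{\partial}{\partial t}-\frac{\nu}{2}\frac{\partial^2}{\partial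 x^2}\right)u=\rho(u)\dot W$, $u(0,\cdot)=\mu$, means $u(t,x)=J_0(t,x)+I(t,x)$ with $J_0(t,x)=\int_{\mathbb{R}}G_\nu(t,x-y)\mu(dy)$ and $I(t,x)=\iint_{[0,t]\times\mathbb{R}}G_\nu(t-s,x-y)\rho(u(s,y))W(ds,dy)$ (Walsh integral). A random field solution is a process $u=(u(t,x),(t,x)\in\mathbb{R}_+^*\times\mathbb{R})$ that is adapted ($u(t,x)$ is $\mathcal{F}_t$-measurable), jointly measurable in $(t,x,\omega)$, satisfies $(G_\nu^2\star\|\rho(u)\|_2^2)(t,x)<\infty$ for all $(t,x)$ with $(t,x)\mapsto I(t,x)$ continuous from $\mathbb{R}_+^*\times\mathbb{R}$ into $L^2(\Omega)$, and satisfies the equation a.s. for every $(t,x)\in\mathbb{R}_+^*\times\mathbb{R}$. For $\rho$ Lipschitz and this $\mu$ it exists and is unique up to versions. *)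

(* Defs.v *)
From HB Require Import structures.
From mathcomp Require Import all_boot all_order all_algebra.
From mathcomp Require Import all_classical all_reals all_analysis.

Set Implicit Arguments.
Unset Strict Implicit.
Unset Printing Implicit Defensive.
Import Order.TTheory GRing.Theory Num.Theory.
Import numFieldNormedType.Exports.

Local Open Scope classical_set_scope.
Local Open Scope ring_scope.

Definition heat_kernel (R : realType) (nu t x : R) : R :=
  if 0 < t
  then (Num.sqrt (2 * pi * nu * t))^-1 * expR (- x ^+ 2 / (2 * nu * t))
  else 0.

(* The oriented integral of exp(-y^2) from 0 to x: one of the two integrals
   vanishes, according to the sign of x. *)
Definition erfc (R : realType) (x : R) : R :=
  1 - 2 / Num.sqrt pi *
      (\int[lebesgue_measure]_(y in `[0, x]) expR (- y ^+ 2) -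
       \int[lebesgue_measure]_(y in `[x, 0]) expR (- y ^+ 2)).

Section Kernels.
Local Open Scope ereal_scope.
Context (R : realType).

(* Space-time convolution of nonnegative kernels. *)
Definition star (f g : R -> R -> \bar R) (t x : R) : \bar R :=
  \int[lebesgue_measure]_(s in `[0%R, t])
    \int[lebesgue_measure]_y (f s y * g (t - s)%R (x - y)%R).

Definition calL0 (nu lambda t x : R) : \bar R :=
  (lambda ^+ 2 * heat_kernel nu t x ^+ 2)%:E.

Fixpoint calL (nu lambda : R) (n : nat) : R -> R -> \bar R :=
  if n is m.+1 then star (calL nu lambda m) (calL0 nu lambda)
  else calL0 nu lambda.

Definition calK (nu lambda t x : R) : \bar R :=
  \sum_(0 <= n <oo) calL nu lambda n t x.

(* (1 * K)(t, x) does not depend on x, because the space integral is over the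
   whole line; it is evaluated at x = 0. *)
Definition calH (nu lambda t : R) : \bar R :=
  star (fun _ _ => 1) (calK nu lambda) t 0%R.

(* Solution of the homogeneous equation with initial measure mu. *)
Definition J0 (nu : R) (mu : {measure set R -> \bar R}) (t x : R) : R :=
  (\int[mu]_y heat_kernel nu t (x - y))%R.

End Kernels.

Section Noise.
Context (R : realType) (d : measure_display) (T : measurableType d)
        (P : probability T R).

(* The first case is the degenerate law of variance 0, for which the library's
   normal_prob is not the Dirac mass. *)
Definition centered_gaussian (X : T -> R) : Prop :=
  {ae P, forall w, X w = 0} \/
  exists2 s : R, 0 < s &
    forall B : set R, measurable B -> P (X @^-1` B) = normal_prob 0 s B.

Definition leb2 : set (R * R) -> \bar R :=
  (@lebesgue_measure R \x @lebesgue_measure R)%E.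

(* A space-time point is a pair (time, position). *)
Definition finite_borel (A : set (R * R)) : Prop :=
  [/\ measurable A, A `<=` [set z | 0 <= z.1] & (leb2 A < +oo)%E].

(* A centered Gaussian process indexed by the Borel sets of R_+ x R of finite
   Lebesgue measure, with covariance |A n B|.  The values of W on all other sets
   are irrelevant. *)
Definition space_time_white_noise (W : set (R * R) -> {RV P >-> R}) : Prop :=
  (forall (n : nat) (A : 'I_n -> set (R * R)) (c : 'I_n -> R),
     (forall i, finite_borel (A i)) ->
     centered_gaussian (fun w => \sum_(i < n) c i * W (A i) w)) /\
  (forall A B : set (R * R), finite_borel A -> finite_borel B ->
     'E_P[fun w => (W A w * W B w)%R]%E = leb2 (A `&` B)).

(* The sigma-algebra generated by W([0, s] x A), s <= t, |A| < oo, and by the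
   null sets. *)
Definition noise_filtration (W : set (R * R) -> {RV P >-> R}) (t : R) :
    set (set T) :=
  <<s [set E | exists (s : R) (A B : set R),
         [/\ 0 <= s <= t, measurable A, (lebesgue_measure A < +oo)%E,
             measurable B & E = W (`[0, s] `*` A) @^-1` B]]
      `|` [set N | P.-negligible N] >>.

Definition filtration_measurable (W : set (R * R) -> {RV P >-> R}) (t : R)
    (X : T -> R) : Prop :=
  forall B : set R, measurable B -> noise_filtration W t (X @^-1` B).

(* Encodes the process (s, y, w) |-> Y(w) 1_{]a, b]}(s) 1_A(y), with a, b, A, Y
   the first four fields. *)
Record elementary (W : set (R * R) -> {RV P >-> R}) : Type := Elementary {
  el_start : R ;
  el_end : R ;
  el_set : set R ;
  el_coef : T -> R ;
  el_time : 0 <= el_start <= el_end ;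
  el_set_measurable : measurable el_set ;
  el_set_finite : (lebesgue_measure el_set < +oo)%E ;
  el_coef_bounded : exists M : R, forall w, `|el_coef w| <= M ;
  el_coef_measurable : filtration_measurable W el_start el_coef }.

Definition el_support (W : set (R * R) -> {RV P >-> R}) (e : elementary W) :
    set (R * R) :=
  `]el_start e, el_end e] `*` el_set e.

(* A simple process is a finite sum of elementary ones. *)
Definition simple_process (W : set (R * R) -> {RV P >-> R})
    (S : seq (elementary W)) (s y : R) (w : T) : R :=
  \sum_(e <- S) el_coef e w * \1_(el_support e) (s, y).

Definition simple_integral (W : set (R * R) -> {RV P >-> R})
    (S : seq (elementary W)) (w : T) : R :=
  \sum_(e <- S) el_coef e w * W (el_support e) w.

(* X is a version of the Walsh integral of f over [0, t] x R, the extension by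
   L^2-isometry of the integral of simple processes.  The processes considered
   here need not be defined at time 0, so that the null set {0} x R is left out
   of the domain. *)
Definition walsh_integral (W : set (R * R) -> {RV P >-> R}) (t : R)
    (f : R -> R -> T -> R) (X : T -> R) : Prop :=
  let g s y w := f s y w * \1_`]0, t] s in
  [/\ measurable_fun [set z : (R * R) * T | 0 < z.1.1 <= t]
        (fun z => f z.1.1 z.1.2 z.2),
      measurable_fun setT X &
      exists S : nat -> seq (elementary W),
        ((\int[lebesgue_measure]_(s in `]0%R, +oo[)
            \int[lebesgue_measure]_y
              'E_P[fun w => ((g s y w - simple_process (S n) s y w) ^+ 2)%R])%E
           @[n --> \oo] --> 0%E) /\
        ('E_P[fun w => ((X w - simple_integral (S n) w) ^+ 2)%R]%E
           @[n --> \oo] --> 0%E)].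

(* Random field solution of the stochastic heat equation driven by W with
   initial measure mu.  Only the values u t x with t > 0 matter; I is the
   stochastic integral term. *)
Definition random_field_solution (nu : R) (rho : R -> R)
    (mu : {measure set R -> \bar R}) (W : set (R * R) -> {RV P >-> R})
    (u : R -> R -> T -> R) : Prop :=
  [/\ (forall t x : R, 0 < t -> filtration_measurable W t (u t x)),
      measurable_fun [set z : (R * R) * T | 0 < z.1.1]
        (fun z => u z.1.1 z.1.2 z.2),
      (forall t x : R, 0 < t ->
         (star (fun s y => (heat_kernel nu s y ^+ 2)%:E)
               (fun s y => 'E_P[fun w => (rho (u s y w) ^+ 2)%R]) t x
          < +oo)%E) &
      exists I : R -> R -> T -> R,
        [/\ (forall t x : R, 0 < t ->
               walsh_integral W t
                 (fun s y w => heat_kernel nu (t - s) (x - y) * rho (u s y w))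
                 (I t x)),
            (forall t x : R, 0 < t ->
               'E_P[fun w => ((I z.1 z.2 w - I t x w) ^+ 2)%R]%E
                 @[z --> (t, x)] --> 0%E) &
            (forall t x : R, 0 < t ->
               {ae P, forall w, u t x w = J0 nu mu t x + I t x w})]].

End Noise.

(* Main.v *)
Require Import Defs.
From HB Require Import structures.
From mathcomp Require Import all_boot all_order all_algebra.
From mathcomp Require Import all_classical all_reals all_analysis.
From mathcomp Require Import measurable_realfun ring lra.
Import Order.TTheory GRing.Theory Num.Theory.
Import numFieldNormedType.Exports.
Local Open Scope classical_set_scope.
Local Open Scope ring_scope.
Set Implicit Arguments.
Unset Strict Implicit.
Unset Printing Implicit Defensive.

(* Ito's isometry turns E[u(t,x) u(t,y)] into G_nu(t,x) G_nu(t,y) plus the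
   space-time integral of G_nu(t-s,x-z) G_nu(t-s,y-z) E[rho(u(s,z))^2].  Since
   G_nu(t,a) G_nu(t,b) = G_{2nu}(t,a-b) G_{nu/2}(t,(a+b)/2), and by the semigroup
   property of G_{nu/2}, the average of varsigma^2 + E[u(s,z)^2] against
   G_{nu/2}(t-s,m-z) dz solves a Volterra equation in the time s alone, with
   kernel lambda^2 G_{2nu}(s,0).  Its only integrable solution is expressed with
   the mixtures D_beta(t,r) of G_{2nu}(t,r+v) against exp(beta v) dv, v > 0, which
   are an exponential times erfc; the same equation gives the series K and H.

   The first-passage densities h_a(s) = (a/s) G(s,a) of a Brownian motion satisfy
   h_a * h_b = h_{a+b} for the convolution in time.  As h_r is proportional to
   the derivative of G(s,r) in r, integration in the levels gives the
   convolution in time of two heat kernels taken at fixed points.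

   For the isometry, noise on future sets is orthogonal to trigonometric
   functions of noise on past sets by comparison of Gaussian laws; passing from
   these to indicator functions by bounded pointwise limits reaches the whole
   filtration without characteristic functions of random vectors. *)

(** * Convolution in time *)

(** In Laplace variables, with q = sqrt(2p/c), the kernel G_c(., r) becomes exp(-q r) / (c q) and
    D_beta(., r) becomes exp(-q r) / (c q (q - beta)). Convolution with l G_c(., 0) multiplies by l
    / (c q), and the geometric series of such factors has its pole at q = l/c: this is the origin of
    the mixtures and of the rate beta = l/c, here lambda^2 / (2 nu). The first-passage densities,
    with transform exp(-q r), let the same algebra be carried out on the side of time, where every
    integrand is nonnegative and Tonelli's theorem applies.

    Gronwall's lemma does not apply to the Volterra equation at once, the kernel being of order
    s^(-1/2). But the convolution of the kernel with itself is constant on positive times, so that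
    one substitution of the equation into itself leaves a bounded kernel. The integrability asked
    there comes from the finiteness condition in the definition of a solution.

    Since values may be infinite until that is known, identities between mixtures and moments are
    mostly stated as sums, with subtracted terms moved to the other side. *)

Section Lebesgue_invariance.
Context {R : realType}.
Local Notation mu := (@lebesgue_measure R).
Local Open Scope ereal_scope.

Lemma lebesgue_measure_shift (c : R) (A : set R) : measurable A ->
  pushforward mu ((fun x => x + c)%R : _ -> measurableTypeR R) A = mu A.
Proof.
move=> mA; apply/esym/lebesgue_measure_unique => //=.
  exact: measurable_funD.
move=> _ _ [[a b]] _ <-.
rewrite /pushforward (_ : _ @^-1` _ = `](a - c)%R, (b - c)%R]%classic); last first.
  by apply/seteqP; split => x /=; rewrite !in_itv/= ltrBlDr lerBrDr.
rewrite !lebesgue_measure_itv/= !lte_fin ltrD2r.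
by case: ifP => // _; congr EFin; ring.
Qed.

Lemma ge0_integral_shift (c : R) (f : R -> \bar R) :
  measurable_fun setT f -> (forall x, 0 <= f x) ->
  \int[mu]_x f (x + c)%R = \int[mu]_x f x.
Proof.
move=> mf f0.
have mD : measurable_fun setT (fun x : R => x + c)%R by exact: measurable_funD.
transitivity (\int[pushforward mu ((fun x => x + c)%R : _ -> measurableTypeR R)]_x f x).
  by rewrite ge0_integral_pushforward.
by apply: eq_measure_integral => A mA _; exact: lebesgue_measure_shift.
Qed.

Lemma ge0_integralN (f : R -> \bar R) :
  measurable_fun setT f -> (forall x, 0 <= f x) ->
  \int[mu]_x f (- x)%R = \int[mu]_x f x.
Proof.
move=> mf f0.
transitivity (\int[pushforward mu (-%R : _ -> measurableTypeR R)]_x f x).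
  by rewrite ge0_integral_pushforward.
by apply: eq_measure_integral => A mA _; exact: lebesgue_measureN.
Qed.

Lemma ge0_integral_reflect (c : R) (f : R -> \bar R) :
  measurable_fun setT f -> (forall x, 0 <= f x) ->
  \int[mu]_x f (c - x)%R = \int[mu]_x f x.
Proof.
move=> mf f0; rewrite -(ge0_integralN mf)// -(@ge0_integral_shift (- c)%R (f \o -%R)%R)//.
- by apply: eq_integral => x _ /=; congr f; rewrite opprD opprK addrC.
- exact: measurableT_comp.
- by move=> x /=; exact: f0.
Qed.

Lemma lebesgue_measure_scale (c : R) (c0 : (0 < c)%R) (A : set R) : measurable A ->
  mu A = c%:E * pushforward mu ((fun x => c * x)%R : _ -> measurableTypeR R) A.
Proof.
have mM : measurable_fun setT (fun x : R => c * x)%R by exact: measurable_funM.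
pose m := mscale (NngNum (ltW c0)) (pushforward mu ((fun x => c * x)%R : _ -> measurableTypeR R)).
suff : forall A, measurable A -> mu A = m mM A by move=> + mA => /(_ _ mA).
move=> {}A; apply: lebesgue_measure_unique => //= _ [[a b]] _ <-.
transitivity (c%:E * mu `](a / c)%R, (b / c)%R]%classic); last first.
  rewrite /m /mscale /pushforward/=; congr (_ * mu _).
  by apply/seteqP; split => x /=; rewrite !in_itv/= ltr_pdivrMr// ler_pdivlMr// [X in (_ < X)%R]mulrC [X in (X <= _)%R]mulrC.
rewrite !lebesgue_measure_itv/= !lte_fin ltr_pM2r ?invr_gt0//.
case: ifP => // _; rewrite ?mule0// -EFinD -EFinM; congr EFin.
by field; rewrite gt_eqF.
Qed.

Lemma ge0_integral_scale (c : R) (f : R -> \bar R) : (0 < c)%R ->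
  measurable_fun setT f -> (forall x, 0 <= f x) ->
  c%:E * \int[mu]_x f (c * x)%R = \int[mu]_x f x.
Proof.
move=> c0 mf f0; have mM : measurable_fun setT (fun x : R => c * x)%R by exact: measurable_funM.
pose m := mscale (NngNum (ltW c0)) (pushforward mu ((fun x => c * x)%R : _ -> measurableTypeR R)).
transitivity (\int[m mM]_x f x).
  by rewrite ge0_integral_mscale//= ge0_integral_pushforward.
by apply: eq_measure_integral => A mA _; rewrite [RHS](lebesgue_measure_scale c0).
Qed.

End Lebesgue_invariance.

Section Convolution.
Context {R : realType}.
Local Notation mu := (@lebesgue_measure R).
Local Open Scope ereal_scope.

(** Integrating over the whole line instead of ]0, t[ gives access to the invariance of Lebesgue
    measure without boundary terms. In the applications both factors vanish at nonpositive times, so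
    that the value is the usual one. *)
Definition conv (f g : R -> \bar R) (t : R) : \bar R :=
  \int[mu]_s (f s * g (t - s)%R).

Lemma convE f g t : conv f g t = \int[mu]_s (f s * g (t - s)%R).
Proof. by []. Qed.

Lemma conv_ge0 f g t : (forall s, 0 <= f s) -> (forall s, 0 <= g s) ->
  0 <= conv f g t.
Proof. by move=> f0 g0; apply: integral_ge0 => s _; rewrite mule_ge0. Qed.

Lemma measurable_conv (f g : R -> \bar R) : measurable_fun setT f ->
  measurable_fun setT g -> (forall s, 0 <= f s) -> (forall s, 0 <= g s) ->
  measurable_fun setT (conv f g).
Proof.
move=> mf mg f0 g0.
apply: (measurable_fun_fubini_tonelli_F (m2 := mu) (fun z : R * R => f z.2 * g (z.1 - z.2)%R)) => /=.
  apply: emeasurable_funM; apply: measurableT_comp => //.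
  exact: measurable_funB.
by move=> z; rewrite mule_ge0.
Qed.

Lemma conv_mule_measurable (f g : R -> \bar R) (t : R) : measurable_fun setT f ->
  measurable_fun setT g -> measurable_fun setT (fun s => f s * g (t - s)%R).
Proof.
move=> mf mg; apply: emeasurable_funM => //; apply: measurableT_comp => //.
exact: measurable_funB.
Qed.

Lemma convC (f g : R -> \bar R) t : measurable_fun setT f ->
  measurable_fun setT g -> (forall s, 0 <= f s) -> (forall s, 0 <= g s) ->
  conv f g t = conv g f t.
Proof.
move=> mf mg f0 g0.
rewrite /conv -(ge0_integral_reflect t).
- by apply: eq_integral => s _; rewrite subKr muleC.
- exact: conv_mule_measurable.
- by move=> s; rewrite mule_ge0.
Qed.

Lemma convA (f g h : R -> \bar R) t : measurable_fun setT f ->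
  measurable_fun setT g -> measurable_fun setT h ->
  (forall s, 0 <= f s) -> (forall s, 0 <= g s) -> (forall s, 0 <= h s) ->
  conv f (conv g h) t = conv (conv f g) h t.
Proof.
move=> mf mg mh f0 g0 h0; rewrite /conv.
transitivity (\int[mu]_s \int[mu]_r (f s * (g (r - s)%R * h (t - r)%R))).
  apply: eq_integral => s _; rewrite -ge0_integralZl//.
  - rewrite -(ge0_integral_shift s).
    + by apply: eq_integral => r _; rewrite addrK opprD addrA addrAC.
    + apply: emeasurable_funM => //; apply: emeasurable_funM => //.
        by apply: measurableT_comp => //; exact: measurable_funB.
      by apply: measurableT_comp => //; exact: measurable_funB.
    + by move=> x; rewrite !mule_ge0.
  - exact: conv_mule_measurable.
  - by move=> x _; rewrite mule_ge0.
rewrite (fubini_tonelli (m1 := mu) (m2 := mu) (fun z : R * R => f z.1 * (g (z.2 - z.1)%R * h (t - z.2)%R)))/=.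
- apply: eq_integral => r _; rewrite -ge0_integralZr//.
  + by apply: eq_integral => s _; rewrite muleA.
  + exact: conv_mule_measurable.
  + by move=> x _; rewrite mule_ge0.
- apply: emeasurable_funM; first exact: measurableT_comp.
  by apply: emeasurable_funM; apply: measurableT_comp => //; exact: measurable_funB.
- by move=> z; rewrite !mule_ge0.
Qed.

Lemma convDl (f1 f2 g : R -> \bar R) t : measurable_fun setT f1 ->
  measurable_fun setT f2 -> measurable_fun setT g ->
  (forall s, 0 <= f1 s) -> (forall s, 0 <= f2 s) -> (forall s, 0 <= g s) ->
  conv (fun s => f1 s + f2 s) g t = conv f1 g t + conv f2 g t.
Proof.
move=> mf mg mh f0 g0 h0; rewrite /conv -ge0_integralD//.
- by apply: eq_integral => s _; rewrite ge0_muleDl.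
- by move=> s _; rewrite mule_ge0.
- exact: conv_mule_measurable.
- by move=> s _; rewrite mule_ge0.
- exact: conv_mule_measurable.
Qed.

Lemma convZl (k : \bar R) (f g : R -> \bar R) t : measurable_fun setT f ->
  measurable_fun setT g ->
  (forall s, 0 <= f s) -> (forall s, 0 <= g s) -> 0 <= k ->
  conv (fun s => k * f s) g t = k * conv f g t.
Proof.
move=> mf mg f0 g0 k0; rewrite /conv -ge0_integralZl//.
- by apply: eq_integral => s _; rewrite muleA.
- exact: conv_mule_measurable.
- by move=> s _; rewrite mule_ge0.
Qed.

Lemma le_conv (f1 f2 g : R -> \bar R) t : measurable_fun setT f1 ->
  measurable_fun setT f2 -> measurable_fun setT g ->
  (forall s, 0 <= f1 s) -> (forall s, 0 <= g s) -> (forall s, f1 s <= f2 s) ->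
  conv f1 g t <= conv f2 g t.
Proof.
move=> mf mg mh f0 g0 f12; apply: ge0_le_integral => //.
- by move=> s _; rewrite mule_ge0.
- exact: conv_mule_measurable.
- exact: conv_mule_measurable.
- by move=> s _; rewrite lee_wpmul2r.
Qed.

End Convolution.

(** * The heat kernel: product formula and semigroup property *)

Section Heat_kernel.
Context {R : realType}.
Local Notation mu := (@lebesgue_measure R).
Implicit Types (nu t s x y : R).

Lemma heat_kernelE nu t x : 0 < t ->
  heat_kernel nu t x = (Num.sqrt (2 * pi * nu * t))^-1 * expR (- x ^+ 2 / (2 * nu * t)).
Proof. by rewrite /heat_kernel => ->. Qed.

Lemma heat_kernel0 nu t x : t <= 0 -> heat_kernel nu t x = 0.
Proof. by rewrite /heat_kernel ltNge => ->. Qed.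

Lemma heat_kernel_ge0 nu t x : 0 <= heat_kernel nu t x.
Proof.
rewrite /heat_kernel; case: ifP => // _.
Qed.

Lemma heat_kernel_gt0 nu t x : 0 < nu -> 0 < t -> 0 < heat_kernel nu t x.
Proof.
move=> nu0 t0; rewrite heat_kernelE// mulr_gt0 ?expR_gt0// invr_gt0 sqrtr_gt0.
by rewrite !mulr_gt0 ?pi_gt0.
Qed.

Lemma heat_kernelN nu t x : heat_kernel nu t (- x) = heat_kernel nu t x.
Proof. by rewrite /heat_kernel sqrrN. Qed.

Lemma heat_kernel_norm nu t x : heat_kernel nu t `|x| = heat_kernel nu t x.
Proof. by rewrite /heat_kernel real_normK ?num_real. Qed.

Lemma measurable_inv : measurable_fun setT (@GRing.inv R).
Proof.
rewrite -(setUv [set 0 : R]); apply/measurable_funU => //.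
  exact: measurableC.
split; first exact: measurable_fun_set1.
apply: open_continuous_measurable_fun; first exact/closed_openC/accessible_closed_set1/hausdorff_accessible/Rhausdorff.
by move=> x; rewrite inE/= => /eqP x0; exact: inv_continuous.
Qed.

Lemma measurable_fun_inv d (T : measurableType d) (f : T -> R) :
  measurable_fun setT f -> measurable_fun setT (fun z => (f z)^-1).
Proof. exact: measurableT_comp measurable_inv. Qed.

Lemma measurable_fun_sqrt d (T : measurableType d) (f : T -> R) :
  measurable_fun setT f -> measurable_fun setT (fun z => Num.sqrt (f z)).
Proof.
by apply: measurableT_comp; apply: continuous_measurable_fun; exact: sqrt_continuous.
Qed.

Lemma measurable_heat_kernel nu :
  measurable_fun setT (fun z : R * R => heat_kernel nu z.1 z.2).
Proof.
apply: measurable_fun_ifT => //=.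
  exact: measurable_fun_ltr.
apply: measurable_funM.
  apply/measurable_fun_inv/measurable_fun_sqrt.
  exact: measurable_funM.
apply: measurableT_comp => //; apply: measurable_funM => //.
  by apply: measurableT_comp => //; exact: measurable_funX.
by apply: measurable_fun_inv; exact: measurable_funM.
Qed.

Lemma measurable_heat_kernel_comp d (T : measurableType d) nu (f g : T -> R) :
  measurable_fun setT f -> measurable_fun setT g ->
  measurable_fun setT (fun z => heat_kernel nu (f z) (g z)).
Proof.
move=> mf mg; apply: (@measurableT_comp _ _ _ _ _ _ (fun z : R * R => heat_kernel nu z.1 z.2) _ (fun z => (f z, g z))).
  exact: measurable_heat_kernel.
exact: measurable_fun_pair.
Qed.

Lemma heat_kernel_normal nu t x : 0 < nu -> 0 < t ->
  heat_kernel nu t x = normal_pdf 0 (Num.sqrt (nu * t)) x.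
Proof.
move=> nu0 t0; rewrite heat_kernelE// normal_pdfE; last first.
  by rewrite gt_eqF// sqrtr_gt0 mulr_gt0.
rewrite /normal_peak /normal_fun sqr_sqrtr; last by rewrite ltW// mulr_gt0.
congr ((Num.sqrt _)^-1 * expR (_ / _)); [|by rewrite subr0|]; rewrite -mulr_natl; ring.
Qed.

Lemma integral_heat_kernel nu t : 0 < nu -> 0 < t ->
  (\int[mu]_x (heat_kernel nu t x)%:E = 1)%E.
Proof.
move=> nu0 t0; under eq_integral do rewrite heat_kernel_normal//.
exact: integral_normal_pdf.
Qed.

Lemma integral_heat_kernel_reflect nu t x : 0 < nu -> 0 < t ->
  (\int[mu]_y (heat_kernel nu t (x - y))%:E = 1)%E.
Proof.
move=> nu0 t0; rewrite (@ge0_integral_reflect R x (fun y => (heat_kernel nu t y)%:E)).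
- exact: integral_heat_kernel.
- exact/measurable_EFinP/measurable_heat_kernel_comp.
- by move=> y; rewrite lee_fin heat_kernel_ge0.
Qed.

Lemma mul_sqrtV (a b c d : R) : 0 <= a -> 0 <= c -> a * b = c * d ->
  (Num.sqrt a)^-1 * (Num.sqrt b)^-1 = (Num.sqrt c)^-1 * (Num.sqrt d)^-1.
Proof. by move=> a0 c0 e; rewrite -!invfM -!sqrtrM// e. Qed.

(** The difference and the half-sum of two independent Gaussian variables of variance nu t are
    independent, with variances 2 nu t and nu t / 2, and the change of variables has Jacobian 1. For
    t <= 0 both sides are 0. *)
Lemma heat_kernel_mul nu t x y : 0 < nu ->
  heat_kernel nu t x * heat_kernel nu t y =
  heat_kernel (2 * nu) t (x - y) * heat_kernel (nu / 2) t ((x + y) / 2).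
Proof.
move=> nu0; have [t0|t0] := ltP 0 t; last by rewrite !heat_kernel0// !mul0r.
have p0 : 0 < pi :> R := pi_gt0 R.
rewrite !heat_kernelE// mulrACA [RHS]mulrACA; congr (_ * _).
  by apply: mul_sqrtV; [rewrite !mulr_ge0// ltW..|field].
by rewrite -!expRD; congr expR; field; rewrite !gt_eqF.
Qed.

(** Completing the square in y: the second factor is the density at time s of the bridge from 0 to x
    over a time s + t, with mean s x / (s + t) and variance nu s t / (s + t). Integrating it out
    gives the semigroup property. *)
Lemma heat_kernel_bridge nu s t x y : 0 < nu -> 0 < s -> 0 < t ->
  heat_kernel nu s y * heat_kernel nu t (x - y) =
  heat_kernel nu (s + t) x * heat_kernel nu (s * t / (s + t)) (y - s * x / (s + t)).
Proof.
move=> nu0 s0 t0; have p0 : 0 < pi :> R := pi_gt0 R.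
have st0 : 0 < s + t by rewrite addr_gt0.
rewrite !heat_kernelE ?divr_gt0 ?mulr_gt0// mulrACA [RHS]mulrACA; congr (_ * _).
  apply: mul_sqrtV; [by rewrite !mulr_ge0// ltW|by rewrite !mulr_ge0// ltW|].
  by field; rewrite gt_eqF.
by rewrite -!expRD; congr expR; field; rewrite !gt_eqF.
Qed.

Lemma heat_kernel_semigroup nu s t x : 0 < nu -> 0 < s -> 0 < t ->
  (\int[mu]_y ((heat_kernel nu s y)%:E * (heat_kernel nu t (x - y))%:E) =
   (heat_kernel nu (s + t) x)%:E)%E.
Proof.
move=> nu0 s0 t0; under eq_integral do rewrite -EFinM heat_kernel_bridge// EFinM.
rewrite ge0_integralZl//.
- rewrite (@ge0_integral_shift R (- (s * x / (s + t)))
    (fun y => (heat_kernel nu (s * t / (s + t)) y)%:E)).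
  + by rewrite integral_heat_kernel ?mule1// divr_gt0 ?mulr_gt0 ?addr_gt0.
  + exact/measurable_EFinP/measurable_heat_kernel_comp.
  + by move=> y; rewrite lee_fin heat_kernel_ge0.
- apply/measurable_EFinP/measurable_heat_kernel_comp => //.
  exact: measurable_funB.
- by move=> y _; rewrite lee_fin heat_kernel_ge0.
- by rewrite lee_fin heat_kernel_ge0.
Qed.

End Heat_kernel.

(** * First-passage densities and exponential mixtures *)

Section FTC_open.
Context {R : realType}.
Local Notation mu := (@lebesgue_measure R).

(** Exhaustion by compact intervals and monotone convergence. Only one-sided limits of the primitive
    are asked at the ends: in the main use it is written with quotients whose denominator vanishes
    there. *)
Lemma ge0_FTC_oo (a b : R) (f F : R -> R) (la lb : R) : a < b ->
  {in `]a, b[, forall x, 0 <= f x} ->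
  {in `]a, b[, continuous f} ->
  {in `]a, b[, forall x : R, is_derive x (1 : R) F (f x)} ->
  F x @[x --> a^'+] --> la -> F x @[x --> b^'-] --> lb ->
  (\int[mu]_(x in `]a, b[) (f x)%:E = (lb - la)%:E)%E.
Proof.
move=> ab f0 cf dF Fa Fb.
(* Dividing by at least 3 keeps [a + e n < b - e n], also for [n = 0]. *)
pose e (n : nat) : R := (b - a) / n.+3%:R.
have e0 n : 0 < e n by rewrite divr_gt0// subr_gt0.
have e3 n : e n <= (b - a) / 3.
  by rewrite ler_pM2l ?subr_gt0// lef_pV2 ?posrE// ler_nat.
have ecv : e n @[n --> \oo] --> 0.
  rewrite -[X in _ --> X](mulr0 (b - a)); apply: cvgMr.
  have := @cvg_harmonic R; rewrite -(cvg_shiftn 2).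
  by under eq_fun do rewrite addn2.
pose I n : set R := `[a + e n, b - e n]%classic.
have sI n x : I n x -> x \in `]a, b[.
  rewrite /I/= !in_itv/= => /andP[h1 h2]; have := e0 n => ?; lra.
have ndI : nondecreasing_seq I.
  apply/nondecreasing_seqP => n; rewrite subsetEset => x; rewrite /I/= !in_itv/=.
  have : e n.+1 <= e n by rewrite ler_pM2l ?subr_gt0// lef_pV2 ?posrE// ler_nat.
  lra.
have mf : measurable_fun `]a, b[ f.
  by apply: open_continuous_measurable_fun => // x; rewrite inE => /cf.
have UI : \bigcup_n I n = `]a, b[%classic.
  apply/seteqP; split => [x [n _ /sI]//|x].
  rewrite /= in_itv/= => /andP[ax xb].
  have xa : 0 < Num.min (x - a) (b - x) by rewrite lt_min !subr_gt0 ax.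
  have := ecv => /cvgr0_norm_lt => /(_ _ xa)[N _ /(_ N (leqnn _))]/=.
  rewrite gtr0_norm// lt_min => /andP[h1 h2].
  by exists N => //; rewrite /I/= in_itv/=; lra.
have := @ge0_nondecreasing_set_cvg_integral _ (measurableTypeR R) R I (EFin \o f) lebesgue_measure ndI.
rewrite UI => /(_ _ _ _)/cvg_lim <- //; last 3 first.
- by move=> i; exact: measurable_itv.
- move=> i; apply/measurable_EFinP; apply: measurable_funS mf => //.
  by move=> x /sI.
- by move=> i x /sI xab; rewrite lee_fin f0.
apply/cvg_lim => //.
have E n : (\int[mu]_(x in I n) (f x)%:E = (F (b - e n) - F (a + e n))%:E)%E.
  have lt : a + e n < b - e n by have := e3 n; have := e0 n; lra.
  have dFx x : I n x -> derivable F x 1.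
    by move=> /sI/dF d; exact: ex_derive.
  rewrite (continuous_FTC2 (F := F))//.
  - by apply: continuous_in_subspaceT => x; rewrite inE => /sI/cf.
  - split.
    + by move=> x xI; apply: dFx; apply: subset_itv_oo_cc xI.
    + apply: cvg_at_right_filter; apply: differentiable_continuous.
      by apply/derivable1_diffP; apply: dFx; rewrite /I/= in_itv/= lexx ltW.
    + apply: cvg_at_left_filter; apply: differentiable_continuous.
      by apply/derivable1_diffP; apply: dFx; rewrite /I/= in_itv/= lexx ltW.
  - move=> x xI; rewrite derive1E; apply: derive_val.
    by apply: dF; apply: sI; apply: subset_itv_oo_cc xI.
rewrite (_ : (fun _ => _) = (fun n => (F (b - e n) - F (a + e n))%:E)); last first.
  by apply/funext => n; exact: E.
apply: cvg_EFin; first exact: nearW.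
apply: cvgB.
  move/cvg_at_leftP : Fb; apply; split => [n|]; first by rewrite ltrBlDr ltrDl.
  by rewrite -[X in _ --> X]subr0; apply: cvgB => //; exact: cvg_cst.
move/cvg_at_rightP : Fa; apply; split => [n|]; first by rewrite ltrDl.
by rewrite -[X in _ --> X]addr0; apply: cvgD => //; exact: cvg_cst.
Qed.

End FTC_open.

Section Normal_cdf.
Context {R : realType} (s : R) (s0 : s != 0).
Local Notation mu := (@lebesgue_measure R).

Definition normal_cdf (x : R) : R := fine (normal_prob 0 s `]-oo, x]).

(** The identity, seen as a random variable under the normal law, has [normal_cdf] as distribution
    function, which gives the limits at both infinities. *)
Let idR : measurableTypeR R -> R := idfun.
#[local] HB.instance Definition _ :=
  @isMeasurableFun.Build _ _ _ _ idR (@measurable_id _ _ setT).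

Let normal_cdfE x : (normal_cdf x)%:E = cdf (idR : {RV (normal_prob 0 s) >-> R}) x.
Proof. by rewrite /normal_cdf fineK// fin_num_measure. Qed.

Lemma normal_cdfy : normal_cdf x @[x --> +oo] --> (1 : R).
Proof.
have := cvg_cdfy1 (idR : {RV (normal_prob 0 s) >-> R}).
rewrite (_ : cdf _ = EFin \o normal_cdf); last first.
  by apply/funext => x; rewrite /= normal_cdfE.
exact: fine_cvg.
Qed.

Lemma normal_cdfNy : normal_cdf x @[x --> -oo] --> (0 : R).
Proof.
have := cvg_cdfNy0 (idR : {RV (normal_prob 0 s) >-> R}).
rewrite (_ : cdf _ = EFin \o normal_cdf); last first.
  by apply/funext => x; rewrite /= normal_cdfE.
exact: fine_cvg.
Qed.

Lemma is_derive_normal_cdf (x : R) : is_derive x 1 normal_cdf (normal_pdf 0 s x).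
Proof.
have [] := @continuous_FTC1 R (normal_pdf 0 s) -oo%O x (x + 1).
- by rewrite ltrDl.
- exact: integrableS (integrable_normal_pdf 0 s).
- by rewrite ltNyr.
- exact: continuous_normal_pdf.
move=> d1 d2; apply: DeriveDef; first exact: d1.
by rewrite -derive1E; exact: d2.
Qed.

End Normal_cdf.

Section Divergence.
Context {R : realType}.

Lemma cvg_div_infty (F : set_system R) {FF : ProperFilter F} (N w : R -> R) (l : R) : 0 < l ->
  N x @[x --> F] --> l -> w x @[x --> F] --> 0 -> (\forall x \near F, 0 < w x) ->
  N x / w x @[x --> F] --> +oo.
Proof.
move=> l0 Nl w0 wp.
have Np : \forall x \near F, 0 < N x by apply: cvgr_gt Nl _ l0.
apply/gtr0_cvgV0.
  by near=> x; rewrite divr_gt0//; near: x.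
have h : w x * (N x)^-1 @[x --> F] --> (0 : R).
  by rewrite -[X in _ --> X](mul0r l^-1); apply: cvgM => //; apply: cvgV => //; rewrite gt_eqF.
move: h; apply: cvg_trans; apply: near_eq_cvg.
by near=> x; rewrite /= invf_div.
Unshelve. all: end_near. Qed.

End Divergence.

Section Hitting_density.
Context {R : realType} (c : R) (c0 : 0 < c).
Local Notation mu := (@lebesgue_measure R).

(* The density of the first passage of the level a by a Brownian motion of
   variance c. *)
Definition hit (a s : R) : R := a / s * heat_kernel c s a.

Lemma cvg_heat_kernel_time (a s : R) : 0 < s ->
  heat_kernel c x a @[x --> s] --> heat_kernel c s a.
Proof.
move=> s0; rewrite heat_kernelE//.
have h : (Num.sqrt (2 * pi * c * x))^-1 * expR (- a ^+ 2 / (2 * c * x)) @[x --> s] -->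
    (Num.sqrt (2 * pi * c * s))^-1 * expR (- a ^+ 2 / (2 * c * s)).
  apply: cvgM.
    apply: cvgV; first by rewrite gt_eqF// sqrtr_gt0 !mulr_gt0// pi_gt0.
    apply: continuous_cvg; first exact: sqrt_continuous.
    by apply: cvgM; [exact: cvg_cst|exact: cvg_id].
  apply: continuous_cvg; first exact: continuous_expR.
  apply: cvgM; first exact: cvg_cst.
  apply: cvgV; first by rewrite gt_eqF// !mulr_gt0.
  by apply: cvgM; [exact: cvg_cst|exact: cvg_id].
apply: cvg_trans h; apply: near_eq_cvg; near=> x; rewrite heat_kernelE//.
by near: x; apply: (cvgr_gt s) => //; exact: cvg_id.
Unshelve. all: end_near. Qed.

Section hit_conv.
Variables (a b t : R).
Hypotheses (a0 : 0 < a) (b0 : 0 < b) (t0 : 0 < t).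
Let w (s : R) : R := Num.sqrt (s * (t - s)).
Let sg := Num.sqrt (c * t).

Let sg0 : sg != 0.
Proof. by rewrite gt_eqF// sqrtr_gt0 mulr_gt0. Qed.

Let w_gt0 s : s \in `]0, t[ -> 0 < w s.
Proof. by rewrite in_itv/= => /andP[s1 s2]; rewrite sqrtr_gt0 mulr_gt0// subr_gt0. Qed.

Let w_sqr s : s \in `]0, t[ -> w s ^+ 2 = s * (t - s).
Proof.
by rewrite in_itv/= => /andP[s1 s2]; rewrite sqr_sqrtr// mulr_ge0 ?subr_ge0// ltW.
Qed.

Let is_derive_w (s : R) : s \in `]0, t[ ->
  is_derive s (1 : R) w ((t - 2 * s) / (2 * w s)).
Proof.
move=> st; have p : 0 < s * (t - s).
  by move: st; rewrite in_itv/= => /andP[s1 s2]; rewrite mulr_gt0// subr_gt0.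
have h : is_derive s (1 : R) (fun s => s * (t - s)) (t - 2 * s).
  apply: is_derive_eq; rewrite /GRing.scale/=; ring.
have h2 := is_derive1_sqrt p.
rewrite (_ : w = Num.sqrt \o (fun s => s * (t - s)))//.
apply: is_derive_eq; rewrite /GRing.scale/= mulrC; by [].
Qed.

Let is_derive_lin_w (k l s : R) : s \in `]0, t[ ->
  is_derive s (1 : R) (fun s => (k * s + l) / w s)
    ((k * w s ^+ 2 - (k * s + l) * (t - 2 * s) / 2) / w s ^+ 3).
Proof.
move=> st; have wp := w_gt0 st; have d1 := is_derive_w st.
have d2 := is_deriveV (lt0r_neq0 wp) d1.
apply: is_derive_eq; rewrite /GRing.scale/=; field; by rewrite gt_eqF.
Qed.

(* A primitive of [hit a (t - s) * hit b s], whose integral over ]0, t[ is the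
   density of passing the level a + b by way of b; up to scale, [w s] is the
   standard deviation at time s of a bridge over [0, t]. *)
Let F s := heat_kernel c t (a + b) / t *
  ((a + b) * normal_cdf sg (((a + b) * s + - (b * t)) / w s) +
   (b - a) * (expR (2 * a * b / (c * t)) *
     normal_cdf sg (((a - b) * s + b * t) / w s))).

(** The squares of the numerators differ by 4 a b s (t - s), that is 4 a b [w s ^+ 2], so the
    exponents differ by the constant 2 a b / (c t). Hence both terms in the derivative of [F] carry
    the same Gaussian factor. *)
Let pdf_y2 s : s \in `]0, t[ ->
  expR (2 * a * b / (c * t)) * normal_pdf 0 sg (((a - b) * s + b * t) / w s) =
  normal_pdf 0 sg (((a + b) * s + - (b * t)) / w s).
Proof.
move=> st; rewrite -!heat_kernel_normal// !heat_kernelE// mulrCA -expRD.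
congr (_ * expR _); rewrite !exprMn !exprVn (w_sqr st).
move: st; rewrite in_itv/= => /andP[s1 s2].
by field; rewrite !gt_eqF ?subr_gt0.
Qed.

(** [heat_kernel_bridge] with its variance c s (t - s) / t written as c t ([w s] / t)^2: rescaling
    the variable by t / [w s] brings the bridge density to the fixed variance c t of
    [normal_cdf sg]. *)
Let bridge s : s \in `]0, t[ ->
  heat_kernel c (t - s) a * heat_kernel c s b = heat_kernel c t (a + b) *
  (normal_pdf 0 sg (((a + b) * s + - (b * t)) / w s) * t / w s).
Proof.
move=> st; have w0 := w_gt0 st; have w2 := w_sqr st.
move: st; rewrite in_itv/= => /andP[s1 s2]; have s3 : 0 < t - s by rewrite subr_gt0.
have := @heat_kernel_bridge _ c s (t - s) (a + b) b c0 s1 s3.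
rewrite addrK [s + (t - s)]addrC subrK mulrC => ->; congr (_ * _).
rewrite -!heat_kernel_normal// !heat_kernelE ?divr_gt0 ?mulr_gt0// -w2.
rewrite (_ : 2 * pi * c * (w s ^+ 2 / t) = 2 * pi * c * t * (w s / t) ^+ 2); last first.
  by field; rewrite gt_eqF.
rewrite sqrtrM ?sqrtr_sqr; last by rewrite !mulr_ge0// ?pi_ge0// ltW.
rewrite gtr0_norm ?divr_gt0// invfM invf_div -!mulrA; congr (_ * _).
rewrite mulrA [RHS]mulrC; congr (_ * expR _).
by field; rewrite !gt_eqF.
Qed.

Let dF s : s \in `]0, t[ -> is_derive s (1 : R) F (hit a (t - s) * hit b s).
Proof.
move=> st; have w0 := w_gt0 st; have w2 := w_sqr st.
have d1 := is_derive_lin_w (a + b) (- (b * t)) st.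
have d2 := is_derive_lin_w (a - b) (b * t) st.
have e1 := is_derive_normal_cdf sg0 (((a + b) * s + - (b * t)) / w s).
have e2 := is_derive_normal_cdf sg0 (((a - b) * s + b * t) / w s).
apply: is_derive_eq; rewrite /GRing.scale/=.
rewrite [X in _ * (_ + _ * X)]mulrA (pdf_y2 st).
rewrite /hit mulrACA (bridge st).
move: st; rewrite in_itv/= => /andP[s1 s2]; have s3 : 0 < t - s by rewrite subr_gt0.
set p := normal_pdf _ _ _.
have -> : w s ^+ 3 = w s * (s * (t - s)) by rewrite exprS w2.
rewrite w2.
by field; rewrite !gt_eqF.
Qed.

Lemma hit_ge0 x s : 0 <= x -> 0 <= hit x s.
Proof.
move=> x0; rewrite /hit; have [s0|s0] := leP s 0; first by rewrite heat_kernel0// mulr0.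
by rewrite mulr_ge0 ?heat_kernel_ge0// divr_ge0// ltW.
Qed.

Let cvg_lin_w (G : set_system R) {FG : ProperFilter G} (k l p : R) : G --> p ->
  s * (t - s) @[s --> G] --> (0 : R) -> (\forall s \near G, s \in `]0, t[) ->
  0 < k * p + l -> (k * s + l) / w s @[s --> G] --> +oo.
Proof.
move=> Fp Fw Ft pos; apply: (cvg_div_infty pos).
- by apply: cvgD; [apply: cvgM => //; exact: cvg_cst|exact: cvg_cst].
- rewrite -[X in _ --> X]sqrtr0; apply: continuous_cvg => //; exact: sqrt_continuous.
- by near=> s; apply: w_gt0; near: s.
Unshelve. all: end_near. Qed.

Lemma hit_conv_oo :
  (\int[mu]_(s in `]0%R, t[) (hit a (t - s) * hit b s)%:E = (hit (a + b) t)%:E)%E.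
Proof.
pose E := (b - a) * expR (2 * a * b / (c * t)).
(* The arguments of the two [normal_cdf] tend to -oo and +oo at time 0, and both to +oo at time t.
   The term with [E] has the same limit at both ends and cancels. *)
have -> : hit (a + b) t = heat_kernel c t (a + b) / t * ((a + b) * 1 + E * 1) -
    heat_kernel c t (a + b) / t * ((a + b) * 0 + E * 1).
  by rewrite /hit; field; rewrite gt_eqF.
have Ft s : F s = heat_kernel c t (a + b) / t *
  ((a + b) * normal_cdf sg (((a + b) * s + - (b * t)) / w s) +
   E * normal_cdf sg (((a - b) * s + b * t) / w s)) by rewrite /F /E !mulrA.
have near0 : \forall s \near (0 : R)^'+, s \in `]0, t[.
  near=> s; rewrite in_itv/=; apply/andP; split; near: s.
    exact: nbhs_right_gt.
  exact: nbhs_right_lt.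
have neart : \forall s \near t^'-, s \in `]0, t[.
  near=> s; rewrite in_itv/=; apply/andP; split; near: s.
    exact: nbhs_left_gt.
  exact: nbhs_left_lt.
have r0 : (0 : R)^'+ --> (0 : R) by apply: cvg_at_right_filter; exact: cvg_id.
have lt : t^'- --> t by apply: cvg_at_left_filter; exact: cvg_id.
have w0 : s * (t - s) @[s --> (0 : R)^'+] --> 0.
  rewrite -[X in _ --> X](mul0r (t - 0)); apply: cvgM => //.
  by apply: cvgB => //; exact: cvg_cst.
have wt : s * (t - s) @[s --> t^'-] --> 0.
  have e : t * (t - t) = 0 by rewrite subrr mulr0.
  rewrite -[X in _ --> X]e; apply: cvgM => //.
  by apply: cvgB => //; exact: cvg_cst.
apply: (@ge0_FTC_oo _ _ _ _ F) => //.
- move=> s; rewrite in_itv/= => /andP[s1 s2].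
  by rewrite mulr_ge0// hit_ge0// ltW.
- move=> s; rewrite in_itv/= => /andP[s1 s2].
  apply: cvgM; apply: cvgM; try exact: cvg_heat_kernel_time.
  + apply: cvgM; first exact: cvg_cst.
    apply: cvgV; first by rewrite gt_eqF// subr_gt0.
    by apply: cvgB; [exact: cvg_cst|exact: cvg_id].
  + have h : {for t - s, continuous (fun s => heat_kernel c s a)}.
      by apply: cvg_heat_kernel_time; rewrite subr_gt0.
    apply: (@continuous_comp _ _ _ (fun s => t - s) (fun u => heat_kernel c u a)) => //.
    by apply: cvgB; [exact: cvg_cst|exact: cvg_id].
  + apply: cvgM; first exact: cvg_cst.
    by apply: cvgV; [rewrite gt_eqF|exact: cvg_id].
- under eq_fun do rewrite Ft.
  apply: cvgM; first exact: cvg_cst.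
  apply: cvgD; apply: cvgM; [exact: cvg_cst| |exact: cvg_cst|].
    apply: (cvg_comp _ _ _ (normal_cdfNy sg)); apply/cvgNry.
    have h : (- (a + b) * s + b * t) / w s @[s --> (0 : R)^'+] --> +oo.
      by apply: (cvg_lin_w r0) => //; rewrite mulr0 add0r mulr_gt0.
    apply: cvg_trans h; apply: near_eq_cvg; apply: nearW => s.
    rewrite -[RHS]/(- (((a + b) * s + - (b * t)) / w s)) -mulNr; congr (_ / _).
    by rewrite [RHS]opprD opprK mulNr.
  apply: (cvg_comp _ _ _ (normal_cdfy sg)).
  by apply: (cvg_lin_w r0) => //; rewrite mulr0 add0r mulr_gt0.
- under eq_fun do rewrite Ft.
  apply: cvgM; first exact: cvg_cst.
  apply: cvgD; apply: cvgM; [exact: cvg_cst| |exact: cvg_cst|].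
    apply: (cvg_comp _ _ _ (normal_cdfy sg)).
    by apply: (cvg_lin_w lt) => //; rewrite mulrDl addrK mulr_gt0.
  apply: (cvg_comp _ _ _ (normal_cdfy sg)).
  by apply: (cvg_lin_w lt) => //; rewrite mulrBl subrK mulr_gt0.
Unshelve. all: end_near. Qed.

End hit_conv.

Lemma hit_le0 x s : s <= 0 -> hit x s = 0.
Proof. by move=> s0; rewrite /hit heat_kernel0// mulr0. Qed.

Lemma measurable_hit d (T : measurableType d) (f g : T -> R) :
  measurable_fun setT f -> measurable_fun setT g ->
  measurable_fun setT (fun z => hit (f z) (g z)).
Proof.
move=> mf mg; apply: measurable_funM; last exact: measurable_heat_kernel_comp.
by apply: measurable_funM => //; exact: measurable_fun_inv.
Qed.

Local Open Scope ereal_scope.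

Lemma hit_conv (a b t : R) : (0 < a)%R -> (0 < b)%R ->
  conv (fun s => (hit a s)%:E) (fun s => (hit b s)%:E) t = (hit (a + b) t)%:E.
Proof.
move=> a0 b0; rewrite /conv; have [t0|t0] := leP t 0%R.
  rewrite hit_le0// integral0_eq// => s _; have [s0|s0] := leP s 0%R.
    by rewrite hit_le0// mul0e.
  by rewrite [X in _ * X%:E]hit_le0 ?mule0//; lra.
rewrite (addrC a b) -(hit_conv_oo b0 a0 t0) [RHS]integral_mkcond; apply: eq_integral => s _.
rewrite patchE mem_setE in_itv/=; case: ifPn => [_|]; first by rewrite -EFinM mulrC.
rewrite negb_and -!leNgt => /orP[s0|s0]; first by rewrite hit_le0// mul0e.
by rewrite [X in _ * X%:E]hit_le0 ?mule0// subr_le0.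
Qed.

(** A real factor in place of a domain of integration: all integrals stay on the whole line, where
    shifts and Tonelli's theorem apply directly. *)
Definition ray (w : R) : R := (if 0 < w then 1 else 0)%R.

Lemma ray_ge0 w : (0 <= ray w)%R.
Proof. by rewrite /ray; case: ifP. Qed.

Lemma measurable_ray d (T : measurableType d) (f : T -> R) :
  measurable_fun setT f -> measurable_fun setT (fun z => ray (f z)).
Proof. by move=> mf; apply: measurable_fun_ifT => //; exact: measurable_fun_ltr. Qed.

Lemma integral_ray (f : R -> R) : measurable_fun setT f ->
  \int[mu]_w (ray w * f w)%:E = \int[mu]_(w in `[0%R, +oo[) (f w)%:E.
Proof.
move=> mf; rewrite -integral_itv_obnd_cbnd; last exact/measurable_EFinP/measurable_funTS.
rewrite [RHS]integral_mkcond; apply: eq_integral => w _.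
rewrite patchE mem_setE in_itv/= andbT /ray; case: ifP; rewrite ?mul1r ?mul0r//.
Qed.

Lemma integral_ray_hit (s r : R) : (0 <= r)%R ->
  \int[mu]_w (ray w * hit (r + w) s)%:E = (c * heat_kernel c s r)%:E.
Proof.
move=> r0; have [s0|s0] := leP s 0%R.
  by rewrite heat_kernel0// mulr0 integral0_eq// => w _; rewrite hit_le0// mulr0.
have dF (x : R) : is_derive x (1%R : R) (fun w => - (c * heat_kernel c s (r + w)))%R (hit (r + x) s).
  have e : (fun w => - (c * heat_kernel c s (r + w)))%R =
      (fun w => - (c * ((Num.sqrt (2 * pi * c * s))^-1 * expR (- (r + w) ^+ 2 / (2 * c * s)))))%R.
    by apply/funext => w; rewrite heat_kernelE.
  rewrite e /hit heat_kernelE//.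
  have d0 : is_derive x (1%R : R) (fun w : R => - (r + w) ^+ 2 / (2 * c * s))%R
      (- (2 * (r + x)) / (2 * c * s))%R.
    by apply: is_derive_eq; rewrite /GRing.scale/=; ring.
  have d1 := @is_derive1_comp _ expR (fun w : R => - (r + w) ^+ 2 / (2 * c * s))%R _ _ _ (is_derive_expR _) d0.
  apply: is_derive_eq; rewrite /GRing.scale/=; field.
  by rewrite !gt_eqF// sqrtr_gt0 !mulr_gt0// pi_gt0.
rewrite integral_ray; last by apply: measurable_hit => //; exact: measurable_funD.
rewrite (@ge0_continuous_FTC2y _ _ (fun w => - (c * heat_kernel c s (r + w)))%R _ 0%R).
- by rewrite addr0 EFinN oppeK add0e.
- by move=> x x0; rewrite hit_ge0// addr_ge0.
- apply: continuous_in_subspaceT => x _.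
  have d1 : derivable (fun w : R => (r + w) / s * ((Num.sqrt (2 * pi * c * s))^-1 *
      expR (- (r + w) ^+ 2 / (2 * c * s))))%R x 1%R.
    apply: derivableM.
      by apply: ex_derive.
    apply: derivableM; first exact: ex_derive.
    have d0 : is_derive x (1%R : R) (fun w : R => - (r + w) ^+ 2 / (2 * c * s))%R
        (- (2 * (r + x)) / (2 * c * s))%R.
      by apply: is_derive_eq; rewrite /GRing.scale/=; ring.
    have d1 := @is_derive1_comp _ expR (fun w : R => - (r + w) ^+ 2 / (2 * c * s))%R _ _ _ (is_derive_expR _) d0.
    exact: (@ex_derive _ _ _ _ _ _ _ d1).
  rewrite (_ : (fun _ => _) = (fun w : R => (r + w) / s * ((Num.sqrt (2 * pi * c * s))^-1 *
      expR (- (r + w) ^+ 2 / (2 * c * s))))%R).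
    by apply: differentiable_continuous; exact/derivable1_diffP.
  by apply/funext => w; rewrite /hit heat_kernelE.
- have h : (- (c * ((Num.sqrt (2 * pi * c * s))^-1 * gauss_fun ((w + r) / Num.sqrt (2 * c * s)))))%R
      @[w --> +oo%R] --> (0 : R)%R.
    have e : (- (c * ((Num.sqrt (2 * pi * c * s))^-1 * 0)) = 0)%R by rewrite !mulr0 oppr0.
    rewrite -[X in _ --> X]e.
    apply: cvgN; apply: cvgM; first exact: cvg_cst.
    apply: cvgM; first exact: cvg_cst.
    apply: (cvg_comp _ _ _ cvg_gauss_fun).
    apply/gt0_cvgMly; last exact: cvg_addrr.
    by rewrite invr_gt0 sqrtr_gt0 !mulr_gt0.
  apply: cvg_trans h; apply: near_eq_cvg; apply: nearW => w; rewrite heat_kernelE//.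
  rewrite /gauss_fun exprMn exprVn sqr_sqrtr; last by rewrite !mulr_ge0// ltW.
  by rewrite mulNr [(w + r)%R]addrC.
- by move=> x _; exact: ex_derive.
- have cF (x : R) : {for x, continuous (fun w => - (c * heat_kernel c s (r + w)))%R}.
    by apply: differentiable_continuous; exact/derivable1_diffP/ex_derive.
  exact/cvg_at_right_filter/cF.
- by move=> x _; rewrite derive1E; exact: derive_val.
Qed.

(** * Exponential mixtures of heat kernels *)

Definition expo_mix (beta t r : R) : \bar R :=
  \int[mu]_w (ray w * (expR (beta * w) * heat_kernel c t (r + w)))%:E.

Lemma expo_mixdef beta t r : expo_mix beta t r =
  \int[mu]_w (ray w * (expR (beta * w) * heat_kernel c t (r + w)))%:E.
Proof. by []. Qed.

Lemma conv_mix (M : R * R -> \bar R) (g : R -> \bar R) t : measurable_fun setT M ->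
  measurable_fun setT g -> (forall z, 0 <= M z) -> (forall s, 0 <= g s) ->
  conv (fun s => \int[mu]_v M (v, s)) g t = \int[mu]_v conv (fun s => M (v, s)) g t.
Proof.
move=> mM mg M0 g0; rewrite /conv.
rewrite -(fubini_tonelli (m1 := mu) (m2 := mu) (fun z : R * R => M (z.2, z.1) * g (t - z.1)%R))/=.
- apply: eq_integral => s _; rewrite ge0_integralZr//.
  exact: measurableT_comp.
- apply: emeasurable_funM; first by apply: measurableT_comp => //; exact: measurable_swap.
  by apply: measurableT_comp => //; exact: measurable_funB.
- by move=> z; rewrite mule_ge0.
Qed.

(** The heat kernel at b is 1/c times the integral of the passage densities over all levels above b,
    and convolution with [hit a] raises each level by a. In terms of Brownian motion, a path is cut
    at its first passage of the level a. *)
Lemma conv_hit_heat_kernel (a b t : R) : (0 < a)%R -> (0 <= b)%R ->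
  conv (fun s => (hit a s)%:E) (fun s => (heat_kernel c s b)%:E) t =
  (heat_kernel c t (a + b))%:E.
Proof.
move=> a0 b0; rewrite convC//; last 4 first.
- exact/measurable_EFinP/measurable_hit.
- exact/measurable_EFinP/measurable_heat_kernel_comp.
- by move=> s; rewrite lee_fin hit_ge0// ltW.
- by move=> s; rewrite lee_fin heat_kernel_ge0.
have e s : (heat_kernel c s b)%:E = c^-1%:E * \int[mu]_w (ray w * hit (b + w) s)%:E.
  by rewrite integral_ray_hit// -EFinM mulKf// gt_eqF.
under [X in conv X]eq_fun do rewrite e.
have mh : measurable_fun setT (fun z : R * R => (ray z.1 * hit (b + z.1) z.2)%:E).
  apply/measurable_EFinP/measurable_funM; first exact: measurable_ray.
  by apply: measurable_hit => //; exact: measurable_funD.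
have h0 (z : R * R) : 0 <= (ray z.1 * hit (b + z.1) z.2)%:E.
  rewrite lee_fin /ray; case: ifPn => z0; last by rewrite mul0r.
  by rewrite mul1r hit_ge0// addr_ge0// ltW.
have ha s : 0 <= (hit a s)%:E by rewrite lee_fin hit_ge0// ltW.
have mha : measurable_fun setT (fun s => (hit a s)%:E) by exact/measurable_EFinP/measurable_hit.
rewrite convZl//; last 3 first.
- exact: (measurable_fun_fubini_tonelli_G (m1 := mu) (fun z : R * R => (ray z.1 * hit (b + z.1) z.2)%:E)).
- by move=> s; apply: integral_ge0 => w _; exact: (h0 (w, s)).
- by rewrite lee_fin invr_ge0 ltW.
rewrite (conv_mix (M := fun z : R * R => (ray z.1 * hit (b + z.1) z.2)%:E))//=.
rewrite (_ : \int[mu]_v _ = \int[mu]_w (ray w * hit (a + b + w) t)%:E).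
  by rewrite integral_ray_hit ?addr_ge0// ?(ltW a0)// -EFinM mulKf// gt_eqF.
apply: eq_integral => w _; rewrite /ray; case: ifPn => w0; last first.
  rewrite /conv integral0_eq ?mul0r// => s _; by rewrite mul0r mul0e.
under eq_fun do rewrite mul1r.
rewrite hit_conv//; last by rewrite ltr_wpDl.
by rewrite mul1r addrC addrA.
Qed.

Lemma expo_mix_ge0 beta t r : 0 <= expo_mix beta t r.
Proof.
by apply: integral_ge0 => w _; rewrite lee_fin !mulr_ge0 ?ray_ge0 ?expR_ge0 ?heat_kernel_ge0.
Qed.

Lemma measurable_expo_mix_integrand beta d (T : measurableType d) (f g h : T -> R) :
  measurable_fun setT f -> measurable_fun setT g -> measurable_fun setT h ->
  measurable_fun setT (fun z => (ray (f z) * (expR (beta * f z) * heat_kernel c (g z) (h z)))%:E).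
Proof.
move=> mf mg mh; apply/measurable_EFinP/measurable_funM; first exact: measurable_ray.
apply: measurable_funM; last exact: measurable_heat_kernel_comp.
by apply: measurableT_comp => //; exact: measurable_funM.
Qed.

Lemma measurable_expo_mix beta r : measurable_fun setT (expo_mix beta ^~ r).
Proof.
apply: (measurable_fun_fubini_tonelli_F (m2 := mu) (fun z : R * R =>
  (ray z.2 * (expR (beta * z.2) * heat_kernel c z.1 (r + z.2)))%:E)).
  by apply: measurable_expo_mix_integrand => //; exact: measurable_funD.
by move=> z; rewrite lee_fin !mulr_ge0 ?ray_ge0 ?expR_ge0 ?heat_kernel_ge0.
Qed.

(** The first factor is expanded over levels and each level is absorbed by [conv_hit_heat_kernel];
    what remains is the Gaussian tail beyond a + b, the mixture with exponent 0. The case a = b = 0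
    is allowed because the levels a + w that occur have w > 0. *)
Lemma conv_heat_kernel (a b t : R) : (0 <= a)%R -> (0 <= b)%R ->
  conv (fun s => (heat_kernel c s a)%:E) (fun s => (heat_kernel c s b)%:E) t =
  c^-1%:E * expo_mix 0 t (a + b).
Proof.
move=> a0 b0.
have e s : (heat_kernel c s a)%:E = c^-1%:E * \int[mu]_w (ray w * hit (a + w) s)%:E.
  by rewrite integral_ray_hit// -EFinM mulKf// gt_eqF.
under [X in conv X]eq_fun do rewrite e.
have mh : measurable_fun setT (fun z : R * R => (ray z.1 * hit (a + z.1) z.2)%:E).
  apply/measurable_EFinP/measurable_funM; first exact: measurable_ray.
  by apply: measurable_hit => //; exact: measurable_funD.
have h0 (z : R * R) : 0 <= (ray z.1 * hit (a + z.1) z.2)%:E.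
  rewrite lee_fin /ray; case: ifPn => z0; last by rewrite mul0r.
  by rewrite mul1r hit_ge0// addr_ge0// ltW.
have ha s : 0 <= (heat_kernel c s b)%:E by rewrite lee_fin heat_kernel_ge0.
have mha : measurable_fun setT (fun s => (heat_kernel c s b)%:E).
  exact/measurable_EFinP/measurable_heat_kernel_comp.
rewrite convZl//; last 3 first.
- exact: (measurable_fun_fubini_tonelli_G (m1 := mu) (fun z : R * R => (ray z.1 * hit (a + z.1) z.2)%:E)).
- by move=> s; apply: integral_ge0 => w _; exact: (h0 (w, s)).
- by rewrite lee_fin invr_ge0 ltW.
congr (_ * _).
rewrite (conv_mix (M := fun z : R * R => (ray z.1 * hit (a + z.1) z.2)%:E))//=.
apply: eq_integral => w _; rewrite /ray; case: ifPn => w0; last first.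
  rewrite /conv integral0_eq ?mul0r// => s _; by rewrite mul0r mul0e.
under eq_fun do rewrite mul1r.
rewrite conv_hit_heat_kernel//; last by rewrite ltr_wpDl.
by rewrite mul1r mul0r expR0 mul1r addrAC.
Qed.

Lemma integral_expR_oo (beta u : R) : (0 < beta)%R ->
  beta%:E * \int[mu]_w (ray w * ray (u - w) * expR (beta * w))%:E =
  (ray u * (expR (beta * u) - 1))%:E.
Proof.
move=> b0; have [u0|u0] := leP u 0%R.
  rewrite integral0_eq ?mule0; first by rewrite {1}/ray ltNge u0 mul0r.
  move=> w _; rewrite /ray; case: ifPn => [w0|]; last by rewrite !mul0r.
  by rewrite subr_gt0 ltNge (le_trans u0 (ltW w0)) mulr0 mul0r.
rewrite (_ : \int[mu]_w _ = \int[mu]_(w in `]0%R, u[) (expR (beta * w))%:E); last first.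
  rewrite [RHS]integral_mkcond; apply: eq_integral => w _.
  rewrite patchE mem_setE in_itv/= /ray subr_gt0.
  by case: (0 < w)%R; case: (w < u)%R; rewrite /= ?mul0r ?mulr0 ?mul1r ?mul0r.
have dF (x : R) : is_derive x (1%R : R) (fun w => beta^-1 * expR (beta * w))%R (expR (beta * x)).
  have d0 : is_derive x (1%R : R) (fun w : R => beta * w)%R beta.
    by apply: is_derive_eq; rewrite /GRing.scale/=; ring.
  have d1 := @is_derive1_comp _ expR (fun w : R => beta * w)%R _ _ _ (is_derive_expR _) d0.
  by apply: is_derive_eq; rewrite /GRing.scale/=; field; rewrite gt_eqF.
have cF (x : R) : {for x, continuous (fun w => beta^-1 * expR (beta * w))%R}.
  by apply: differentiable_continuous; exact/derivable1_diffP/ex_derive.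
rewrite (@ge0_FTC_oo _ _ _ _ (fun w => beta^-1 * expR (beta * w))%R
  (beta^-1 * expR (beta * 0))%R (beta^-1 * expR (beta * u))%R)//.
- by rewrite /ray u0 -EFinM mulr0 expR0; congr EFin; field; rewrite gt_eqF.
- move=> x _.
  have d0 : derivable (fun w : R => beta * (beta^-1 * expR (beta * w)))%R x 1%R by exact: ex_derive.
  rewrite (_ : (fun _ => _) = (fun w : R => beta * (beta^-1 * expR (beta * w)))%R).
    by apply: differentiable_continuous; exact/derivable1_diffP.
  by apply/funext => w; rewrite mulrA divff ?mul1r// gt_eqF.
- exact/cvg_at_right_filter/cF.
- exact/cvg_at_left_filter/cF.
Qed.

(* Fubini in the sum of the two mixing variables, whose inner integral is
   that of [beta * expR (beta * w)] over [0, u]. *)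
Lemma expo_mix_conv (beta r t : R) : (0 < beta)%R -> (0 <= r)%R ->
  (beta * c)%:E * conv (fun s => (heat_kernel c s r)%:E) (fun s => expo_mix beta s 0) t
    + expo_mix 0 t r = expo_mix beta t r.
Proof.
move=> b0 r0.
have mr : measurable_fun setT (fun s => (heat_kernel c s r)%:E).
  exact/measurable_EFinP/measurable_heat_kernel_comp.
have r_ge0 s : 0 <= (heat_kernel c s r)%:E by rewrite lee_fin heat_kernel_ge0.
rewrite convC//; [|exact: measurable_expo_mix|by move=> s; exact: expo_mix_ge0].
have mE : measurable_fun setT (fun z : R * R =>
    (ray z.1 * (expR (beta * z.1) * heat_kernel c z.2 (0 + z.1)))%:E).
  by apply: measurable_expo_mix_integrand => //; exact: measurable_funD.
rewrite (conv_mix (M := fun z : R * R =>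
    (ray z.1 * (expR (beta * z.1) * heat_kernel c z.2 (0 + z.1)))%:E))//=; last first.
  by move=> z; rewrite lee_fin !mulr_ge0 ?ray_ge0 ?expR_ge0 ?heat_kernel_ge0.
have mG d (T : measurableType d) (f g : T -> R) : measurable_fun setT f -> measurable_fun setT g ->
    measurable_fun setT (fun z => (ray (f z) * heat_kernel c t (g z))%:E).
  move=> mf mg; apply/measurable_EFinP/measurable_funM; first exact: measurable_ray.
  exact: measurable_heat_kernel_comp.
have me d (T : measurableType d) (f : T -> R) : measurable_fun setT f ->
    measurable_fun setT (fun z => expR (beta * f z)).
  by move=> mf; apply: measurableT_comp => //; exact: measurable_funM.
(* In the variable u = v + w the heat kernel is free of v, which then occurs only in the exponential
   and in the constraint 0 < v < u. *)
have tailE v : expo_mix 0 t (v + r) = \int[mu]_u (ray (u - v) * heat_kernel c t (r + u))%:E.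
  rewrite -(@ge0_integral_shift R v (fun u => (ray (u - v) * heat_kernel c t (r + u))%:E)).
  - by apply: eq_integral => w _; rewrite addrK mul0r expR0 mul1r [(v + r + w)%R]addrAC [(v + w)%R]addrC [(r + _)%R]addrC.
  - by apply: mG; [exact: measurable_funB|exact: measurable_funD].
  - by move=> u; rewrite lee_fin mulr_ge0 ?ray_ge0 ?heat_kernel_ge0.
transitivity ((beta * c)%:E * \int[mu]_v (c^-1%:E * ((ray v * expR (beta * v))%:E *
    \int[mu]_u (ray (u - v) * heat_kernel c t (r + u))%:E)) + expo_mix 0 t r).
  congr (_ * _ + _); apply: eq_integral => v _; rewrite -tailE.
  have [v0|v0] := leP v 0%R.
    rewrite /ray ltNge v0/= mul0r mul0e mule0 /conv integral0_eq// => s _.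
    by rewrite mul0r mul0e.
  rewrite (_ : (fun s => _) = fun s => (ray v * expR (beta * v))%:E * (heat_kernel c s (0 + v))%:E); last first.
    by apply/funext => s; rewrite -EFinM mulrA.
  rewrite convZl//.
  - by rewrite conv_heat_kernel ?add0r ?(ltW v0)// muleCA.
  - exact/measurable_EFinP/measurable_heat_kernel_comp.
  - by move=> s; rewrite lee_fin heat_kernel_ge0.
  - by rewrite lee_fin mulr_ge0 ?ray_ge0 ?expR_ge0.
have mI : measurable_fun setT (fun z : R * R => ((ray z.1 * expR (beta * z.1)) *
    (ray (z.2 - z.1) * heat_kernel c t (r + z.2)))%:E).
  apply/measurable_EFinP; apply: measurable_funM.
    by apply: measurable_funM; [exact: measurable_ray|exact: me].
  by apply/measurable_EFinP; apply: mG; [exact: measurable_funB|exact: measurable_funD].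
have I0 (z : R * R) : 0 <= ((ray z.1 * expR (beta * z.1)) *
    (ray (z.2 - z.1) * heat_kernel c t (r + z.2)))%:E.
  by rewrite lee_fin !mulr_ge0 ?ray_ge0 ?expR_ge0 ?heat_kernel_ge0.
have innerE v : (ray v * expR (beta * v))%:E *
    \int[mu]_u (ray (u - v) * heat_kernel c t (r + u))%:E =
    \int[mu]_u ((ray v * expR (beta * v)) * (ray (u - v) * heat_kernel c t (r + u)))%:E.
  rewrite -ge0_integralZl//.
  - by apply: mG; [exact: measurable_funB|exact: measurable_funD].
  - by move=> u _; rewrite lee_fin mulr_ge0 ?ray_ge0 ?heat_kernel_ge0.
  - by rewrite lee_fin mulr_ge0 ?ray_ge0 ?expR_ge0.
under eq_integral do rewrite innerE.
rewrite ge0_integralZl//; last 3 first.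
- exact: (measurable_fun_fubini_tonelli_F (m2 := mu) (fun z : R * R => ((ray z.1 * expR (beta * z.1)) *
    (ray (z.2 - z.1) * heat_kernel c t (r + z.2)))%:E)).
- by move=> v _; apply: integral_ge0 => u _; exact: (I0 (v, u)).
- by rewrite lee_fin invr_ge0 ltW.
rewrite muleA -EFinM mulfK ?gt_eqF//.
rewrite (fubini_tonelli (m1 := mu) (m2 := mu) (fun z : R * R => ((ray z.1 * expR (beta * z.1)) *
    (ray (z.2 - z.1) * heat_kernel c t (r + z.2)))%:E))//=.
rewrite -ge0_integralZl//; last 3 first.
- exact: (measurable_fun_fubini_tonelli_G (m1 := mu) (fun z : R * R => ((ray z.1 * expR (beta * z.1)) *
    (ray (z.2 - z.1) * heat_kernel c t (r + z.2)))%:E)).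
- by move=> v _; apply: integral_ge0 => u _; exact: (I0 (u, v)).
- by rewrite lee_fin ltW.
(* The inner integral leaves the weight exp(beta u) - 1; the added term [expo_mix 0 t r] has weight
   1 and restores exp(beta u). *)
have JE u : beta%:E * \int[mu]_v (ray v * expR (beta * v) * (ray (u - v) * heat_kernel c t (r + u)))%:E =
    (ray u * (expR (beta * u) - 1) * heat_kernel c t (r + u))%:E.
  rewrite EFinM -integral_expR_oo// -muleA -ge0_integralZr//.
  - by congr (_ * _); apply: eq_integral => v _; rewrite -EFinM; congr EFin; ring.
  - apply/measurable_EFinP/measurable_funM; last exact: me.
    by apply: measurable_funM; apply: measurable_ray => //; exact: measurable_funB.
  - by move=> v _; rewrite lee_fin !mulr_ge0 ?ray_ge0 ?expR_ge0.
  - by rewrite lee_fin heat_kernel_ge0.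
under eq_integral do rewrite JE.
rewrite /expo_mix -ge0_integralD//.
- apply: eq_integral => u _; rewrite -EFinD mul0r expR0; congr EFin; ring.
- move=> u _; rewrite lee_fin /ray; case: ifPn => u0; last by rewrite !mul0r.
  by rewrite mul1r mulr_ge0 ?heat_kernel_ge0// subr_ge0 -expR0 ler_expR mulr_ge0// ltW.
- apply/measurable_EFinP/measurable_funM; last by apply: measurable_heat_kernel_comp => //; exact: measurable_funD.
  apply: measurable_funM; first exact: measurable_ray.
  by apply: measurable_funB => //; exact: me.
- by move=> u _; rewrite lee_fin !mulr_ge0 ?ray_ge0 ?expR_ge0 ?heat_kernel_ge0.
- by apply: measurable_expo_mix_integrand => //; exact: measurable_funD.
Qed.

(** The half-line integral of exp(-y^2) is sqrt(pi) / 2. The sign of x decides whether a piece is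
    removed from it or added to it, and which of the two integrals in [erfc] vanishes. *)
Lemma integral_ray_gauss (x : R) :
  \int[mu]_y (ray (y - x) * gauss_fun y)%:E = (Num.sqrt pi / 2 * erfc x)%:E.
Proof.
have ig D : measurable D -> mu.-integrable D (EFin \o gauss_fun).
  by move=> mD; exact: integrableS integrableT_gauss.
have gE D : measurable D ->
    (\int[mu]_(y in D) gauss_fun y)%R%:E = \int[mu]_(y in D) (gauss_fun y)%:E.
  by move=> mD; rewrite /Rintegral fineK//; apply: integrable_fin_num => //; exact: ig.
have mg D : measurable_fun D (fun y : R => (gauss_fun y)%:E).
  by apply/measurable_EFinP/measurable_funTS; exact: measurable_gauss_fun.
have g0 (y : R) : 0 <= (gauss_fun y)%:E by rewrite lee_fin gauss_fun_ge0.
rewrite (_ : \int[mu]_y _ = \int[mu]_(y in `]x, +oo[) (gauss_fun y)%:E); last first.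
  rewrite [RHS]integral_mkcond; apply: eq_integral => w _.
  rewrite patchE mem_setE in_itv/= andbT /ray subr_gt0.
  by case: ifP; rewrite ?mul1r ?mul0r.
have -> : (Num.sqrt pi / 2 * erfc x = Num.sqrt pi / 2 -
    \int[mu]_(y in `[0%R, x]) gauss_fun y + \int[mu]_(y in `[x, 0%R]) gauss_fun y)%R.
  by rewrite /erfc /gauss_fun; field; rewrite gt_eqF// sqrtr_gt0 pi_gt0.
have h := @integral0y_gauss R.
have [x0|x0] := leP 0%R x.
  have -> : (\int[mu]_(y in `[x, 0%R]) gauss_fun y = 0)%R.
    rewrite /Rintegral (@integral_Sset1 _ _ _ 0%R)// => y /=; rewrite in_itv/= => /andP[y1 y2].
    by apply/eqP; rewrite eq_le y2 (le_trans x0).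
  have U : `[0%R, x] `|` `]x, +oo[ = `[0%R, +oo[%classic :> set R.
    by rewrite -itv_bndbnd_setU// bnd_simp.
  move: h; rewrite -U ge0_integral_setU//; last 2 first.
    by apply: measurable_funTS; exact: mg.
    by apply/disj_setPS => y []/=; rewrite !in_itv/= andbT => /andP[_ h1] h2; lra.
  move=> {}h; have : (\int[mu]_(y in `[0%R, x]) gauss_fun y + \int[mu]_(y in `]x, +oo[) gauss_fun y)%R%:E =
      (Num.sqrt pi / 2)%:E by rewrite EFinD gE// gE.
  by move=> -[<-]; rewrite -gE// addr0 addrAC subrr add0r.
have -> : (\int[mu]_(y in `[0%R, x]) gauss_fun y = 0)%R.
  by rewrite set_itv_ge ?Rintegral_set0// bnd_simp -ltNge.
have U : `]x, 0%R[ `|` `[0%R, +oo[ = `]x, +oo[%classic :> set R.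
  by rewrite -itv_bndbnd_setU// bnd_simp.
rewrite -U ge0_integral_setU//; last 2 first.
  by apply: measurable_funTS; exact: mg.
  by apply/disj_setPS => y []/=; rewrite !in_itv/= andbT => /andP[_ h1]; rewrite leNgt h1.
rewrite h subr0 EFinD gE// addeC; congr (_ + _).
by rewrite [RHS]integral_itv_bndoo.
Qed.

(** Completing the square: beta w - (r + w)^2 / (2 c t) = A - (w + z)^2 / (2 c t) with z = r - beta
    c t and A = beta^2 c t / 2 - beta r. A shift by z and a scaling by k = sqrt(2 c t) then leave a
    Gaussian tail. *)
Lemma expo_mixE (beta t r : R) : (0 < t)%R ->
  expo_mix beta t r = (2^-1 * (expR ((beta ^+ 2 * c * t) / 2 - beta * r) *
    erfc ((r - beta * c * t) / Num.sqrt (2 * c * t))))%:E.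
Proof.
move=> t0; set k := Num.sqrt _; set z := (r - _)%R.
have k0 : (0 < k)%R by rewrite sqrtr_gt0 !mulr_gt0.
have k2 : (k ^+ 2 = 2 * c * t)%R by rewrite sqr_sqrtr// !mulr_ge0// ltW.
set A := (_ - beta * r)%R.
have e w : (expR (beta * w) * heat_kernel c t (r + w) =
    expR A * (Num.sqrt (2 * pi * c * t))^-1 * gauss_fun ((w + z) / k))%R.
  rewrite heat_kernelE// mulrCA -expRD -[in RHS]mulrA [RHS]mulrCA /gauss_fun -expRD; congr (_ * expR _)%R.
  rewrite exprMn exprVn k2 /A /z.
  by field; rewrite !gt_eqF.
rewrite /expo_mix.
transitivity (\int[mu]_w ((expR A * (Num.sqrt (2 * pi * c * t))^-1)%:E *
    (ray ((w + z) / k - z / k) * gauss_fun ((w + z) / k))%:E)).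
  apply: eq_integral => w _; rewrite e -EFinM; congr EFin.
  rewrite mulrCA; congr (_ * (_ * _))%R.
  by rewrite /ray -mulrBl addrK pmulr_lgt0// invr_gt0.
rewrite ge0_integralZl; last 4 first.
- by [].
- apply/measurable_EFinP/measurable_funM.
    apply: measurable_ray; apply: measurable_funB => //; apply: measurable_funM => //.
    exact: measurable_funD.
  apply: measurableT_comp; first exact: measurable_gauss_fun.
  by apply: measurable_funM => //; exact: measurable_funD.
- by move=> w _; rewrite lee_fin mulr_ge0 ?ray_ge0 ?gauss_fun_ge0.
- by rewrite lee_fin mulr_ge0 ?expR_ge0.
have mf : measurable_fun setT (fun w : R => (ray (w / k - z / k) * gauss_fun (w / k))%:E).
  apply/measurable_EFinP/measurable_funM.
    by apply: measurable_ray; apply: measurable_funB => //; exact: measurable_funM.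
  by apply: measurableT_comp; [exact: measurable_gauss_fun|exact: measurable_funM].
have f0 (w : R) : 0 <= (ray (w / k - z / k) * gauss_fun (w / k))%:E.
  by rewrite lee_fin mulr_ge0 ?ray_ge0 ?gauss_fun_ge0.
rewrite (ge0_integral_shift z mf f0) -(ge0_integral_scale k0 mf f0).
under eq_integral do rewrite [(k * _)%R]mulrC mulfK ?gt_eqF//.
rewrite integral_ray_gauss -!EFinM; congr EFin.
have -> : Num.sqrt (2 * pi * c * t) = (Num.sqrt pi * k)%R.
  by rewrite -sqrtrM ?pi_ge0//; congr Num.sqrt; ring.
by field; rewrite !gt_eqF// sqrtr_gt0 pi_gt0.
Qed.

End Hitting_density.

(** * Volterra equations and the kernels *)

Opaque conv expo_mix heat_kernel.

Section Volterra.
Context {R : realType}.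
Local Notation mu := (@lebesgue_measure R).
Local Open Scope ereal_scope.

(** The primitive D of e vanishes step by step along a subdivision of mesh at most 1 / (2 kappa). If
    D is 0 at the left end of a step, the hypothesis gives D b <= D b / 2 at the right end, and D b
    is finite, hence 0. *)
Lemma gronwall0 (kappa T : R) (e : R -> \bar R) : (0 <= kappa)%R -> (0 < T)%R ->
  measurable_fun setT e -> (forall s, 0 <= e s) ->
  \int[mu]_(s in `]0%R, T]) e s < +oo ->
  (forall s, (s <= T)%R -> e s <= kappa%:E * \int[mu]_(r in `]0%R, s]) e r) ->
  forall s, (s <= T)%R -> e s = 0.
Proof.
move=> k0 T0 me e0 eoo eE.
pose D (s : R) := \int[mu]_(r in `]0%R, s]) e r.
have D0 s : 0 <= D s by exact: integral_ge0.
have leD a b : (a <= b)%R -> D a <= D b.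
  move=> ab; apply: ge0_subset_integral => //; first exact: measurable_funTS.
  by move=> x /=; rewrite !in_itv/= => /andP[-> /= /le_trans]; apply.
have Dfin s : (s <= T)%R -> D s \is a fin_num.
  by move=> sT; rewrite ge0_fin_numE//; apply: le_lt_trans eoo; exact: leD.
have step (a b : R) : (0 <= a)%R -> (a <= b)%R -> (b <= T)%R -> (kappa * (b - a) <= 2^-1)%R ->
    D a = 0 -> D b = 0.
  move=> a0 ab bT kab Da.
  have h : D b <= (kappa * (b - a))%:E * D b.
    have -> : (kappa * (b - a))%:E * D b = \int[mu]_(r in `]a, b]) (cst (kappa%:E * D b) r).
      rewrite integral_cst//= lebesgue_measure_itv/= lte_fin; case: ltP => ab'.
        by rewrite -EFinD EFinM muleAC.
      by rewrite (_ : b - a = 0)%R ?mulr0 ?mul0e ?mule0//; apply/eqP; rewrite subr_eq0 eq_le ab ab'.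
    rewrite /D [X in X <= _]integral_mkcond [X in _ <= X]integral_mkcond.
    apply: ge0_le_integral => //.
    - by move=> x _; exact: erestrict_ge0.
    - by apply/(measurable_restrictT _ _).1 => //; exact: measurable_funTS.
    - by apply/(measurable_restrictT _ _).1 => //; exact: measurable_cst.
    - move=> x _; rewrite !patchE !mem_setE !in_itv/=.
      have [ax|xa] := ltP a x; last first.
        case: ifP => // /andP[x0 xb]; apply: (le_trans (eE _ _)); first exact: le_trans xb bT.
        rewrite -/(D x) (_ : D x = 0) ?mule0//; apply/eqP; rewrite eq_le D0 andbT -Da; exact: leD.
      rewrite (le_lt_trans a0 ax)/=; case: ifP => // xb.
      apply: (le_trans (eE _ (le_trans xb bT))).
      by apply: lee_wpmul2l; [rewrite lee_fin|exact: leD].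
  have := Dfin b bT; move: h (D0 b); case: (D b) => // r.
  rewrite -EFinM !lee_fin => h r0 _; congr EFin; nra.
have [n nk] : exists n : nat, (kappa * T * 2 <= n.+1%:R)%R.
  exists (Num.truncn (kappa * T * 2)); apply: ltW; exact: truncnS_gt.
have DT : D T = 0.
  have : forall j, (j <= n.+1)%N -> D (T * j%:R / n.+1%:R)%R = 0.
    elim=> [_|j IH jn].
      by rewrite mulr0 mul0r /D set_itv_ge ?integral_set0// bnd_simp ltxx.
    apply: step (IH (ltnW jn)).
    - by rewrite divr_ge0// mulr_ge0// ltW.
    - by rewrite ler_pM2r ?invr_gt0// ler_pM2l// ler_nat.
    - by rewrite ler_pdivrMr// ler_pM2l// ler_nat.
    - rewrite -mulrBl -mulrBr -natrB// subSnn mulr1 mulrA ler_pdivrMr//.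
      by rewrite ler_pdivlMl// mulrC.
  by move=> /(_ n.+1 (leqnn _)); rewrite mulfK// gt_eqF.
move=> s sT; apply/eqP; rewrite eq_le e0 andbT.
apply: (le_trans (eE _ sT)); rewrite -/(D s) (_ : D s = 0) ?mule0//.
by apply/eqP; rewrite eq_le D0 andbT -DT; exact: leD.
Qed.

Lemma volterra1_unique (kappa T : R) (A x1 x2 : R -> \bar R) :
  (0 <= kappa)%R -> (0 < T)%R ->
  measurable_fun setT x1 -> measurable_fun setT x2 ->
  (forall s, 0 <= x1 s) -> (forall s, 0 <= x2 s) ->
  (forall s, (0 < s < T)%R -> A s \is a fin_num) ->
  \int[mu]_(s in `]0%R, T[) x1 s < +oo -> \int[mu]_(s in `]0%R, T[) x2 s < +oo ->
  (forall s, (0 < s < T)%R -> x1 s = A s + kappa%:E * \int[mu]_(r in `]0%R, s[) x1 r) ->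
  (forall s, (0 < s < T)%R -> x2 s = A s + kappa%:E * \int[mu]_(r in `]0%R, s[) x2 r) ->
  forall s, (0 < s < T)%R -> x1 s = x2 s.
Proof.
move=> k0 T0 m1 m2 x10 x20 Afin i1 i2 E1 E2.
(* Set to 0 outside ]0, T[, where the two equations say nothing. *)
pose e s := if (0 < s < T)%R then `|x1 s - x2 s| else 0.
have int (x : R -> \bar R) s : measurable_fun setT x -> (forall s, 0 <= x s) ->
    \int[mu]_(s in `]0%R, T[) x s < +oo -> (s < T)%R -> mu.-integrable `]0%R, s[ x.
  move=> mx x0 ix sT; apply/integrableP; split; first exact: measurable_funTS.
  under eq_integral do rewrite gee0_abs//.
  apply: le_lt_trans ix; apply: ge0_subset_integral => //; first exact: measurable_funTS.
  by move=> r /=; rewrite !in_itv/= => /andP[-> /= rs]; exact: lt_trans sT.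
have fin x s : measurable_fun setT x -> (forall s, 0 <= x s) ->
    \int[mu]_(s in `]0%R, T[) x s < +oo -> (s < T)%R -> \int[mu]_(r in `]0%R, s[) x r \is a fin_num.
  by move=> *; apply: integrable_fin_num => //; exact: int.
have me : measurable_fun setT e.
  apply: measurable_fun_ifT => //=.
    by apply: measurable_and; exact: measurable_fun_ltr.
  by apply: measurableT_comp => //; exact: emeasurable_funB.
have e0 s : 0 <= e s by rewrite /e; case: ifP.
suff h : forall s, (s <= T)%R -> e s = 0.
  move=> s /[dup] sT /andP[s0 /ltW /h]; rewrite /e sT => /eqP.
  have f1 : x1 s \is a fin_num.
    by rewrite E1// fin_numD Afin// fin_numM//; apply: fin => //; case/andP: sT.
  have f2 : x2 s \is a fin_num.
    by rewrite E2// fin_numD Afin// fin_numM//; apply: fin => //; case/andP: sT.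
  rewrite -(fineK f1) -(fineK f2) -EFinB /= => /eqP[/eqP].
  by rewrite normr_eq0 subr_eq0 => /eqP ->.
apply: (gronwall0 k0 T0 me e0).
  apply: (@le_lt_trans _ _ (\int[mu]_(s in `]0%R, T[) (x1 s + x2 s))).
    rewrite [X in X <= _]integral_mkcond [X in _ <= X]integral_mkcond.
    apply: ge0_le_integral => //.
    - by move=> x _; exact: erestrict_ge0.
    - by apply/(measurable_restrictT _ _).1 => //; exact: measurable_funTS.
    - by apply/(measurable_restrictT _ _).1 => //; apply: measurable_funTS; exact: emeasurable_funD.
    - move=> x _; rewrite !patchE !mem_setE !in_itv/= /e; case: (ltP 0%R x) => //= x0.
      case: (ltgtP x T) => //= xT; rewrite ?adde_ge0//.
      apply: (le_trans (lee_abs_sub _ _)); by rewrite !gee0_abs.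
  by rewrite ge0_integralD//; [exact: lte_add_pinfty|exact: measurable_funTS..].
move=> s sT; rewrite {1}/e; case: ifPn => [/andP[s0 s1]|_]; last first.
  by rewrite mule_ge0// integral_ge0.
have X1 := fin _ _ m1 x10 i1 s1; have X2 := fin _ _ m2 x20 i2 s1.
rewrite E1 ?s0// E2 ?s0//.
have -> : A s + kappa%:E * \int[mu]_(r in `]0%R, s[) x1 r - (A s + kappa%:E * \int[mu]_(r in `]0%R, s[) x2 r)
    = kappa%:E * (\int[mu]_(r in `]0%R, s[) x1 r - \int[mu]_(r in `]0%R, s[) x2 r).
  have As : A s \is a fin_num by rewrite Afin// s0.
  move: As X1 X2; move: (A s) (\int[mu]_(r in _) x1 r) (\int[mu]_(r in _) x2 r).
  move=> [a||] [p||] [q||]// _ _ _.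
  change ((a + kappa * p - (a + kappa * q))%:E = (kappa * (p - q))%:E).
  by congr EFin; ring.
rewrite abseM gee0_abs ?lee_fin//; apply: lee_wpmul2l; first by rewrite lee_fin.
have j1 := int _ _ m1 x10 i1 s1; have j2 := int _ _ m2 x20 i2 s1.
rewrite -integralB//.
apply: (le_trans (le_abse_integral _ _ _)) => //.
  by apply: measurable_funTS; exact: emeasurable_funB.
rewrite [X in X <= _]integral_mkcond [X in _ <= X]integral_mkcond.
apply: ge0_le_integral => //.
- by move=> x _; exact: erestrict_ge0.
- apply/(measurable_restrictT _ _).1 => //; apply: measurable_funTS.
  by apply: measurableT_comp => //; exact: emeasurable_funB.
- by apply/(measurable_restrictT _ _).1 => //; exact: measurable_funTS.
- move=> x _; rewrite !patchE !mem_setE !in_itv/= /e.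
  have [x0|//] := ltP 0%R x; have [xs|xs] := ltP x s => /=.
    by rewrite (ltW xs) (lt_trans xs s1).
  by case: ifP => _; [case: ifP => _; [exact: abse_ge0|exact: lexx]|exact: lexx].
Qed.

End Volterra.

Section Expo_mix_facts.
Context {R : realType}.
Local Notation mu := (@lebesgue_measure R).
Local Open Scope ereal_scope.

Lemma erfc0 : erfc (0 : R) = 1%R.
Proof.
rewrite /erfc subrr mulr0 subr0//.
Qed.

Lemma expo_mix_le0 (c beta t r : R) : (t <= 0)%R -> expo_mix c beta t r = 0.
Proof. by move=> t0; rewrite expo_mixdef integral0_eq// => w _; rewrite heat_kernel0// !mulr0. Qed.

(** Half of the mass of a centered Gaussian, whatever its variance. That it does not depend on t is
    what makes the kernel convolved with itself constant. *)
Lemma expo_mix0 (c t : R) : (0 < c)%R -> (0 < t)%R -> expo_mix c 0 t 0 = (2^-1)%:E.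
Proof.
move=> c0 t0; rewrite expo_mixE// expr0n/= !mul0r subrr expR0 mul1r.
by rewrite mul0r erfc0 mulr1.
Qed.

Lemma expo_mix_fin (c beta t r : R) : (0 < c)%R -> expo_mix c beta t r \is a fin_num.
Proof.
move=> c0; have [t0|t0] := leP t 0%R; first by rewrite expo_mix_le0.
by rewrite expo_mixE.
Qed.

End Expo_mix_facts.

(** * The resolvent of the singular kernel *)

Section Resolvent.
Context {R : realType} (c l : R) (c0 : (0 < c)%R) (l0 : (0 < l)%R).
Local Notation mu := (@lebesgue_measure R).
Local Open Scope ereal_scope.

(** The Volterra kernel, of order s^(-1/2) at 0 and decreasing on positive times; in the
    applications c = 2 nu and l = lambda^2. *)
Definition kern (s : R) : \bar R := (l * heat_kernel c s 0)%:E.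

Lemma kern_ge0 s : 0 <= kern s.
Proof. by rewrite lee_fin mulr_ge0 ?heat_kernel_ge0// ltW. Qed.

Lemma kern_le0 s : (s <= 0)%R -> kern s = 0.
Proof. by move=> s0; rewrite /kern heat_kernel0// mulr0. Qed.

Lemma measurable_kern : measurable_fun setT kern.
Proof. exact/measurable_EFinP/measurable_funM/measurable_heat_kernel_comp. Qed.

Lemma le_kern (s t : R) : (0 < s)%R -> (s <= t)%R -> kern t <= kern s.
Proof.
move=> s0 st; have t0 := lt_le_trans s0 st.
rewrite lee_fin ler_pM2l// !heat_kernelE// expr0n/= oppr0 !mul0r expR0 !mulr1.
have p0 : (0 < 2 * pi * c)%R by rewrite !mulr_gt0// pi_gt0.
rewrite lef_pV2 ?posrE ?sqrtr_gt0 ?mulr_gt0 ?pi_gt0//.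
by apply: ler_wsqrtr; rewrite ler_pM2l.
Qed.

Lemma kern_gt0 s : (0 < s)%R -> 0 < kern s.
Proof. by move=> s0; rewrite lte_fin mulr_gt0// heat_kernel_gt0. Qed.

Lemma conv_kern (f : R -> \bar R) (t : R) : measurable_fun setT f -> (forall s, 0 <= f s) ->
  conv kern f t = l%:E * conv (fun s => (heat_kernel c s 0)%:E) f t.
Proof.
move=> mf f0; rewrite (_ : kern = fun s => l%:E * (heat_kernel c s 0)%:E) ?convZl//.
- exact/measurable_EFinP/measurable_heat_kernel_comp.
- by move=> s; rewrite lee_fin heat_kernel_ge0.
- by rewrite lee_fin ltW.
Qed.

Let kappa := (l ^+ 2 / (2 * c))%R.

(** The singularity s^(-1/2) convolved with itself is constant. The constant l^2 / (2 c) collects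
    l^2, the factor 1/c of [conv_heat_kernel] and the half mass of [expo_mix0]. *)
Lemma conv_kern_kern t : conv kern kern t = (kappa * ray t)%:E.
Proof.
rewrite conv_kern; [|exact: measurable_kern|exact: kern_ge0].
rewrite convC; [|exact/measurable_EFinP/measurable_heat_kernel_comp|exact: measurable_kern
  |by move=> s; rewrite lee_fin heat_kernel_ge0|exact: kern_ge0].
rewrite conv_kern; [|exact/measurable_EFinP/measurable_heat_kernel_comp
  |by move=> s; rewrite lee_fin heat_kernel_ge0].
rewrite conv_heat_kernel// addr0; have [t0|t0] := leP t 0%R.
  by rewrite expo_mix_le0// !mule0 /ray ltNge t0 mulr0.
rewrite expo_mix0// /ray t0 -!EFinM; congr EFin; rewrite /kappa; field; by rewrite gt_eqF.
Qed.

Lemma conv_ray (f : R -> \bar R) (t : R) : measurable_fun setT f -> (forall s, 0 <= f s) ->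
  (forall s, (s <= 0)%R -> f s = 0) ->
  conv (fun s => (ray s)%:E) f t = \int[mu]_(s in `]0%R, t[) f s.
Proof.
move=> mf f0 fn; rewrite convC//; last 2 first.
- exact/measurable_EFinP/measurable_ray.
- by move=> s; rewrite lee_fin ray_ge0.
rewrite convE [RHS]integral_mkcond; apply: eq_integral => s _.
rewrite patchE mem_setE in_itv/= /ray subr_gt0.
have [s0|s0] := ltP 0%R s; last by rewrite fn// mul0e.
by case: ifP; rewrite ?mule1 ?mule0.
Qed.

Lemma eq_conv_kern (f g : R -> \bar R) (t : R) : (forall s, (s < t)%R -> f s = g s) ->
  conv f kern t = conv g kern t.
Proof.
move=> fg; rewrite !convE; apply: eq_integral => s _; have [st|ts] := ltP s t; first by rewrite fg.
by rewrite kern_le0 ?mule0// subr_le0.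
Qed.

(** As the kernel decreases, [kern (T - s)] is at least [kern T], which is positive. Finiteness of
    the convolution at the single time T thus gives integrability on ]0, T[. *)
Lemma integral_lty_conv_kern (f : R -> \bar R) (T : R) : (0 < T)%R ->
  measurable_fun setT f -> (forall s, 0 <= f s) ->
  conv f kern T < +oo -> \int[mu]_(s in `]0%R, T[) f s < +oo.
Proof.
move=> T0 mf f0 foo.
have kT := kern_gt0 T0.
have : (kern T) * \int[mu]_(s in `]0%R, T[) f s < +oo.
  apply: le_lt_trans foo; rewrite convE -ge0_integralZl; last 4 first.
  - by [].
  - exact: measurable_funTS.
  - by move=> s _; exact: f0.
  - exact: kern_ge0.
  rewrite [X in X <= _]integral_mkcond; apply: ge0_le_integral => //.
  - by move=> x _; apply: erestrict_ge0 => // s _; rewrite mule_ge0// kern_ge0.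
  - apply/(measurable_restrictT _ _).1 => //; apply: measurable_funTS.
    exact: measurable_funeM.
  - exact: conv_mule_measurable measurable_kern.
  - move=> x _; rewrite patchE mem_setE in_itv/=; case: ifP => [/andP[x0 xT]|_].
      rewrite muleC; apply: lee_wpmul2l => //; apply: le_kern; first by rewrite subr_gt0.
      by rewrite lerBlDr lerDl ltW.
    by rewrite mule_ge0// kern_ge0.
rewrite !ltey; apply: contra => /eqP ->.
by rewrite gt0_muley.
Qed.

(** Inserting the equation into its own right-hand side replaces [kern] by its convolution square, a
    constant, and [volterra1_unique] applies with the source [psi + conv psi kern]. That source must
    be finite for the two solutions to be subtracted. *)
Lemma resolvent_unique (T : R) (psi x1 x2 : R -> \bar R) : (0 < T)%R ->
  measurable_fun setT psi -> measurable_fun setT x1 -> measurable_fun setT x2 ->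
  (forall s, 0 <= psi s) -> (forall s, 0 <= x1 s) -> (forall s, 0 <= x2 s) ->
  (forall s, (s <= 0)%R -> x1 s = 0) -> (forall s, (s <= 0)%R -> x2 s = 0) ->
  (forall s, (0 < s < T)%R -> psi s + conv psi kern s \is a fin_num) ->
  conv x1 kern T < +oo -> conv x2 kern T < +oo ->
  (forall s, (s < T)%R -> x1 s = psi s + conv x1 kern s) ->
  (forall s, (s < T)%R -> x2 s = psi s + conv x2 kern s) ->
  forall s, (s < T)%R -> x1 s = x2 s.
Proof.
move=> T0 mp m1 m2 p0 x10 x20 n1 n2 fin i1 i2 E1 E2.
have mk := measurable_kern.
have mc f : measurable_fun setT f -> (forall s, 0 <= f s) -> measurable_fun setT (conv f kern).
  by move=> mf f0; apply: measurable_conv => //; exact: kern_ge0.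
have it (x : R -> \bar R) : measurable_fun setT x -> (forall s, 0 <= x s) -> (forall s, (s <= 0)%R -> x s = 0) ->
   (forall s, (s < T)%R -> x s = psi s + conv x kern s) ->
   forall s, (0 < s < T)%R -> x s = psi s + conv psi kern s + kappa%:E * \int[mu]_(r in `]0%R, s[) x r.
  move=> mx x0 xn Ex s /andP[s0 sT]; rewrite Ex//.
  rewrite (@eq_conv_kern x (fun r => psi r + conv x kern r)); last first.
    by move=> r rs; rewrite Ex//; exact: lt_trans sT.
  rewrite convDl//; [|exact: mc|by move=> r; exact/conv_ge0/kern_ge0|exact: kern_ge0].
  rewrite addeA; congr (_ + _).
  rewrite -convA//; [|exact: kern_ge0..].
  rewrite (_ : conv kern kern = fun t => kappa%:E * (ray t)%:E); last first.
    by apply/funext => t; rewrite conv_kern_kern EFinM.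
  have mr : measurable_fun setT (fun t : R => (ray t)%:E).
    by apply/measurable_EFinP; exact: measurable_ray.
  have kap0 : 0 <= kappa%:E by rewrite lee_fin /kappa divr_ge0 ?sqr_ge0// mulr_ge0// ltW.
  have rr0 (r : R) : 0 <= (ray r)%:E by rewrite lee_fin ray_ge0.
  rewrite convC//; [|exact: measurable_funeM|by move=> r; exact: mule_ge0].
  by rewrite convZl// conv_ray.
move=> s sT; have [s0|s0] := leP s 0%R; first by rewrite n1// n2.
apply: (@volterra1_unique _ kappa T (fun s => psi s + conv psi kern s)) => //.
- by rewrite /kappa divr_ge0 ?sqr_ge0// mulr_ge0// ltW.
- exact: integral_lty_conv_kern.
- exact: integral_lty_conv_kern.
- exact: it.
- exact: it.
- by rewrite s0.
Qed.

(** The rate for which the factor [beta * c] of [expo_mix_conv] is [l]. *)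
Let beta := (l / c)%R.
Let b0 : (0 < beta)%R. Proof. by rewrite divr_gt0. Qed.

Lemma expo_mix_kern t (r : R) : (0 <= r)%R ->
  l%:E * conv (fun s => (heat_kernel c s r)%:E) (fun s => expo_mix c beta s 0) t + expo_mix c 0 t r =
  expo_mix c beta t r.
Proof.
by move=> r0; rewrite -(expo_mix_conv c0 t b0 r0) {1}/beta divfK// gt_eqF.
Qed.

(** The one computation behind all closed forms. At r = 0 it checks that a combination of a heat
    kernel and a mixture solves the Volterra equation; at a general r it evaluates the integral in
    the covariance. *)
Lemma conv_mixture_heat_kernel (p q : R) (r t : R) : (0 <= p)%R -> (0 <= q)%R -> (0 <= r)%R ->
  l%:E * conv (fun s => p%:E * (heat_kernel c s 0)%:E + q%:E * expo_mix c beta s 0)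
    (fun s => (heat_kernel c s r)%:E) t + q%:E * expo_mix c 0 t r =
  (p * beta)%:E * expo_mix c 0 t r + q%:E * expo_mix c beta t r.
Proof.
move=> p0 q0 r0.
have mh x : measurable_fun setT (fun s => (heat_kernel c s x)%:E).
  exact/measurable_EFinP/measurable_heat_kernel_comp.
have mD := measurable_expo_mix c beta 0.
have h0 x s : 0 <= (heat_kernel c s x)%:E by rewrite lee_fin heat_kernel_ge0.
have D0 s : 0 <= expo_mix c beta s 0 by exact: expo_mix_ge0.
rewrite convDl; [|exact: measurable_funeM|exact: measurable_funeM|exact: mh
  |by move=> s; rewrite mule_ge0|by move=> s; rewrite mule_ge0|exact: h0].
rewrite convZl; [|exact: mh|exact: mh|exact: h0|exact: h0|by rewrite lee_fin].
rewrite convZl; [|exact: mD|exact: mh|exact: D0|exact: h0|by rewrite lee_fin].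
rewrite (conv_heat_kernel c0 t (lexx 0%R) r0) add0r -(expo_mix_kern t r0).
rewrite [conv (fun s => expo_mix _ _ _ _) _ _]convC; [|exact: mD|exact: mh|exact: D0|exact: h0].
have C0 : 0 <= conv (fun s => (heat_kernel c s r)%:E) (fun s => expo_mix c beta s 0) t.
  by apply: conv_ge0; [exact: h0|exact: D0].
have N0 := expo_mix_ge0 c 0 t r.
rewrite ge0_muleDr; last 2 first.
- by rewrite !mule_ge0// lee_fin invr_ge0 ltW.
- by rewrite mule_ge0.
rewrite [X in _ = _ + X]ge0_muleDr; [|by rewrite mule_ge0// lee_fin ltW|exact: N0].
rewrite -addeA; congr (_ + _).
  by rewrite !muleA -!EFinM; congr (_%:E * _); rewrite /beta; ring.
by rewrite [q%:E * (l%:E * _)]muleCA.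
Qed.

End Resolvent.

Lemma adde_cancelr {R : realType} (r : R) (x y : \bar R) :
  (x + r%:E = y + r%:E -> x = y)%E.
Proof.
by case: x => [x||]; case: y => [y||]//=; rewrite -!EFinD => -[] /addIr ->.
Qed.

(** * Closed forms of the kernel series and of its time integral *)

Section Kernel_formulas.
Context {R : realType} (nu lambda : R) (nu0 : (0 < nu)%R) (lambda0 : lambda != 0%R).
Local Notation mu := (@lebesgue_measure R).
Local Open Scope ereal_scope.

Let c0 : (0 < 2 * nu)%R. Proof. by rewrite mulr_gt0. Qed.
Let h0 : (0 < nu / 2)%R. Proof. by rewrite divr_gt0. Qed.
Let l0 : (0 < lambda ^+ 2)%R. Proof. by rewrite exprn_even_gt0. Qed.

Local Notation k0 := (kern (2 * nu) (lambda ^+ 2)).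
Local Notation beta := (lambda ^+ 2 / (2 * nu))%R.
Local Notation G := (heat_kernel (nu / 2)).

(** The semigroup property turns the space integral into [G t x], which no longer depends on s and
    leaves the time convolution. The vanishing of a and b at nonpositive times exchanges [[0, t]]
    for the whole line. *)
Lemma star_heat_kernel (a b : R -> \bar R) (t x : R) :
  measurable_fun setT a -> measurable_fun setT b ->
  (forall s, 0 <= a s) -> (forall s, 0 <= b s) ->
  (forall s, (s <= 0)%R -> a s = 0) -> (forall s, (s <= 0)%R -> b s = 0) ->
  star (fun s y => (G s y)%:E * a s) (fun s y => (G s y)%:E * b s) t x =
  (G t x)%:E * conv a b t.
Proof.
move=> ma mb a0 b0 an bn; rewrite /star; have [t0|t0] := leP t 0%R.
  rewrite heat_kernel0// mul0e (@integral_Sset1 _ _ _ 0%R)// => y /=.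
  by rewrite in_itv/= => /andP[y0 yt]; apply/eqP; rewrite eq_le y0 (le_trans yt).
have inner s : \int[mu]_y ((G s y)%:E * a s * ((G (t - s) (x - y))%:E * b (t - s)%R)) =
    (G t x)%:E * (a s * b (t - s)%R).
  have [s0|s0] := leP s 0%R.
    by rewrite an// mul0e mule0 integral0_eq// => y _; rewrite mule0 mul0e.
  have [ts|st] := leP t s.
    by rewrite (bn (t - s)%R) ?subr_le0// !mule0 integral0_eq// => y _; rewrite mule0 mule0.
  under eq_integral do rewrite muleACA.
  rewrite ge0_integralZr.
  - by rewrite heat_kernel_semigroup ?subr_gt0// addrC subrK.
  - exact: measurableT.
  - apply: emeasurable_funM; apply/measurable_EFinP/measurable_heat_kernel_comp => //.
    exact: measurable_funB.
  - by move=> y _; rewrite mule_ge0// lee_fin heat_kernel_ge0.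
  - exact: mule_ge0.
under eq_integral do rewrite inner.
rewrite convE -ge0_integralZl; last 4 first.
- exact: measurableT.
- exact: conv_mule_measurable.
- by move=> s _; rewrite mule_ge0.
- by rewrite lee_fin heat_kernel_ge0.
rewrite integral_mkcond; apply: eq_integral => s _; rewrite patchE mem_setE in_itv/=.
case: ifPn => //; rewrite negb_and -!ltNge => /orP[s0|s0].
  by rewrite an ?ltW// mul0e mule0.
by rewrite bn ?mule0// subr_le0 ltW.
Qed.

Lemma calL0E t x : calL0 nu lambda t x = (G t x)%:E * k0 t.
Proof.
rewrite /calL0 /kern -EFinM; congr EFin.
rewrite [(heat_kernel _ _ _ ^+ 2)%R]expr2 (heat_kernel_mul t x x nu0) subrr.
have -> : ((x + x) / 2 = x)%R by field.
ring.
Qed.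

Fixpoint time_part (n : nat) : R -> \bar R :=
  if n is m.+1 then conv (time_part m) k0 else k0.

Lemma time_part_props n : [/\ measurable_fun setT (time_part n),
  forall s, 0 <= time_part n s & forall s, (s <= 0)%R -> time_part n s = 0].
Proof.
elim: n => [|n [mn n0 nn]] /=.
  split; [exact: measurable_kern|exact: kern_ge0|exact: kern_le0].
split.
- by apply: measurable_conv => //; [exact: measurable_kern|exact: kern_ge0].
- by move=> s; apply: conv_ge0 => // r; exact: kern_ge0.
- move=> s s0; rewrite convE integral0_eq// => r _; have [r0|r0] := leP r 0%R.
    by rewrite nn// mul0e.
  by rewrite kern_le0 ?mule0// subr_le0; lra.
Qed.

Lemma calLE n t x : calL nu lambda n t x = (G t x)%:E * time_part n t.
Proof.
elim: n t x => [|n IH] t x /=; first exact: calL0E.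
have [mn n0 nn] := time_part_props n.
transitivity (star (fun s y => (G s y)%:E * time_part n s) (fun s y => (G s y)%:E * k0 s) t x).
  have -> : calL nu lambda n = fun s y => (G s y)%:E * time_part n s.
    by apply/funext => s; apply/funext => y; exact: IH.
  have -> // : calL0 nu lambda = fun s y => (G s y)%:E * k0 s.
  by apply/funext => s; apply/funext => y; exact: calL0E.
apply: star_heat_kernel.
- exact: mn.
- exact: measurable_kern.
- exact: n0.
- exact: kern_ge0.
- exact: nn.
- exact: kern_le0.
Qed.

(** The candidate for the sum of all [time_part n]. With q as in the Laplace picture its transform
    is beta / (q - beta), the sum of the geometric series of ratio beta / q. *)
Definition time_kernel (t : R) : \bar R :=
  (lambda ^+ 2)%:E * (heat_kernel (2 * nu) t 0)%:E +
  (lambda ^+ 2 * beta)%:E * expo_mix (2 * nu) beta t 0.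

Lemma time_kernel_ge0 s : 0 <= time_kernel s.
Proof.
apply: adde_ge0; apply: mule_ge0; rewrite ?lee_fin.
- exact: ltW.
- exact: heat_kernel_ge0.
- by rewrite mulr_ge0 ?divr_ge0// ltW.
- exact: expo_mix_ge0.
Qed.

Lemma measurable_time_kernel : measurable_fun setT time_kernel.
Proof.
apply: emeasurable_funD; apply: measurable_funeM.
  exact/measurable_EFinP/measurable_heat_kernel_comp.
exact: measurable_expo_mix.
Qed.

Lemma time_kernel_le0 s : (s <= 0)%R -> time_kernel s = 0.
Proof. by move=> s0; rewrite /time_kernel heat_kernel0// expo_mix_le0// !mule0 adde0. Qed.

Lemma conv_time_kernel t :
  conv time_kernel k0 t = (lambda ^+ 2 * beta)%:E * expo_mix (2 * nu) beta t 0.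
Proof.
have mh : measurable_fun setT (fun s => (heat_kernel (2 * nu) s 0)%:E).
  exact/measurable_EFinP/measurable_heat_kernel_comp.
have hk0 s : 0 <= (heat_kernel (2 * nu) s 0)%:E by rewrite lee_fin heat_kernel_ge0.
have b0 : (0 <= beta)%R by rewrite divr_ge0 ?ltW.
rewrite convC; [|exact: measurable_time_kernel|exact: measurable_kern|exact: time_kernel_ge0|exact: kern_ge0].
rewrite (conv_kern (2 * nu) l0 t measurable_time_kernel time_kernel_ge0).
rewrite convC; [|exact: mh|exact: measurable_time_kernel|exact: hk0|exact: time_kernel_ge0].
(* With q = p * beta the two terms in [expo_mix 0] are equal and cancel. *)
have := @conv_mixture_heat_kernel _ _ _ c0 l0 (lambda ^+ 2) (lambda ^+ 2 * beta) 0 t (ltW l0) (mulr_ge0 (ltW l0) b0) (lexx _).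
rewrite addeC [RHS]addeC -/(time_kernel) -(fineK (expo_mix_fin 0 t 0 c0)) -!EFinM addeC => /adde_cancelr.
exact.
Qed.

Lemma time_kernelE t : time_kernel t = k0 t + conv time_kernel k0 t.
Proof. by rewrite conv_time_kernel /time_kernel /kern EFinM. Qed.

(** The partial sums are the iterates from 0 of the monotone map sending f to [k0 + conv f k0], and
    [time_kernel] is a nonnegative fixed point of it, so they stay below. *)
Lemma le_sum_time_part n t : \sum_(i < n) time_part i t <= time_kernel t.
Proof.
have mS m : measurable_fun setT (fun s => \sum_(i < m) time_part i s).
  by apply: emeasurable_sum => i; case: (time_part_props i).
have S0 m s : 0 <= \sum_(i < m) time_part i s.
  by apply: sume_ge0 => i _; case: (time_part_props i).
elim: n t => [|n IH] t; first by rewrite big_ord0 time_kernel_ge0.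
rewrite big_ord_recl /= time_kernelE; apply: leeD2l.
apply: (@le_trans _ _ (conv (fun s => \sum_(i < n) time_part i s) k0 t)).
  rewrite le_eqVlt; apply/orP; left; apply/eqP.
  elim: n {IH} => [|n IH].
    by rewrite big_ord0 convE integral0_eq// => s _; rewrite big_ord0 mul0e.
  rewrite big_ord_recr/= IH; have [mn n0 nn] := time_part_props n.
  rewrite -convDl; [|exact: mS|exact: mn|exact: measurable_kern|exact: S0|exact: n0|exact: kern_ge0].
  by congr conv; apply/funext => s; rewrite big_ord_recr.
apply: le_conv; [exact: mS|exact: measurable_time_kernel|exact: measurable_kern|exact: S0|exact: kern_ge0|exact: IH].
Qed.

Let khat (t : R) : \bar R := \sum_(0 <= n <oo) time_part n t.

Let khat_le t : khat t <= time_kernel t.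
Proof.
apply: lime_le; first by apply: is_cvg_nneseries => n _ _; case: (time_part_props n).
by apply: nearW => n; rewrite big_mkord; exact: le_sum_time_part.
Qed.

Let tp0 n s : 0 <= time_part n s.
Proof. by case: (time_part_props n). Qed.

Let khatE t : khat t = k0 t + conv khat k0 t.
Proof.
have -> : conv khat k0 t = \sum_(0 <= n <oo) conv (time_part n) k0 t.
  rewrite convE -integral_nneseries//.
  - apply: eq_integral => s _; rewrite muleC -nneseriesZl//.
    by apply: eq_eseriesr => n _; rewrite muleC.
  - by move=> n; apply: conv_mule_measurable; [case: (time_part_props n)|exact: measurable_kern].
  - by move=> n s _; apply: mule_ge0 => //; exact: kern_ge0.
rewrite /khat nneseries_recl//; congr (_ + _).
rewrite -(@nneseries_addn _ (fun k => time_part k t) 1)//.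
by apply: eq_eseriesr => n _; rewrite addn1.
Qed.

(** The series solves the same equation as [time_kernel] by monotone convergence. Being bounded by
    it, the series has the finiteness that uniqueness requires. *)
Lemma sum_time_part (t : R) : \sum_(0 <= n <oo) time_part n t = time_kernel t.
Proof.
have [t0|t0] := leP t 0%R.
  rewrite time_kernel_le0// eseries0// => n _ _; by case: (time_part_props n) => _ _ ->.
have mk : measurable_fun setT khat.
  by apply: ge0_emeasurable_sum => // n; case: (time_part_props n).
have k_ge0 s : 0 <= khat s by apply: nneseries_ge0.
(* Uniqueness holds strictly before the horizon, which is therefore taken beyond t. *)
have t1 : (t < t + 1)%R by rewrite ltrDl.
have fin s : conv time_kernel k0 s \is a fin_num by rewrite conv_time_kernel fin_numM// expo_mix_fin.
apply: (@resolvent_unique _ _ _ c0 l0 (t + 1) k0 khat time_kernel) => //.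
- by rewrite addr_gt0.
- exact: measurable_kern.
- exact: measurable_time_kernel.
- exact: kern_ge0.
- exact: time_kernel_ge0.
- by move=> s s0; apply: eseries0 => n _ _; case: (time_part_props n) => _ _ ->.
- exact: time_kernel_le0.
- move=> s _; rewrite (conv_kern_kern c0 l0) fin_numD/=.
  by rewrite /kern.
- apply: (@le_lt_trans _ _ (conv time_kernel k0 (t + 1))).
    by apply: le_conv => //; [exact: measurable_time_kernel|exact: measurable_kern|exact: kern_ge0].
  by rewrite -ge0_fin_numE ?fin// conv_ge0//; [exact: time_kernel_ge0|exact: kern_ge0].
- by rewrite -ge0_fin_numE ?fin// conv_ge0//; [exact: time_kernel_ge0|exact: kern_ge0].
- by move=> s _; exact: time_kernelE.
Qed.

Lemma calKE (t x : R) : calK nu lambda t x = (G t x)%:E * time_kernel t.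
Proof.
rewrite -sum_time_part -nneseriesZl//.
by apply: eq_eseriesr => n _; exact: calLE.
Qed.

(** The space integral of K is [time_kernel], so H is its primitive. The term 1 stands on the left
    so that no subtraction occurs before finiteness is known. *)
Lemma calHE (t : R) : (0 < t)%R ->
  calH nu lambda t + 1 = 2%:E * expo_mix (2 * nu) beta t 0.
Proof.
move=> t0.
have -> : calH nu lambda t = conv (fun s => (ray s)%:E) time_kernel t.
  rewrite /calH /star.
  transitivity (\int[mu]_(s in `[0%R, t]) time_kernel (t - s)%R).
    apply: eq_integral => s _; under eq_integral do rewrite mul1e calKE.
    have [st|ts] := ltP s t; last first.
      by rewrite (@time_kernel_le0 (t - s)%R) ?subr_le0// integral0_eq// => y _; rewrite mule0.
    rewrite ge0_integralZr.
    - by rewrite integral_heat_kernel_reflect ?mul1e// subr_gt0.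
    - exact: measurableT.
    - apply/measurable_EFinP/measurable_heat_kernel_comp => //.
      exact: measurable_funB.
    - by move=> y _; rewrite lee_fin heat_kernel_ge0.
    - exact: time_kernel_ge0.
  have mtk : measurable_fun setT (fun s : R => time_kernel (t - s)%R).
    by apply: measurableT_comp; [exact: measurable_time_kernel|exact: measurable_funB].
  rewrite -integral_itv_obnd_cbnd; last exact: measurable_funTS.
  rewrite integral_mkcond convE; apply: eq_integral => s _.
  rewrite patchE mem_setE in_itv/= /ray; case: ifPn => /=.
    by case: ifPn => [s0 _|]; rewrite ?mul1e//= => /negbTE ->.
  rewrite negb_and => /orP[/negbTE ->|]; first by rewrite mul0e.
  by rewrite -ltNge => ts; rewrite time_kernel_le0 ?mule0// subr_le0 ltW.
have mr : measurable_fun setT (fun s : R => (ray s)%:E).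
  by apply/measurable_EFinP; exact: measurable_ray.
have rr0 (r : R) : 0 <= (ray r)%:E by rewrite lee_fin ray_ge0.
have mk := measurable_kern (2 * nu) (lambda ^+ 2).
have mD := measurable_expo_mix (2 * nu) beta 0.
have D0 (s : R) : 0 <= expo_mix (2 * nu) beta s 0 by exact: expo_mix_ge0.
pose kappa := ((lambda ^+ 2) ^+ 2 / (2 * (2 * nu)))%R.
have kap0 : (0 < kappa)%R.
  by apply: divr_gt0; [exact: exprn_gt0|exact: mulr_gt0].
have b0 : (0 < beta)%R by rewrite divr_gt0.
(* A primitive is a convolution with [ray], and kappa times [ray] is [conv k0 k0]. By associativity,
   convolving [time_kernel] twice with [k0] returns to a mixture, to which [expo_mix_kern]
   applies. *)
have E : kappa%:E * conv (fun s => (ray s)%:E) time_kernel t =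
    (lambda ^+ 2 * beta)%:E * conv k0 (fun s => expo_mix (2 * nu) beta s 0) t.
  rewrite -convZl; [|exact: mr|exact: measurable_time_kernel|exact: rr0|exact: time_kernel_ge0|by rewrite lee_fin ltW].
  rewrite (_ : (fun s => _) = conv k0 k0); last first.
    by apply/funext => s; rewrite (conv_kern_kern c0 l0) EFinM.
  rewrite -convA; [|exact: mk|exact: mk|exact: measurable_time_kernel|exact: kern_ge0|exact: kern_ge0|exact: time_kernel_ge0].
  rewrite (_ : conv k0 time_kernel = fun s => (lambda ^+ 2 * beta)%:E * expo_mix (2 * nu) beta s 0); last first.
    apply/funext => s; rewrite -conv_time_kernel convC//; [exact: measurable_time_kernel|exact: kern_ge0|exact: time_kernel_ge0].
  have q0 : 0 <= (lambda ^+ 2 * beta)%:E by rewrite lee_fin mulr_ge0// ltW.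
  rewrite convC; [|exact: mk|exact: measurable_funeM|exact: kern_ge0|by move=> s; exact: mule_ge0].
  rewrite convZl; [|exact: mD|exact: mk|exact: D0|exact: kern_ge0|exact: q0].
  by rewrite convC; [|exact: mD|exact: mk|exact: D0|exact: kern_ge0].
have X0 : 0 <= conv (fun s => (ray s)%:E) time_kernel t.
  by apply: conv_ge0; [exact: rr0|exact: time_kernel_ge0].
have := @expo_mix_kern _ _ _ c0 l0 t 0 (lexx _).
rewrite -(conv_kern _ l0 _ mD D0) expo_mix0//.
move: E X0 (expo_mix_fin beta t 0 c0) (conv_ge0 t (kern_ge0 (2 * nu) l0) D0).
move: (conv (fun s => (ray s)%:E) _ _) (conv k0 _ _) (expo_mix _ _ _ _).
move=> [x||] [y||] [d||]//; rewrite ?gt0_muley ?lte_fin//.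
move=> [e] _ _ _ [e2]; congr EFin.
apply: (@mulfI _ kappa); first by rewrite gt_eqF.
rewrite mulrDr e -e2 /kappa; field; exact: lt0r_neq0.
Qed.

End Kernel_formulas.

(** * The Volterra equation of the second moments *)

Section Second_moment_equation.
Context {R : realType} (nu lambda : R) (nu0 : (0 < nu)%R) (lambda0 : lambda != 0%R).
Local Notation mu := (@lebesgue_measure R).
Local Open Scope ereal_scope.

Let c0 : (0 < 2 * nu)%R. Proof. by rewrite mulr_gt0. Qed.
Let h0 : (0 < nu / 2)%R. Proof. by rewrite divr_gt0. Qed.
Let l0 : (0 < lambda ^+ 2)%R. Proof. by rewrite exprn_even_gt0. Qed.

Local Notation k0 := (kern (2 * nu) (lambda ^+ 2)).
Local Notation beta := (lambda ^+ 2 / (2 * nu))%R.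
Local Notation G := (heat_kernel (nu / 2)).

(* [phi] plays the role of the second moments of [sqrt (vs ^ 2 + u ^ 2)]; its
   heat flow up to the terminal point (T, m) solves a Volterra equation in
   time only, by the semigroup property. *)
Lemma second_moment_volterra (vs T m : R) (phi : R -> R -> \bar R) :
  (0 < T)%R ->
  measurable_fun setT (fun z : R * R => phi z.1 z.2) ->
  (forall s y, 0 <= phi s y) -> (forall s y, (s <= 0)%R -> phi s y = 0) ->
  (forall s y, (0 < s < T)%R -> phi s y = (vs ^+ 2 + heat_kernel (2 * nu) s 0 * G s y)%:E +
     \int[mu]_r \int[mu]_z (k0 (s - r)%R * (G (s - r) (y - z))%:E * phi r z)) ->
  \int[mu]_r \int[mu]_z (k0 (T - r)%R * (G (T - r) (m - z))%:E * phi r z) < +oo ->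
  forall q : R, (0 <= q)%R ->
  (lambda ^+ 2)%:E * \int[mu]_r \int[mu]_z ((heat_kernel (2 * nu) (T - r) q)%:E *
      (G (T - r) (m - z))%:E * phi r z) + (2 * vs ^+ 2)%:E * expo_mix (2 * nu) 0 T q =
  (G T m * beta + 2 * vs ^+ 2)%:E * expo_mix (2 * nu) beta T q.
Proof.
move=> T0 mphi phi0 phin phiE phioo q q0.
(* The average of [phi s] against the heat kernel of the remaining time T - s. In its equation the
   source is [psi]: vs^2 is preserved by averaging, and the Gaussian factor of the initial datum
   averages to [G T m] at every s. *)
pose x1 (s : R) := \int[mu]_y ((G (T - s) (m - y))%:E * phi s y).
pose psi (s : R) := (vs ^+ 2 * ray s + G T m * heat_kernel (2 * nu) s 0)%:E.
(* The coefficients come from [conv_mixture_heat_kernel] at r = 0 with p = [G T m]: the source there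
   is p times the heat kernel plus (q - p beta) / 2, the half being [expo_mix0]. For this to be
   [psi] one needs q = p beta + 2 vs^2. *)
pose x2 (s : R) := (G T m)%:E * (heat_kernel (2 * nu) s 0)%:E +
   (G T m * beta + 2 * vs ^+ 2)%:E * expo_mix (2 * nu) beta s 0.
have mG d (S : measurableType d) (f g : S -> R) : measurable_fun setT f -> measurable_fun setT g ->
    measurable_fun setT (fun z => (G (f z) (g z))%:E).
  by move=> mf mg; exact/measurable_EFinP/measurable_heat_kernel_comp.
have mI : measurable_fun setT (fun z : R * R => (G (T - z.1) (m - z.2))%:E * phi z.1 z.2).
  by apply: emeasurable_funM => //; apply: mG; exact: measurable_funB.
have I0 (z : R * R) : 0 <= (G (T - z.1) (m - z.2))%:E * phi z.1 z.2.
  by rewrite mule_ge0//; rewrite lee_fin heat_kernel_ge0.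
have m1 : measurable_fun setT x1.
  by apply: (measurable_fun_fubini_tonelli_F (m2 := mu) (fun z : R * R => (G (T - z.1) (m - z.2))%:E * phi z.1 z.2)).
have x10 s : 0 <= x1 s by apply: integral_ge0 => y _; exact: (I0 (s, y)).
have x1n s : (s <= 0)%R -> x1 s = 0.
  by move=> s0; rewrite /x1 integral0_eq// => y _; rewrite phin// mule0.
have kI (f : R -> \bar R) : (forall s, 0 <= f s) ->
    \int[mu]_r \int[mu]_z (f (T - r)%R * (G (T - r) (m - z))%:E * phi r z) = conv x1 f T.
  move=> f0; rewrite convE; apply: eq_integral => r _.
  rewrite muleC -ge0_integralZl//.
  - by apply: eq_integral => y _; rewrite muleA.
  - exact: (measurableT_comp mI (measurable_pair1 r)).
  - by move=> y _; exact: (I0 (r, y)).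
have mhk p : measurable_fun setT (fun s => (heat_kernel (2 * nu) s p)%:E).
  exact/measurable_EFinP/measurable_heat_kernel_comp.
have hk0 p s : 0 <= (heat_kernel (2 * nu) s p)%:E by rewrite lee_fin heat_kernel_ge0.
have mk := measurable_kern (2 * nu) (lambda ^+ 2).
have kk0 s : 0 <= k0 s by exact: kern_ge0.
have mD := measurable_expo_mix (2 * nu) beta 0.
have D0 (s : R) : 0 <= expo_mix (2 * nu) beta s 0 by exact: expo_mix_ge0.
have b0 : (0 <= beta)%R by rewrite divr_ge0 ?ltW.
have Gp : (0 <= G T m)%R by exact: heat_kernel_ge0.
have Q0 : (0 <= G T m * beta + 2 * vs ^+ 2)%R by rewrite addr_ge0// mulr_ge0// sqr_ge0.
have m2 : measurable_fun setT x2 by apply: emeasurable_funD; exact: measurable_funeM.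
have x20 s : 0 <= x2 s by rewrite adde_ge0// mule_ge0// lee_fin.
have x2n s : (s <= 0)%R -> x2 s = 0.
  by move=> s0; rewrite /x2 (heat_kernel0 (2 * nu) 0 s0) expo_mix_le0// !mule0 adde0.
have x2fin s : x2 s \is a fin_num by rewrite fin_numD !fin_numM// expo_mix_fin.
have mpsi : measurable_fun setT psi.
  apply/measurable_EFinP; apply: measurable_funD; apply: measurable_funM => //.
    exact: measurable_ray.
  exact: measurable_heat_kernel_comp.
have psi0 s : 0 <= psi s.
  rewrite lee_fin; apply: addr_ge0; apply: mulr_ge0 => //; rewrite ?sqr_ge0 ?ray_ge0//.
  exact: heat_kernel_ge0.
have E2 s : x2 s = psi s + conv x2 k0 s.
  have [s0|s0] := leP s 0%R.
    rewrite x2n// /psi /ray ltNge s0/= (heat_kernel0 (2 * nu) 0 s0) !mulr0 addr0 add0e convE integral0_eq// => r _.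
    have [r0|r0] := leP r 0%R; first by rewrite x2n// mul0e.
    by rewrite kern_le0 ?mule0// subr_le0; lra.
  have := conv_mixture_heat_kernel c0 l0 s Gp Q0 (lexx 0%R).
  rewrite -/x2 convC; [|exact: m2|exact: mhk|exact: x20|exact: hk0].
  rewrite -(conv_kern (2 * nu) l0 s m2 x20) convC; [|exact: mk|exact: m2|exact: kk0|exact: x20].
  rewrite expo_mix0// [x2 s]/x2 /psi /ray s0.
  move: (conv_ge0 s x20 kk0) (expo_mix_fin beta s 0 c0).
  move: (conv x2 k0 s) (expo_mix _ _ _ _) => [x||] [y||]// _ _ [e]; congr EFin.
  apply: (@addIr _ ((G T m * beta + 2 * vs ^+ 2) / 2)%R).
  by rewrite -[in RHS]addrA e; field; rewrite gt_eqF.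
have E1 s : (s < T)%R -> x1 s = psi s + conv x1 k0 s.
  move=> sT; have [s0|s0] := leP s 0%R.
    rewrite x1n// /psi /ray ltNge s0/= (heat_kernel0 (2 * nu) 0 s0) !mulr0 addr0 add0e convE integral0_eq// => r _.
    have [r0|r0] := leP r 0%R; first by rewrite x1n// mul0e.
    by rewrite kern_le0 ?mule0// subr_le0; lra.
  have Ts0 : (0 < T - s)%R by rewrite subr_gt0.
  pose B (w : (R * R) * R) := (G (T - s) (m - w.1.1))%:E *
    (k0 (s - w.1.2)%R * (G (s - w.1.2) (w.1.1 - w.2))%:E * phi w.1.2 w.2).
  have mB : measurable_fun setT B.
    apply: emeasurable_funM; first by apply: mG => //; apply: measurable_funB => //; exact: measurableT_comp.
    apply: emeasurable_funM; last first.
      apply: (@measurableT_comp _ _ _ _ _ _ (fun z : R * R => phi z.1 z.2) _ (fun w : R * R * R => (w.1.2, w.2))) => //.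
      by apply: measurable_fun_pair => //; exact: measurableT_comp.
    apply: emeasurable_funM.
      by apply: measurableT_comp => //; apply: measurable_funB => //; exact: measurableT_comp.
    by apply: mG; apply: measurable_funB => //; exact: measurableT_comp.
  have B0 w : 0 <= B w by rewrite /B !mule_ge0//; rewrite lee_fin heat_kernel_ge0.
  have mB1F : measurable_fun setT (fun w : R * R => \int[mu]_z B (w, z)).
    exact: (measurable_fun_fubini_tonelli_F (m2 := mu) B).
  have mB2F : measurable_fun setT (fun y : R => \int[mu]_r \int[mu]_z B ((y, r), z)).
    apply: (measurable_fun_fubini_tonelli_F (m2 := mu) (fun w : R * R => \int[mu]_z B (w, z))) => //.
    by move=> w; apply: integral_ge0.
  have Bin y : (G (T - s) (m - y))%:E *
      (\int[mu]_r \int[mu]_z (k0 (s - r)%R * (G (s - r) (y - z))%:E * phi r z)) =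
      \int[mu]_r \int[mu]_z B ((y, r), z).
    have mC : measurable_fun setT (fun w : R * R => k0 (s - w.1)%R * (G (s - w.1) (y - w.2))%:E * phi w.1 w.2).
      apply: emeasurable_funM => //; apply: emeasurable_funM.
        by apply: measurableT_comp => //; exact: measurable_funB.
      by apply: mG; exact: measurable_funB.
    have C0 (w : R * R) : 0 <= k0 (s - w.1)%R * (G (s - w.1) (y - w.2))%:E * phi w.1 w.2.
      by rewrite !mule_ge0//; rewrite lee_fin heat_kernel_ge0.
    rewrite -ge0_integralZl; last 4 first.
    - exact: measurableT.
    - exact: (measurable_fun_fubini_tonelli_F (m2 := mu) (fun w : R * R => k0 (s - w.1)%R * (G (s - w.1) (y - w.2))%:E * phi w.1 w.2)).
    - by move=> r _; apply: integral_ge0 => z _; exact: (C0 (r, z)).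
    - by rewrite lee_fin heat_kernel_ge0.
    apply: eq_integral => r _; rewrite -ge0_integralZl; last 4 first.
    - exact: measurableT.
    - exact: (measurableT_comp mC (measurable_pair1 r)).
    - by move=> z _; exact: (C0 (r, z)).
    - by rewrite lee_fin heat_kernel_ge0.
    by [].
  have -> : x1 s = \int[mu]_y ((G (T - s) (m - y))%:E *
      ((vs ^+ 2 + heat_kernel (2 * nu) s 0 * G s y)%:E) + \int[mu]_r \int[mu]_z B ((y, r), z)).
    apply: eq_integral => y _; rewrite phiE ?s0// -Bin ge0_muleDr//.
    - by rewrite lee_fin addr_ge0 ?sqr_ge0// mulr_ge0 ?heat_kernel_ge0.
    - apply: integral_ge0 => r _; apply: integral_ge0 => z _.
      by rewrite !mule_ge0//; rewrite lee_fin heat_kernel_ge0.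
  rewrite ge0_integralD; last 5 first.
  - exact: measurableT.
  - by move=> y _; rewrite mule_ge0// lee_fin ?heat_kernel_ge0// addr_ge0 ?sqr_ge0// mulr_ge0 ?heat_kernel_ge0.
  - apply: emeasurable_funM; first by apply: mG => //; exact: measurable_funB.
    apply/measurable_EFinP/measurable_funD => //; apply: measurable_funM => //.
    exact: measurable_heat_kernel_comp.
  - by move=> y _; apply: integral_ge0 => r _; apply: integral_ge0 => z _.
  - exact: mB2F.
  congr (_ + _).
    transitivity (\int[mu]_y ((vs ^+ 2)%:E * (G (T - s) (m - y))%:E +
        (heat_kernel (2 * nu) s 0)%:E * ((G s y)%:E * (G (T - s) (m - y))%:E))).
      apply: eq_integral => y _; rewrite -!EFinM -EFinD; congr EFin; ring.
    have mGG : measurable_fun setT (fun y : R => (G s y)%:E * (G (T - s) (m - y))%:E).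
      by apply: emeasurable_funM; apply: mG => //; exact: measurable_funB.
    have mG1 : measurable_fun setT (fun y : R => (G (T - s) (m - y))%:E).
      by apply: mG => //; exact: measurable_funB.
    have GG0 y : 0 <= (G s y)%:E * (G (T - s) (m - y))%:E.
      by rewrite mule_ge0//; rewrite lee_fin heat_kernel_ge0.
    have G10 y : 0 <= (G (T - s) (m - y))%:E by rewrite lee_fin heat_kernel_ge0.
    have v0 : 0 <= (vs ^+ 2)%:E by rewrite lee_fin sqr_ge0.
    rewrite ge0_integralD; last 5 first.
    - exact: measurableT.
    - by move=> y _; exact: mule_ge0.
    - exact: measurable_funeM.
    - by move=> y _; apply: mule_ge0.
    - exact: measurable_funeM.
    rewrite ge0_integralZl// ge0_integralZl//.
    rewrite integral_heat_kernel_reflect// heat_kernel_semigroup// [(s + (T - s))%R]addrC subrK.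
    by rewrite mule1 -EFinM -EFinD /psi /ray s0 mulr1 [(G T m * _)%R]mulrC.
  (* Exchanging y first with r and then with z puts the integral in y innermost, where the kernels
     of durations s - r and T - s compose to the one of duration T - r. *)
  rewrite (fubini_tonelli (m1 := mu) (m2 := mu) (fun w : R * R => \int[mu]_z B (w, z)))/=; last 2 first.
  - exact: mB1F.
  - by move=> w; apply: integral_ge0.
  rewrite convE; apply: eq_integral => r _.
  rewrite (fubini_tonelli (m1 := mu) (m2 := mu) (fun w : R * R => B ((w.1, r), w.2)))/=; last 2 first.
  - apply: (@measurableT_comp _ _ _ _ _ _ B _ (fun w : R * R => ((w.1, r), w.2))) => //.
    by apply: measurable_fun_pair => //; exact: measurable_fun_pair.
  - by [].
  rewrite /x1 muleC -ge0_integralZl; last 4 first.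
  - exact: measurableT.
  - exact: (measurableT_comp mI (measurable_pair1 r)).
  - by move=> y _; exact: (I0 (r, y)).
  - exact: kk0.
  apply: eq_integral => z _; rewrite /B/=.
  have [rs|sr] := ltP r s; last first.
    rewrite kern_le0 ?subr_le0// mul0e integral0_eq// => y _.
    by rewrite !mul0e mule0.
  have mGG : measurable_fun setT (fun y : R => (G (s - r) y)%:E * (G (T - s) (m - z - y))%:E).
    by apply: emeasurable_funM; apply: mG => //; exact: measurable_funB.
  have GG0 (y : R) : 0 <= (G (s - r) y)%:E * (G (T - s) (m - z - y))%:E.
    by rewrite mule_ge0//; rewrite lee_fin heat_kernel_ge0.
  rewrite -(@ge0_integral_shift _ z); last 2 first.
  - apply: emeasurable_funM; first by apply: mG => //; exact: measurable_funB.
    apply: emeasurable_funM => //; apply: measurable_funeM.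
    by apply: mG => //; exact: measurable_funB.
  - by move=> y; rewrite !mule_ge0//; rewrite lee_fin heat_kernel_ge0.
  transitivity (\int[mu]_y (k0 (s - r)%R * phi r z * ((G (s - r) y)%:E * (G (T - s) (m - z - y))%:E))).
    apply: eq_integral => y _; rewrite addrK opprD addrA addrAC.
    by rewrite muleC -!muleA; congr (_ * _); rewrite muleCA; congr (_ * _); rewrite muleC.
  rewrite ge0_integralZl//; last by rewrite mule_ge0.
  rewrite heat_kernel_semigroup ?subr_gt0//.
  have -> : (s - r + (T - s) = T - r)%R by ring.
  by rewrite -muleA; congr (_ * _); rewrite muleC.
have X12 : forall s, (s < T)%R -> x1 s = x2 s.
  apply: (@resolvent_unique _ _ _ c0 l0 T psi x1 x2) => //.
  - move=> s /andP[_ sT]; rewrite fin_numD/= ge0_fin_numE; last exact: conv_ge0.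
    (* [psi] lies below [x2], whose convolution is bounded by the finite [x2 s]. *)
    apply: (@le_lt_trans _ _ (conv x2 k0 s)).
      by apply: le_conv => // r; rewrite E2 leeDl// conv_ge0.
    apply: (@le_lt_trans _ _ (x2 s)); first by rewrite [X in _ <= X]E2 leeDr.
    by rewrite -ge0_fin_numE.
  - by rewrite -kI.
  - apply: (@le_lt_trans _ _ (x2 T)); first by rewrite [X in _ <= X]E2 leeDr.
    by rewrite -ge0_fin_numE.
rewrite (kI (fun s => (heat_kernel (2 * nu) s q)%:E))//.
have -> : conv x1 (fun s => (heat_kernel (2 * nu) s q)%:E) T = conv x2 (fun s => (heat_kernel (2 * nu) s q)%:E) T.
  rewrite !convE; apply: eq_integral => s _; have [st|ts] := ltP s T; first by rewrite X12.
  by rewrite heat_kernel0 ?mule0// subr_le0.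
have := conv_mixture_heat_kernel c0 l0 T Gp Q0 q0.
rewrite -/x2.
move: (expo_mix_fin 0 T q c0) (expo_mix_fin beta T q c0).
move: (conv_ge0 T x20 (hk0 q)).
move: (conv x2 _ T) (expo_mix (2 * nu) 0 T q) (expo_mix (2 * nu) beta T q) => [x||] [y||] [z||]//; last first.
  by rewrite gt0_muley ?lte_fin.
move=> _ _ _ [e]; congr EFin.
apply: (@addIr _ (G T m * beta * y)%R).
rewrite [RHS]addrC -e; ring.
Qed.

End Second_moment_equation.

(** * From trigonometric functions to a sigma-algebra *)

Section RealIntegral.
Context d (T : measurableType d) (R : realType) (mu : {measure set T -> \bar R}).
Implicit Types f g : T -> R.

Definition itg (f : T -> R) : Prop := mu.-integrable [set: T] (EFin \o f).

Lemma itg_measurable f : itg f -> measurable_fun setT f.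
Proof. by move=> /measurable_int/measurable_EFinP. Qed.

Lemma itgE f : itg f -> (\int[mu]_w (f w)%:E)%E = (\int[mu]_w f w)%:E.
Proof.
by move=> f1; rewrite /Rintegral fineK//; exact: integrable_fin_num f1.
Qed.

Lemma itg_lty f : measurable_fun setT f -> (forall w, 0 <= f w) ->
  (\int[mu]_w (f w)%:E < +oo)%E -> itg f.
Proof.
move=> mf f0 fy; apply/integrableP; split; first exact/measurable_EFinP.
rewrite (eq_integral (fun w => (f w)%:E))// => w _ /=.
by rewrite ger0_norm.
Qed.

Lemma itg_le f g : measurable_fun setT f -> (forall w, `|f w| <= g w) ->
  itg g -> itg f.
Proof.
move=> mf fg; apply: le_integrable => //; first exact/measurable_EFinP.
by move=> w _ /=; rewrite lee_fin (le_trans (fg w))// ler_norm.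
Qed.

Lemma itgD f g : itg f -> itg g -> itg (fun w => f w + g w).
Proof. by move=> f1 g1; exact: (integrableD measurableT f1 g1). Qed.

Lemma itgB f g : itg f -> itg g -> itg (fun w => f w - g w).
Proof. by move=> f1 g1; exact: (integrableB measurableT f1 g1). Qed.

Lemma itgZ k f : itg f -> itg (fun w => k * f w).
Proof. by move=> f1; exact: (integrableZl measurableT k f1). Qed.

Lemma itg_sum I (s : seq I) (f : I -> T -> R) : (forall i, itg (f i)) ->
  itg (fun w => \sum_(i <- s) f i w).
Proof.
move=> fi; elim: s => [|i s IH].
  rewrite /itg (_ : _ \o _ = cst 0%E); first exact: integrable0.
  by apply/funext => w /=; rewrite big_nil.
rewrite (_ : (fun w => _) = fun w => f i w + \sum_(i <- s) f i w).
  exact: itgD.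
by apply/funext => w; rewrite big_cons.
Qed.

Lemma itg_mule (k : R) f g : measurable_fun setT g -> (forall w, `|g w| <= k) ->
  itg f -> itg (fun w => g w * f w).
Proof.
move=> mg gk f1; apply: (@itg_le _ (fun w => k * `|f w|)).
- by apply: measurable_funM => //; exact: itg_measurable.
- by move=> w; rewrite normrM ler_wpM2r.
- by apply: itgZ; exact: integrable_norm f1.
Qed.

Lemma RintD f g : itg f -> itg g ->
  \int[mu]_w (f w + g w) = \int[mu]_w f w + \int[mu]_w g w.
Proof. exact: (@RintegralD _ _ _ mu setT f g measurableT). Qed.

Lemma RintB f g : itg f -> itg g ->
  \int[mu]_w (f w - g w) = \int[mu]_w f w - \int[mu]_w g w.
Proof. exact: (@RintegralB _ _ _ mu setT f g measurableT). Qed.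

Lemma RintZ k f : itg f -> \int[mu]_w (k * f w) = k * \int[mu]_w f w.
Proof. exact: (@RintegralZl _ _ _ mu setT f k measurableT). Qed.

Lemma Rint_sum I (s : seq I) (f : I -> T -> R) : (forall i, itg (f i)) ->
  \int[mu]_w (\sum_(i <- s) f i w) = \sum_(i <- s) \int[mu]_w f i w.
Proof.
move=> fi; elim: s => [|i s IH].
  rewrite big_nil (_ : Rintegral _ _ _ = \int[mu]_w (0 * 0)).
    by rewrite RintZ ?mul0r//; exact: integrable0.
  by apply: eq_Rintegral => w _; rewrite big_nil mul0r.
rewrite big_cons -IH -RintD//; last exact: itg_sum.
by apply: eq_Rintegral => w _; rewrite big_cons.
Qed.

Lemma Rint_ae0 f : measurable_fun setT f -> {ae mu, forall w, f w = 0} ->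
  \int[mu]_w f w = 0.
Proof.
move=> mf f0; rewrite /Rintegral (@ae_eq_integral _ _ _ mu setT (cst 0%E))//=.
- by rewrite integral0.
- exact/measurable_EFinP.
- by apply: filterS f0 => w + _ /=; move=> ->.
Qed.

Lemma Rint_dominated (f_ : nat -> T -> R) f g :
  (forall n, measurable_fun setT (f_ n)) -> measurable_fun setT f ->
  (forall w, f_ ^~ w @ \oo --> f w) -> itg g ->
  (forall n w, `|f_ n w| <= g w) ->
  itg f /\ (fun n => \int[mu]_w f_ n w) @ \oo --> \int[mu]_w f w.
Proof.
move=> mf_ mf ff gi fg.
have [] := @dominated_convergence _ _ _ mu setT measurableT
  (fun n => EFin \o f_ n) (EFin \o f) (EFin \o g).
- by move=> n; exact/measurable_EFinP.
- exact/measurable_EFinP.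
- by apply: aeW => w _; apply/cvg_EFin; [exact: nearW|exact: ff].
- exact: gi.
- by apply: aeW => w n _; rewrite lee_fin.
move=> fi _ cv; split => //.
apply: (@fine_cvg _ _ _ _ _ (\int[mu]_w f w)).
by rewrite -itgE.
Qed.

End RealIntegral.

Section Sine.
Context (R : realType).
Implicit Types x : R.

Lemma normr_sin_le x : `|sin x| <= `|x|.
Proof.
have pos (y : R) : 0 <= y -> `|sin y| <= y.
  move=> y0.
  have [|c _] := @MVT_segment R sin cos 0 y y0 (fun z _ => is_derive_sin z).
    by apply: continuous_subspaceT => z; exact: continuous_sin.
  rewrite sin0 !subr0 => ->; rewrite normrM (ger0_norm y0).
  by rewrite ler_piMl// cos_max.
have [x0|x0] := leP 0 x; first by rewrite (ger0_norm x0) pos.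
by rewrite -normrN -sinN (ltr0_norm x0) pos// oppr_ge0 ltW.
Qed.

(** The limit is the derivative at 0 of h |-> sin(h x). Together with |n sin(x / n)| <= |x| it
    recovers x, and its square, from trigonometric functions by dominated convergence. *)
Lemma cvg_mulr_sinV x :
  (fun n => n.+1%:R * sin (n.+1%:R^-1 * x)) @ \oo --> x.
Proof.
have h : is_derive (0 : R) 1 (fun h => sin (h * x)) x.
  have h1 : is_derive (0 : R) 1 (fun h : R => h * x) x.
    have := @is_deriveM _ _ id (cst x) (0 : R) 1 1 0 _ _.
    by rewrite scaler0 add0r /GRing.scale/= mulr1; exact.
  have := @is_derive1_comp _ (@sin R) (fun h : R => h * x) 0 _ _
    (is_derive_sin _) h1.
  by rewrite /GRing.scale/= mul0r cos0 mul1r.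
have [D E] := h.
have h2 : (fun h : R => h^-1 * sin (h * x)) @ 0^' --> x.
  rewrite -{2}E; move: D; rewrite /derivable /derive /=.
  under eq_fun do rewrite addr0 mul0r sin0 subr0 /GRing.scale/= mulr1.
  exact.
have /cvg_at_rightP/(_ (fun n => n.+1%:R^-1)) := cvg_dnbhs_at_right h2.
rewrite (_ : (fun n => _ * _) = fun n : nat => n.+1%:R * sin (n.+1%:R^-1 * x)).
  by apply; split => [n|]; [rewrite invr_gt0|exact: cvg_harmonic].
by apply/funext => n; rewrite invrK.
Qed.

End Sine.

(** * From orthogonality to cosines to a vanishing conditional expectation *)

Section Multipliers.
Context d (T : measurableType d) (R : realType) (P : probability T R).
Variables (V : set (T -> R)) (zeta : T -> R).
Hypotheses (V0 : V (cst 0)) (VD : forall f g, V f -> V g -> V (fun w => f w + g w))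
  (VZ : forall k f, V f -> V (fun w => k * f w))
  (Vm : forall f, V f -> measurable_fun setT f).
Hypotheses (zi : itg P zeta) (Vz : forall f t, V f ->
  \int[P]_w (cos (f w + t) * zeta w) = 0).
Implicit Types (f g Y m : T -> R).

Definition mbounded f :=
  measurable_fun setT f /\ exists k : R, forall w, `|f w| <= k.

Lemma mboundedM f g : mbounded f -> mbounded g -> mbounded (fun w => f w * g w).
Proof.
move=> [mf [k fk]] [mg [l gl]]; split; first exact: measurable_funM.
by exists (k * l) => w; rewrite normrM ler_pM.
Qed.

Lemma mboundedD f g : mbounded f -> mbounded g -> mbounded (fun w => f w + g w).
Proof.
move=> [mf [k fk]] [mg [l gl]]; split; first exact: measurable_funD.
by exists (k + l) => w; rewrite (le_trans (ler_normD _ _))// lerD.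
Qed.

Lemma mbounded_cst (k : R) : mbounded (fun _ => k).
Proof. by split; [exact: measurable_cst|exists `|k|]. Qed.

Lemma itg_mbounded f g : mbounded f -> itg P g -> itg P (fun w => f w * g w).
Proof. by move=> [mf [k fk]] gi; exact: itg_mule fk gi. Qed.

Lemma mbounded_cos f t : V f -> mbounded (fun w => cos (f w + t)).
Proof.
move=> Vf; split; last first.
  by exists 1 => w; rewrite ler_norml cos_geN1 cos_le1.
apply: measurableT_comp; last by apply: measurable_funD => //; exact: Vm.
by apply: continuous_measurable_fun; exact: continuous_cos.
Qed.

(* The multipliers, which keep the functions orthogonal to all [cos (f + t) * zeta]
   stable, form an algebra closed under bounded pointwise limits; it contains
   the trigonometric functions, hence by approximation of the sign function the
   indicators of the generating sets. *)
Definition annihilates Y := mbounded Y /\ forall f t, V f ->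
  \int[P]_w (Y w * cos (f w + t) * zeta w) = 0.

Definition multiplier m := mbounded m /\
  forall Y, annihilates Y -> annihilates (fun w => Y w * m w).

Let itg3 Y f t : mbounded Y -> V f ->
  itg P (fun w => Y w * cos (f w + t) * zeta w).
Proof.
move=> bY Vf; apply: itg_mbounded zi.
exact: (mboundedM bY (mbounded_cos t Vf)).
Qed.

Lemma annihilatesD Y Z : annihilates Y -> annihilates Z ->
  annihilates (fun w => Y w + Z w).
Proof.
move=> [bY YV] [bZ ZV]; split; first exact: mboundedD.
move=> f t Vf; under eq_Rintegral do rewrite 2!mulrDl.
by rewrite RintD; [rewrite YV// ZV// addr0|exact: itg3..].
Qed.

Lemma annihilatesZ k Y : annihilates Y -> annihilates (fun w => k * Y w).
Proof.
move=> [bY YV]; split; first by apply: mboundedM => //; exact: mbounded_cst.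
move=> f t Vf; under eq_Rintegral do rewrite -(mulrA k) -(mulrA k).
by rewrite RintZ; [rewrite YV// mulr0|exact: itg3].
Qed.

Lemma annihilates1 : annihilates (fun _ => 1).
Proof.
split; first exact: mbounded_cst.
by move=> f t Vf; under eq_Rintegral do rewrite mul1r; exact: Vz.
Qed.

Lemma multiplier_cst k : multiplier (fun _ => k).
Proof.
split; first exact: mbounded_cst.
move=> Y /(annihilatesZ k); rewrite (_ : (fun w => k * Y w) = fun w => Y w * k)//.
by apply/funext => w; rewrite mulrC.
Qed.

Lemma multiplierD m n : multiplier m -> multiplier n ->
  multiplier (fun w => m w + n w).
Proof.
move=> [bm hm] [bn hn]; split; first exact: mboundedD.
move=> Y YA; rewrite (_ : (fun w => _) = fun w => Y w * m w + Y w * n w).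
  by apply: annihilatesD; [exact: hm|exact: hn].
by apply/funext => w; rewrite mulrDr.
Qed.

Lemma multiplierM m n : multiplier m -> multiplier n ->
  multiplier (fun w => m w * n w).
Proof.
move=> [bm hm] [bn hn]; split; first exact: mboundedM.
move=> Y YA; rewrite (_ : (fun w => _) = fun w => Y w * m w * n w).
  by apply: hn; exact: hm.
by apply/funext => w; rewrite mulrA.
Qed.

Lemma multiplierZ k m : multiplier m -> multiplier (fun w => k * m w).
Proof. by move=> mm; apply: multiplierM mm; exact: multiplier_cst. Qed.

(** A product of two cosines is half the sum of the cosines of the sum and of the difference, whose
    arguments stay in the linear space [V] up to a phase. Keeping the phase t covers the sine as
    well. *)
Lemma multiplier_cos f t : V f -> multiplier (fun w => cos (f w + t)).
Proof.
move=> Vf; split; first exact: mbounded_cos.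
move=> Y [bY YV]; split; first by apply: mboundedM => //; exact: mbounded_cos.
move=> g s Vg.
have Vd : V (fun w => f w + (-1) * g w) by apply: VD => //; exact: VZ.
have Vs := VD Vf Vg.
transitivity (\int[P]_w (2^-1 * (Y w * cos (f w + g w + (t + s)) * zeta w +
    Y w * cos (f w + (-1) * g w + (t - s)) * zeta w))).
  apply: eq_Rintegral => w _.
  have -> : f w + g w + (t + s) = (f w + t) + (g w + s) by ring.
  have -> : f w + -1 * g w + (t - s) = (f w + t) - (g w + s) by ring.
  by rewrite (cosD (f w + t)) (cosB (f w + t)); field.
rewrite RintZ; last by apply: itgD; exact: itg3.
rewrite RintD; [|exact: itg3..].
by rewrite !YV// addr0 mulr0.
Qed.

Lemma multiplier_sin f : V f -> multiplier (fun w => sin (f w)).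
Proof.
move=> Vf; have := multiplier_cos (- (pi / 2)) Vf; congr multiplier.
by apply/funext => w; rewrite cosB cos_pihalf sin_pihalf mulr0 add0r mulr1.
Qed.

Lemma multiplier_lim (m_ : nat -> T -> R) m (k : R) :
  (forall n, multiplier (m_ n)) -> (forall n w, `|m_ n w| <= k) ->
  (forall w, m_ ^~ w @ \oo --> m w) -> multiplier m.
Proof.
move=> mm mk mc.
have m_m : measurable_fun setT m.
  apply: (@measurable_fun_cvg _ _ _ _ m_) => [n|w _]; last exact: mc.
  by have [[]] := mm n.
have bm : mbounded m.
  split=> //; exists k => w.
  have h : (fun n => `|m_ n w|) @ \oo --> `|m w| by apply: cvg_norm; exact: mc.
  rewrite -(cvg_lim _ h)//; apply: limr_le; first by apply: cvgP h.
  by apply: nearW => n; exact: mk.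
split=> // Y YA; split; first by case: YA => bY _; exact: mboundedM.
move=> f t Vf; have [bY _] := YA.
have bc := mboundedM bY (mbounded_cos t Vf).
have [c1 [K cK]] := bc.
have [_ h] : itg P (fun w => Y w * m w * cos (f w + t) * zeta w) /\
    (fun n => \int[P]_w (Y w * m_ n w * cos (f w + t) * zeta w)) @ \oo -->
    \int[P]_w (Y w * m w * cos (f w + t) * zeta w).
  apply: (@Rint_dominated _ _ _ P _ _ (fun w => K * k * `|zeta w|)).
  - move=> n; apply: itg_measurable; apply: itg3 => //.
    by apply: mboundedM => //; case: (mm n).
  - by apply: itg_measurable; apply: itg3 => //; exact: mboundedM.
  - move=> w; apply: cvgM; last exact: cvg_cst.
    apply: cvgM; last exact: cvg_cst.
    by apply: cvgM; [exact: cvg_cst|exact: mc].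
  - by apply: itgZ; exact: integrable_norm zi.
  - move=> n w; rewrite !normrM ler_wpM2r//.
    by rewrite mulrAC ler_pM// -normrM.
rewrite -(cvg_lim _ h)//; apply: lim_near_cst => //.
apply: nearW => n; have [_ /(_ _ YA)[_]] := mm n.
exact.
Qed.

(* Its iterates converge to the sign function on [-1, 1]. *)
Let sg (x : R) := (3 * x - x ^+ 3) / 2.

Let sg_bounded x : `|x| <= 1 -> `|sg x| <= 1.
Proof.
rewrite !ler_norml => /andP[x0 x1].
have h (y : R) : -1 <= y -> y <= 1 -> sg y <= 1.
  move=> y0 y1; rewrite -subr_ge0.
  have -> : 1 - sg y = (1 - y) ^+ 2 * ((2 + y) / 2) by rewrite /sg; field.
  by rewrite mulr_ge0 ?sqr_ge0//; lra.
rewrite h// andbT lerNl.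
have -> : - sg x = sg (- x) by rewrite /sg; field.
by apply: h; lra.
Qed.

Let sg_iter x n : `|x| <= 1 -> `|iter n sg x| <= 1.
Proof. by move=> x1; elim: n => //= n; exact: sg_bounded. Qed.

(** From 1 - sg y = (1 - y) (1 - y/2 - y^2/2): as the iterates stay above x, the distance to 1
    shrinks at each step by a factor at most 1 - x/2. *)
Let sg_iter_gt0 x n : 0 < x -> x <= 1 ->
  x <= iter n sg x <= 1 /\ 1 - iter n sg x <= (1 - x / 2) ^+ n.
Proof.
move=> x0 x1; elim: n => [|n [/andP[h1 h2] h3]].
  by rewrite /= lexx x1 expr0; split => //; lra.
rewrite iterS; set y := iter n sg x in h1 h2 h3 *.
have y0 : 0 < y by exact: lt_le_trans h1.
have e : 1 - sg y = (1 - y) * (1 - y / 2 - y ^+ 2 / 2) by rewrite /sg; field.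
have le1 : sg y <= 1.
  have := @sg_bounded y; rewrite !ler_norml.
  have -> : -1 <= y <= 1 by apply/andP; split; lra.
  by move=> /(_ isT) /andP[].
split.
  rewrite le1 andbT (le_trans h1)// -subr_ge0.
  have -> : sg y - y = y * ((1 - y) * (1 + y)) / 2 by rewrite /sg; field.
  by rewrite divr_ge0// mulr_ge0 ?(ltW y0)// mulr_ge0; lra.
rewrite e (exprSr (1 - x / 2)).
have y2 := sqr_ge0 y.
apply: (@le_trans _ _ ((1 - y) * (1 - x / 2))).
  by apply: ler_wpM2l; lra.
by apply: ler_wpM2r; lra.
Qed.

Let sg_cvg x : `|x| <= 1 -> (fun n => iter n sg x) @ \oo --> Num.sg x.
Proof.
have pos (y : R) : 0 < y -> y <= 1 -> (fun n => iter n sg y) @ \oo --> (1 : R).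
  move=> y0 y1; apply: (squeeze_cvgr (f := fun n => 1 - (1 - y / 2) ^+ n)
    (h := fun _ => 1)).
  - apply: nearW => n; have [/andP[_ h1] h2] := sg_iter_gt0 n y0 y1.
    by rewrite h1 andbT; lra.
  - rewrite -[X in _ --> X]subr0; apply: cvgB; first exact: cvg_cst.
    by apply: cvg_expr; rewrite ger0_norm; lra.
  - exact: cvg_cst.
rewrite ler_norml => /andP[x0 x1]; case: (sgrP x) => [->|x2|x2].
- have -> : (fun n => iter n sg 0) = (fun _ => 0).
    apply/funext; elim => //= n ->.
    by rewrite /sg mulr0 expr0n/= subr0 mul0r.
  exact: cvg_cst.
- exact: pos.
- have -> : (fun n => iter n sg x) = (fun n => - iter n sg (- x)).
    apply/funext; elim => [|n IH]; first by rewrite opprK.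
    by rewrite !iterS IH /sg; field.
  by apply: cvgN; apply: pos; lra.
Qed.

Lemma multiplier_sgr m : multiplier m -> multiplier (fun w => Num.sg (m w)).
Proof.
move=> mm; have [[_ [k mk]] _] := mm.
(* Division by [l] brings m into [-1, 1], where the iterates of [sg] converge; it does not change
   the sign, since the added 1 makes [l] positive. *)
pose l := `|k| + 1; have l0 : 0 < l by rewrite /l ltr_wpDl.
have ml w : `|l^-1 * m w| <= 1.
  rewrite normrM ger0_norm ?invr_ge0 ?(ltW l0)// mulrC ler_pdivrMr// mul1r.
  by rewrite (le_trans (mk w))// /l (le_trans (ler_norm _))// lerDl.
have -> : (fun w => Num.sg (m w)) = (fun w => Num.sg (l^-1 * m w)).
  by apply/funext => w; rewrite sgrM (_ : Num.sg l^-1 = 1) ?mul1r// gtr0_sg// invr_gt0.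
apply: (@multiplier_lim (fun n w => iter n sg (l^-1 * m w)) _ 1).
- elim => [|n IH]; first exact: multiplierZ.
  rewrite (_ : (fun w => _) = fun w => 3 / 2 * iter n sg (l^-1 * m w) +
    - 2^-1 * (iter n sg (l^-1 * m w) * (iter n sg (l^-1 * m w) *
    iter n sg (l^-1 * m w)))).
    apply: multiplierD; apply: multiplierZ => //.
    by apply: multiplierM => //; exact: multiplierM.
  by apply/funext => w; rewrite iterS {1}/sg; field.
- by move=> n w; exact: sg_iter.
- by move=> w; exact: sg_cvg.
Qed.

(* [n sin (f / n) - n sin (c / n)] tends to [f - c] and vanishes where [f = c]. *)
Lemma multiplier_sgr_sub f c : V f -> multiplier (fun w => Num.sg (f w - c)).
Proof.
move=> Vf.
apply: (@multiplier_lim (fun n w => Num.sg (n.+1%:R * sin (n.+1%:R^-1 * f w) +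
   - (n.+1%:R * sin (n.+1%:R^-1 * c)))) _ 1).
- move=> n; apply: multiplier_sgr; apply: multiplierD; last exact: multiplier_cst.
  by apply: multiplierZ; apply: multiplier_sin; exact: VZ.
- move=> n w; case: sgrP => _; rewrite ?normr0 ?normrN ?normr1//.
- move=> w; case: (sgrP (f w - c)) => [|h|h].
  + move=> /subr0_eq ->; under eq_fun do rewrite subrr sgr0.
    exact: cvg_cst.
  + apply: cvg_near_cst.
    near=> n; rewrite gtr0_sg//; near: n.
    exact: (cvgr_gt _ (cvgB (@cvg_mulr_sinV R (f w)) (@cvg_mulr_sinV R c)) 0 h).
  + apply: cvg_near_cst.
    near=> n; rewrite ltr0_sg//; near: n.
    exact: (cvgr_lt _ (cvgB (@cvg_mulr_sinV R (f w)) (@cvg_mulr_sinV R c)) 0 h).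
Unshelve. all: by end_near.
Qed.

Lemma multiplier_indic_gt f c : V f ->
  multiplier (\1_[set w | c < f w] : T -> R).
Proof.
move=> Vf; have mm := multiplier_sgr_sub c Vf.
have -> : (\1_[set w | c < f w] : T -> R) =
    fun w => 2^-1 * (Num.sg (f w - c) * Num.sg (f w - c) + Num.sg (f w - c)).
  apply/funext => w; rewrite indicE; case: sgrP => h.
  - by rewrite memNset ?mulr0 ?addr0 ?mulr0//= => /lt_eqF; lra.
  - by rewrite mem_set//=; [field|lra].
  - by rewrite memNset//=; [field|lra].
by apply: multiplierZ; apply: multiplierD => //; exact: multiplierM.
Qed.

Let D : set (set T) := [set E | measurable E /\ multiplier (\1_E : T -> R)].

(** Products of multipliers give finite intersections, subtraction from 1 gives complements, and a
    countable union is the bounded pointwise limit of finite unions. *)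
Let D_sigma : sigma_algebra [set: T] D.
Proof.
have D0 : D set0.
  split=> //; rewrite (_ : \1_set0 = fun _ => 0); first exact: multiplier_cst.
  by apply/funext => w; rewrite indic0.
have DC E : D E -> D (~` E).
  move=> [mE ME]; split; first exact: measurableC.
  rewrite (_ : \1_(~` E) = fun w => 1 + (-1) * \1_E w).
    by apply: multiplierD; [exact: multiplier_cst|exact: multiplierZ].
  by apply/funext => w; rewrite !indicE in_setC; case: (_ \in _) => /=; ring.
have DI E F : D E -> D F -> D (E `&` F).
  move=> [mE ME] [mF MF]; split; first exact: measurableI.
  rewrite indicI; exact: multiplierM.
have DU E F : D E -> D F -> D (E `|` F).
  by move=> DE DF; rewrite -(setCK (E `|` F)) setCU; apply: (DC); apply: DI; exact: DC.
split=> //; first by move=> E DE; rewrite setTD; exact: DC.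
move=> F DF; have mF n : measurable (F n) by case: (DF n).
split; first exact: bigcup_measurable.
pose G n := \bigcup_(i in `I_n) F i.
apply: (@multiplier_lim (fun n => \1_(G n)) _ 1).
- have DG n : D (G n).
    elim: n => [|n IH]; first by rewrite /G II0 bigcup_set0.
    by rewrite /G IIS bigcup_setU bigcup_set1; exact: DU.
  by move=> n; case: (DG n).
- by move=> n w; rewrite indicE; case: (_ \in _); rewrite ?normr1 ?normr0.
- move=> w; apply: cvg_near_cst.
  have [[i _ Fi]|nF] := pselect ((\bigcup_i F i) w).
    exists i.+1 => // n /= ni; rewrite !indicE !mem_set//; last by exists i.
    by exists i.
  apply: nearW => n; rewrite !indicE !memNset// => -[i _ Fi]; apply: nF.
  by exists i.
Qed.

Lemma multiplier_preimage f B : V f -> measurable B ->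
  multiplier (\1_(f @^-1` B) : T -> R).
Proof.
move=> Vf mB.
have S : sigma_algebra [set: R] [set B | D (f @^-1` B)].
  have [h0 hC hU] := D_sigma; split => /=.
  - by rewrite preimage_set0.
  - by move=> A /hC; rewrite !setTD preimage_setC.
  - by move=> F DF; rewrite preimage_bigcup; exact: hU.
suff : D (f @^-1` B) by case.
have {mB} : (@RGenOInfty.G R).-sigma.-measurable B by rewrite -RGenOInfty.measurableE.
apply: (smallest_sub S) => _ [c ->]; split; last first.
  have := multiplier_indic_gt c Vf; congr multiplier; congr indic.
  by apply/seteqP; split=> w /=; rewrite in_itv/= andbT.
by rewrite -[X in measurable X]setTI; apply: Vm => //; exact: measurable_itv.
Qed.

Hypothesis (hP : measure_is_complete P).

Definition generated : set (set T) :=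
  <<s [set E | exists f B, [/\ V f, measurable B & E = f @^-1` B]] `|`
      [set N | P.-negligible N] >>.

(** For the null sets among the generators, completeness of P gives measurability, and all the
    integrals that define a multiplier vanish. *)
Lemma multiplier_generated E : generated E ->
  measurable E /\ multiplier (\1_E : T -> R).
Proof.
apply: (smallest_sub D_sigma) => {}E [[f [B [Vf mB ->]]]|NE].
  split; last exact: multiplier_preimage.
  by rewrite -[X in measurable X]setTI; exact: Vm.
have mE := hP NE; split=> //.
have bE : mbounded (\1_E : T -> R).
  split; first exact: measurable_indic.
  by exists 1 => w; rewrite indicE; case: (_ \in _); rewrite ?normr1 ?normr0.
split=> // Y [bY _]; split; first exact: mboundedM.
move=> f t Vf; apply: Rint_ae0.
  by apply: itg_measurable; apply: itg3 => //; exact: mboundedM.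
apply: negligibleS NE => w /= h; apply: contrapT => nE; apply: h.
by rewrite indicE memNset// !(mulr0,mul0r).
Qed.

Lemma Rint_generated E : generated E -> \int[P]_w (\1_E w * zeta w) = 0.
Proof.
(* Orthogonality is read off at f = 0 and t = 0, where the cosine is 1. *)
move=> /multiplier_generated[_ [_ /(_ _ annihilates1)[_ /(_ _ 0 V0)]]].
by under eq_Rintegral do rewrite addr0 cos0 mulr1 mul1r.
Qed.

Lemma measurable_generated Y :
  (forall B : set R, measurable B -> generated (Y @^-1` B)) ->
  measurable_fun setT Y.
Proof.
move=> hY _ B mB; rewrite setTI.
by case: (multiplier_generated (hY _ mB)).
Qed.

Import HBNNSimple.

Let GT := g_sigma_algebraType
   ([set E | exists f B, [/\ V f, measurable B & E = f @^-1` B]] `|`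
      [set N | P.-negligible N]).

Let Rint_generated_ge0 (Y : GT -> R) : (forall w, 0 <= Y w) ->
  measurable_fun setT Y -> itg P (fun w : T => Y w * zeta w) ->
  \int[P]_(w in [set: T]) (Y w * zeta w) = 0.
Proof.
move=> Y0 mY Yi.
have mYE : measurable_fun [set: GT] (EFin \o Y) by exact/measurable_EFinP.
have [g [nd cg]] := approximation measurableT mYE (fun w _ => Y0 w : (0 <= (Y w)%:E)%E).
have cgR w : (fun n => g n w) @ \oo --> Y w by exact: (fine_cvg (cg w I)).
have gY n w : g n w <= Y w.
  have cgw := cgR w.
  rewrite -(cvg_lim _ cgw)//; apply: nondecreasing_cvgn_le.
    by move=> a b ab; exact: (lefP _ _ (nd _ _ ab)).
  by apply: cvgP cgw.
have gen n y : generated (g n @^-1` [set y]).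
  have : measurable (g n @^-1` [set y] : set GT).
    by rewrite -[X in measurable X]setTI; exact: measurable_funP.
  exact.
have mg n : measurable_fun [set: T] (g n).
  move=> _ B mB; rewrite setTI.
  have : generated (g n @^-1` B).
    have : measurable (g n @^-1` B : set GT).
      by rewrite -[X in measurable X]setTI; exact: measurable_funP.
    exact.
  by move/multiplier_generated => [].
have h n : \int[P]_(w in [set: T]) (g n w * zeta w) = 0.
  transitivity (\int[P]_(w in [set: T]) \sum_(y <- finmap.enum_fset (fset_set (range (g n))))
     (y * (\1_(g n @^-1` [set y] : set T) w * zeta w))).
    apply: eq_Rintegral => w _.
    rewrite fimfunE fsbig_finite//= mulr_suml; apply: eq_bigr => y _.
    by rewrite mulrA.
  have ii y : itg P (fun w : T => \1_(g n @^-1` [set y] : set T) w * zeta w).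
    apply: itg_mbounded zi.
    by case: (multiplier_generated (gen n y)) => _ [].
  rewrite Rint_sum; last by move=> y; exact: itgZ.
  by rewrite big1// => y _; rewrite RintZ// Rint_generated ?mulr0.
have [_ cv] : itg P (fun w : T => Y w * zeta w) /\
    (fun n => \int[P]_(w in [set: T]) (g n w * zeta w)) @ \oo -->
    \int[P]_(w in [set: T]) (Y w * zeta w).
  apply: (@Rint_dominated _ _ _ P _ _ (fun w => `|Y w * zeta w|)).
  - by move=> n; apply: measurable_funM => //; exact: itg_measurable zi.
  - exact: itg_measurable Yi.
  - move=> w; apply: cvgM; last exact: cvg_cst.
    exact: cgR.
  - exact: integrable_norm Yi.
  - move=> n w; rewrite !normrM ler_wpM2r//.
    rewrite [leLHS]ger0_norm; last exact: fun_ge0.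
    by rewrite [leRHS]ger0_norm.
rewrite -(cvg_lim _ cv)//; apply: lim_near_cst => //.
exact: nearW.
Qed.

(** In other words, the conditional expectation of [zeta] given the generated sigma-algebra is 0.
    Positive and negative parts are approximated by simple functions, dominated by |Y zeta|. *)
Lemma Rint_generated_fun Y :
  (forall B : set R, measurable B -> generated (Y @^-1` B)) ->
  itg P (fun w => Y w * zeta w) -> \int[P]_w (Y w * zeta w) = 0.
Proof.
move=> hY Yi.
have mY : measurable_fun [set: GT] (Y : GT -> R).
  by move=> _ B mB; rewrite setTI; exact: hY.
have mp : measurable_fun [set: GT] (fun w : GT => Num.max (Y w) 0).
  exact: measurable_maxr.
have mn : measurable_fun [set: GT] (fun w : GT => Num.max (- Y w) 0).
  by apply: measurable_maxr => //; exact: measurableT_comp.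
have mYT := measurable_generated hY.
have ip : itg P (fun w : T => Num.max (Y w) 0 * zeta w).
  apply: (itg_le _ _ (integrable_norm Yi)).
    by apply: measurable_funM; [exact: measurable_maxr|exact: itg_measurable zi].
  move=> w /=; rewrite !normrM ler_wpM2r//.
  by case: (leP (Y w) 0) => h; rewrite ?normr0.
have in_ : itg P (fun w : T => Num.max (- Y w) 0 * zeta w).
  apply: (itg_le _ _ (integrable_norm Yi)).
    apply: measurable_funM; last exact: itg_measurable zi.
    by apply: measurable_maxr => //; exact: measurableT_comp.
  move=> w /=; rewrite !normrM ler_wpM2r//.
  by case: (leP (- Y w) 0) => h; rewrite ?normr0 ?normrN.
rewrite (@eq_Rintegral _ _ _ _ _ (fun w =>
  Num.max (Y w) 0 * zeta w - Num.max (- Y w) 0 * zeta w)).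
  rewrite RintB// !Rint_generated_ge0 ?subr0//.
  - by move=> w; rewrite le_max lexx orbT.
  - by move=> w; rewrite le_max lexx orbT.
move=> w _; rewrite -mulrBl; congr (_ * _).
by case: (leP (Y w) 0) => h; case: (leP (- Y w) 0) => h'; lra.
Qed.

End Multipliers.

(** * Centered Gaussian laws *)

Section CosineTransform.
Context (R : realType).
Notation mu := (@lebesgue_measure R).
Notation G := (@heat_kernel R 1).
Implicit Types s t x y : R.

Let mG t : measurable_fun setT (G t).
Proof. exact: measurable_heat_kernel_comp. Qed.

Let mcos : measurable_fun setT (@cos R).
Proof. by apply: continuous_measurable_fun; exact: continuous_cos. Qed.

Let msin : measurable_fun setT (@sin R).
Proof. by apply: continuous_measurable_fun; exact: continuous_sin. Qed.

Let iG t : 0 < t -> itg mu (G t).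
Proof.
move=> t0; apply: itg_lty; first exact: mG.
  by move=> w; exact: heat_kernel_ge0.
by rewrite integral_heat_kernel// ltry.
Qed.

Let igG t (g : R -> R) : 0 < t -> measurable_fun setT g ->
  (forall x, `|g x| <= 1) -> itg mu (fun x => g x * G t x).
Proof. by move=> t0 mg g1; exact: (@itg_mule _ _ R mu 1 (G t) g mg g1 (iG t0)). Qed.

Definition cosine_transform t := \int[mu]_x (cos x * G t x).

Let c0 x : 0 <= 1 + cos x.
Proof. by have := cos_geN1 x; lra. Qed.

Let cG0 t x y : (0 <= ((1 + cos x) * G t y)%:E)%E.
Proof. by rewrite lee_fin mulr_ge0// heat_kernel_ge0. Qed.

Let mcD y : measurable_fun setT (fun x : R => 1 + cos (x + y)).
Proof.
by apply: measurable_funD => //; apply: measurableT_comp => //; exact: measurable_funD.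
Qed.

(** The added 1 makes the integrand nonnegative, as Tonelli's theorem will require. By symmetry of
    the heat kernel the integral is even in y, and averaging over y and -y removes the sines. *)
Lemma integral_cos_shift t y : 0 < t ->
  (\int[mu]_x ((1 + cos (x + y)) * G t x)%:E =
   (1 + cos y * cosine_transform t)%:E)%E.
Proof.
move=> t0.
have m1 z : measurable_fun setT (fun x : R => ((1 + cos (x + z)) * G t x)%:E).
  by apply/measurable_EFinP; apply: measurable_funM.
have ci z : itg mu (fun x => (1 + cos (x + z)) * G t x).
  apply: itg_lty; first by have /measurable_EFinP := m1 z.
    by move=> x; rewrite mulr_ge0// heat_kernel_ge0.
  apply: (@le_lt_trans _ _ (\int[mu]_x (2 * G t x)%:E)%E).
    apply: ge0_le_integral => //.
    - exact: m1.
    - by apply/measurable_EFinP; apply: measurable_funM => //; exact: mG.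
    - move=> x _; rewrite lee_fin ler_wpM2r ?heat_kernel_ge0//.
      by have := cos_le1 (x + z); lra.
  by rewrite (itgE (itgZ 2 (iG t0))) ltry.
have e : (\int[mu]_x ((1 + cos (x + y)) * G t x)%:E =
          \int[mu]_x ((1 + cos (x - y)) * G t x)%:E)%E.
  rewrite -(ge0_integralN (m1 y)); last by move=> x; exact: cG0.
  apply: eq_integral => x _; rewrite heat_kernelN -cosN; congr (((1 + cos _) * _)%:E).
  by ring.
rewrite (itgE (ci y)); congr EFin.
have e' : \int[mu]_x ((1 + cos (x + y)) * G t x) = \int[mu]_x ((1 + cos (x - y)) * G t x).
  by rewrite /Rintegral e.
have h : \int[mu]_x ((1 + cos (x + y)) * G t x) + \int[mu]_x ((1 + cos (x - y)) * G t x) =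
    2 * (1 + cos y * cosine_transform t).
  rewrite -RintD//.
  transitivity (\int[mu]_x (2 * (G t x + cos y * (cos x * G t x)))).
    by apply: eq_Rintegral => x _; rewrite cosD cosB; ring.
  have i2 := igG t0 mcos (@cos_max R).
  rewrite RintZ; last by apply: itgD; [exact: iG|exact: itgZ].
  rewrite RintD; [|exact: iG|exact: itgZ].
  rewrite RintZ//; congr (2 * (_ + _)).
  by rewrite /Rintegral integral_heat_kernel.
by move: h; rewrite -e'; move: (Rintegral _ _ _) (1 + _) => a b h; lra.
Qed.

(** The semigroup property writes the kernel of time s + t as a double integral; integrating first
    in x gives [integral_cos_shift]. This functional equation is all that is used of the Fourier
    transform of a Gaussian. *)
Lemma cosine_transformD s t : 0 < s -> 0 < t ->
  cosine_transform (s + t) = cosine_transform s * cosine_transform t.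
Proof.
move=> s0 t0.
have st0 : 0 < s + t by rewrite addr_gt0.
suff : (1 + cosine_transform (s + t))%:E = (1 + cosine_transform s * cosine_transform t)%:E.
  by move=> [] /addrI.
have e (t' : R) : 0 < t' -> (\int[mu]_x ((1 + cos x) * G t' x)%:E = (1 + cosine_transform t')%:E)%E.
  move=> t'0; have := integral_cos_shift 0 t'0.
  by under eq_integral do rewrite addr0; rewrite cos0 mul1r.
rewrite -e//.
under eq_integral do rewrite EFinM -heat_kernel_semigroup//.
have m1 : measurable_fun [set: R * R] (fun z => ((1 + cos z.1)%:E * ((G s z.2)%:E * (G t (z.1 - z.2))%:E))%E).
  apply: emeasurable_funM.
    apply/measurable_EFinP; apply: measurable_funD => //.
    exact: measurableT_comp.
  apply: emeasurable_funM; apply/measurable_EFinP; apply: measurable_heat_kernel_comp => //.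
  exact: measurable_funB.
transitivity (\int[mu]_x \int[mu]_y ((1 + cos x)%:E * ((G s y)%:E * (G t (x - y))%:E)))%E.
  apply: eq_integral => x _; rewrite ge0_integralZl//.
  - apply: emeasurable_funM; apply/measurable_EFinP; apply: measurable_heat_kernel_comp => //.
    exact: measurable_funB.
  - by move=> y _; rewrite mule_ge0// lee_fin heat_kernel_ge0.
rewrite (fubini_tonelli (m1 := mu) (m2 := mu) (fun z : R * R =>
   ((1 + cos z.1)%:E * ((G s z.2)%:E * (G t (z.1 - z.2))%:E)))%E) /=; [|exact: m1|]; last first.
  by move=> z; rewrite -!EFinM lee_fin !mulr_ge0// heat_kernel_ge0.
transitivity (\int[mu]_y (((1 + cos y * cosine_transform t) * G s y)%:E))%E.
  apply: eq_integral => y _.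
  rewrite EFinM -integral_cos_shift// -ge0_integralZr//; last 2 first.
  - by apply/measurable_EFinP; apply: measurable_funM => //; [exact: mcD|exact: mG].
  - by rewrite lee_fin heat_kernel_ge0.
  rewrite -[LHS](@ge0_integral_shift R y).
  - apply: eq_integral => x _; rewrite addrK -!EFinM; congr EFin; ring.
  - exact: (@measurableT_comp _ _ _ _ _ _ (fun z : R * R =>
      ((1 + cos z.1)%:E * ((G s z.2)%:E * (G t (z.1 - z.2))%:E))%E) _
      (fun x : R => (x, y : R)) m1 (measurable_pair2 y)).
  - by move=> x; rewrite -!EFinM lee_fin !mulr_ge0// heat_kernel_ge0.
have i1 : itg mu (fun y => G s y + cosine_transform t * (cos y * G s y)).
  by apply: itgD; [exact: iG|apply: itgZ; exact: (igG s0 mcos (@cos_max R))].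
transitivity (\int[mu]_y ((G s y + cosine_transform t * (cos y * G s y))%:E))%E.
  by apply: eq_integral => y _; congr EFin; ring.
have i2 : itg mu (fun y => cos y * G s y) by exact: (igG s0 mcos (@cos_max R)).
rewrite (itgE i1) RintD; [|exact: iG|exact: itgZ].
rewrite (RintZ _ i2); congr ((_ + _)%:E); last exact: mulrC.
by rewrite /Rintegral integral_heat_kernel.
Qed.

End CosineTransform.

(** * Centered Gaussian laws are determined by their variance *)

Section GaussianLaw.
Context d (T : measurableType d) (R : realType) (P : probability T R).
Implicit Types (X Y Z : T -> R) (f : R -> R) (s : R).
Notation mu := (@lebesgue_measure R).

Definition normal_law s X := forall B : set R, measurable B ->
  P (X @^-1` B) = normal_prob 0 s B.

Lemma same_law_integral X Y (f : R -> \bar R) :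
  measurable_fun setT X -> measurable_fun setT Y ->
  (forall B : set R, measurable B -> P (X @^-1` B) = P (Y @^-1` B)) ->
  measurable_fun setT f -> (forall x, 0 <= f x)%E ->
  (\int[P]_w f (X w) = \int[P]_w f (Y w))%E.
Proof.
move=> mX mY XY mf f0.
transitivity (\int[pushforward P (X : T -> measurableTypeR R)]_x f x)%E.
  by rewrite ge0_integral_pushforward.
transitivity (\int[pushforward P (Y : T -> measurableTypeR R)]_x f x)%E.
  by apply: eq_measure_integral => A mA _; exact: XY.
by rewrite ge0_integral_pushforward.
Qed.

Lemma integral_normal_prob s (f : R -> \bar R) : 0 < s ->
  measurable_fun setT f -> (\int[normal_prob 0 s]_x `|f x| < +oo)%E ->
  (\int[normal_prob 0 s]_x f x = \int[mu]_x (f x * (normal_pdf 0 s x)%:E))%E.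
Proof.
move=> s0 mf finf.
have dom := @normal_prob_dominates R 0 s.
rewrite -(Radon_Nikodym_change_of_variables dom)//=; last first.
  by apply/integrableP; split.
have mp : measurable_fun setT (fun x : R => (normal_pdf 0 s x)%:E).
  by apply/measurable_EFinP; exact: (@measurable_normal_pdf R 0 s).
apply: ae_eq_integral => //.
- by apply: emeasurable_funM => //; exact: (measurable_int mu).
- exact: emeasurable_funM.
- apply: ae_eqe_mul2l => /=.
  rewrite Radon_NikodymE//=.
  case: cid => /= h [h1 h2 h3].
  apply: integral_ae_eq => //=.
  by move=> E E01 mE; rewrite -h3.
Qed.

Lemma normal_law_integral s X (f : R -> R) : 0 < s ->
  measurable_fun setT X -> normal_law s X ->
  measurable_fun setT f -> (forall x, 0 <= f x) ->
  itg P (fun w => f (X w)) ->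
  (\int[P]_w (f (X w))%:E = \int[mu]_x (f x * heat_kernel 1 (s ^+ 2) x)%:E)%E.
Proof.
move=> s0 mX nX mf f0 fi.
have mfE : measurable_fun setT (EFin \o f) by exact/measurable_EFinP.
have e : (\int[P]_w (f (X w))%:E = \int[normal_prob 0 s]_x (f x)%:E)%E.
  transitivity (\int[pushforward P (X : T -> measurableTypeR R)]_x (f x)%:E)%E.
    by rewrite ge0_integral_pushforward// => x _; rewrite lee_fin.
  by apply: eq_measure_integral => A mA _; exact: nX.
rewrite e (@integral_normal_prob s (EFin \o f))//.
  apply: eq_integral => x _; rewrite -EFinM heat_kernel_normal ?exprn_gt0//.
  by rewrite mul1r sqrtr_sqr gtr0_norm.
under eq_integral do rewrite /= ger0_norm//.
by rewrite -e itgE// ltry.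
Qed.

(** The variance of the standard normal law, kept as an extended number. That it is finite and
    nonzero is deduced, where needed, from a square integrable variable that is not almost surely
    0. *)
Definition gauss_variance : \bar R := (\int[mu]_x (x ^+ 2 * heat_kernel 1 1 x)%:E)%E.

Lemma normal_law_sqr s X : 0 < s -> measurable_fun setT X -> normal_law s X ->
  itg P (fun w => X w ^+ 2) ->
  (\int[P]_w (X w ^+ 2)%:E = (s ^+ 2)%:E * gauss_variance)%E.
Proof.
move=> s0 mX nX Xi.
rewrite (@normal_law_integral s X (fun x => x ^+ 2))//; last first.
  by move=> x; exact: sqr_ge0.
have mh t : measurable_fun setT (fun x : R => (x ^+ 2 * heat_kernel 1 t x)%:E).
  apply/measurable_EFinP; apply: measurable_funM => //.
  exact: measurable_heat_kernel_comp.
have h0 (t x : R) : (0 <= (x ^+ 2 * heat_kernel 1 t x)%:E)%E.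
  by rewrite lee_fin mulr_ge0 ?sqr_ge0 ?heat_kernel_ge0.
rewrite -(ge0_integral_scale s0 (mh _) (h0 _)) /gauss_variance.
rewrite -(ge0_integralZl mu measurableT (mh 1)); last 2 first.
- by move=> x _; exact: h0.
- by rewrite lee_fin sqr_ge0.
rewrite -(@ge0_integralZl _ _ _ mu setT measurableT (fun x : R =>
  ((s * x) ^+ 2 * heat_kernel 1 (s ^+ 2) (s * x))%:E)); last 3 first.
- by apply: (measurableT_comp (mh _)); exact: measurable_funM.
- by move=> x _; exact: h0.
- by rewrite lee_fin ltW.
apply: eq_integral => x _; rewrite -!EFinM; congr EFin.
rewrite !heat_kernelE ?exprn_gt0//.
have -> : 2 * pi * 1 * s ^+ 2 = s ^+ 2 * (2 * pi * 1 * 1) by ring.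
rewrite (sqrtrM _ (sqr_ge0 s)) sqrtr_sqr gtr0_norm// invfM exprMn.
have -> : - (s ^+ 2 * x ^+ 2) / (2 * 1 * s ^+ 2) = - x ^+ 2 / (2 * 1 * 1).
  by field; rewrite gt_eqF.
set h := (Num.sqrt _)^-1; set E := expR _.
by field; rewrite gt_eqF.
Qed.

Lemma sqr_mean0 X : measurable_fun setT X ->
  (\int[P]_w (X w ^+ 2)%:E = 0)%E -> {ae P, forall w, X w = 0}.
Proof.
move=> mX X0.
have mX2 : measurable_fun setT (fun w => (X w ^+ 2)%:E).
  by apply/measurable_EFinP; exact: measurable_funX.
have [] := ae_eq_integral_abs P measurableT mX2.
under eq_integral do rewrite /= ger0_norm ?sqr_ge0//.
move=> /(_ X0) + _; apply: filterS => w /(_ I) /= [] /eqP.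
by rewrite sqrf_eq0 => /eqP.
Qed.

Lemma normal_law_neq0 s X : 0 < s -> measurable_fun setT X -> normal_law s X ->
  ~ {ae P, forall w, X w = 0}.
Proof.
move=> s0 mX nX X0.
have : normal_prob 0 s [set 0] = 0%E.
  have /null_content_dominatesP := @normal_prob_dominates R 0 s.
  by apply => //; exact: lebesgue_measure_set1.
rewrite -nX// => PX.
have mE : measurable (X @^-1` [set 0]) by rewrite -[X in measurable X]setTI; exact: mX.
have := probability_setC P mE; rewrite PX sube0.
have [N [mN PN NX]] := X0.
have -> : P (~` (X @^-1` [set 0])) = 0%E.
  by apply: (subset_measure0 _ mN _ PN) => //; exact: measurableC.
by move=> /esym/eqP; rewrite onee_eq0.
Qed.

Lemma ae0_normal_sqr X : measurable_fun setT X -> {ae P, forall w, X w = 0} ->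
  (\int[P]_w (X w ^+ 2)%:E = 0)%E.
Proof.
move=> mX X0; rewrite (@ae_eq_integral _ _ _ P setT (cst 0%E))//=.
- by rewrite integral0.
- by apply/measurable_EFinP; exact: measurable_funX.
- by apply: filterS X0 => w + _ /=; move=> ->; rewrite expr0n.
Qed.

(** A vanishing second moment characterizes the degenerate case. Otherwise the two scales satisfy
    s^2 v = r^2 v, with v the variance of the standard law, and v can be cancelled. *)
Lemma centered_gaussian_law X Y : measurable_fun setT X -> measurable_fun setT Y ->
  itg P (fun w => X w ^+ 2) -> itg P (fun w => Y w ^+ 2) ->
  centered_gaussian P X -> centered_gaussian P Y ->
  \int[P]_w (X w ^+ 2) = \int[P]_w (Y w ^+ 2) ->
  forall B : set R, measurable B -> P (X @^-1` B) = P (Y @^-1` B).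
Proof.
move=> mX mY Xi Yi gX gY XY B mB.
have E : (\int[P]_w (X w ^+ 2)%:E = \int[P]_w (Y w ^+ 2)%:E)%E.
  by rewrite (itgE Xi) (itgE Yi) XY.
have both0 : {ae P, forall w, X w = 0} -> {ae P, forall w, Y w = 0} ->
    P (X @^-1` B) = P (Y @^-1` B).
  suff h Z : measurable_fun setT Z -> {ae P, forall w, Z w = 0} ->
      P (Z @^-1` B) = (\int[P]_w (\1_B (0 : R))%:E)%E by move=> X0 Y0; rewrite !h.
  move=> mZ Z0.
  have mZB : measurable (Z @^-1` B) by rewrite -[X in measurable X]setTI; exact: mZ.
  rewrite -[Z @^-1` B]setIT -integral_indic//.
  apply: ae_eq_integral => //.
  - exact/measurable_EFinP/measurable_indic.
  - by apply: filterS Z0 => w + _ /=; rewrite !indicE => <-.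
case: gX => [X0|[s s0 nX]]; case: gY => [Y0|[r r0 nY]].
- exact: both0.
- apply: both0 => //; apply: sqr_mean0 => //.
  by rewrite -E ae0_normal_sqr.
- apply: both0 => //; apply: sqr_mean0 => //.
  by rewrite E ae0_normal_sqr.
- suff -> : P (X @^-1` B) = normal_prob 0 r B by rewrite nY.
  rewrite (nX _ mB); suff -> : s = r by [].
  have e1 := normal_law_sqr s0 mX nX Xi; have e2 := normal_law_sqr r0 mY nY Yi.
  have : (\int[P]_w (X w ^+ 2)%:E <> 0)%E.
    by move=> /(sqr_mean0 mX); exact: normal_law_neq0 nX.
  move: e1 e2; rewrite -E (itgE Xi); case: gauss_variance => [v| |].
  + rewrite -!EFinM => -[->] [] e2 n0; apply/eqP.
    rewrite -(eqrXn2 (n := 2))// ?ltW//; apply/eqP.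
    by apply: (@mulIf _ v) => //; apply/eqP => v0; apply: n0; rewrite v0 mulr0.
  + by rewrite mulry gtr0_sg ?exprn_gt0// mul1e.
  + by rewrite mulrNy gtr0_sg ?exprn_gt0// mul1e.
Qed.

Lemma normal_law_cos s X : 0 < s -> measurable_fun setT X -> normal_law s X ->
  \int[P]_w cos (X w) = cosine_transform (s ^+ 2).
Proof.
move=> s0 mX nX.
have mcos : measurable_fun setT (@cos R).
  by apply: continuous_measurable_fun; exact: continuous_cos.
have i1 : itg P (fun=> 1).
  by apply: itg_lty => //; rewrite integral_cst//= mul1e probability_setT ltry.
have ic : itg P (fun w => cos (X w)).
  apply: (itg_le _ _ i1); first exact: measurableT_comp.
  by move=> w; exact: cos_max.
have i2 : itg P (fun w => 1 + cos (X w)) by exact: itgD.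
have := @normal_law_integral s X (fun x => 1 + cos x) s0 mX nX _ _ i2.
rewrite (itgE i2) RintD//.
have := @integral_cos_shift R (s ^+ 2) 0 (exprn_gt0 _ s0).
under eq_integral do rewrite addr0; rewrite cos0 mul1r => ->.
rewrite /Rintegral integral_cst//= mul1e probability_setT/=.
move=> h; apply: (@addrI _ 1); apply: EFin_inj; apply: h.
- exact: measurable_funD.
- by move=> x; have := cos_geN1 x; lra.
Qed.

(** Only the three variances matter, through [cosine_transformD]: Z need not be X + Y. For
    uncorrelated jointly Gaussian variables this stands in for independence. *)
Lemma centered_gaussian_cosM X Y Z : measurable_fun setT X ->
  measurable_fun setT Y -> measurable_fun setT Z ->
  itg P (fun w => X w ^+ 2) -> itg P (fun w => Y w ^+ 2) ->
  itg P (fun w => Z w ^+ 2) ->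
  centered_gaussian P X -> centered_gaussian P Y -> centered_gaussian P Z ->
  \int[P]_w (Z w ^+ 2) = \int[P]_w (X w ^+ 2) + \int[P]_w (Y w ^+ 2) ->
  \int[P]_w cos (Z w) = \int[P]_w cos (X w) * \int[P]_w cos (Y w).
Proof.
move=> mX mY mZ Xi Yi Zi gX gY gZ ZXY.
have mcos : measurable_fun setT (@cos R).
  by apply: continuous_measurable_fun; exact: continuous_cos.
have i1 : itg P (fun=> 1).
  by apply: itg_lty => //; rewrite integral_cst//= mul1e probability_setT ltry.
have R1 : \int[P]_w (1 : R) = 1.
  by rewrite /Rintegral integral_cst//= mul1e probability_setT.
have ic (U : T -> R) : measurable_fun setT U -> itg P (fun w => cos (U w)).
  move=> mU; apply: (itg_le _ _ i1); first exact: measurableT_comp.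
  by move=> w; exact: cos_max.
have ec (U U' : T -> R) : measurable_fun setT U -> measurable_fun setT U' ->
    itg P (fun w => U w ^+ 2) -> itg P (fun w => U' w ^+ 2) ->
    centered_gaussian P U -> centered_gaussian P U' ->
    \int[P]_w (U w ^+ 2) = \int[P]_w (U' w ^+ 2) ->
    \int[P]_w cos (U w) = \int[P]_w cos (U' w).
  move=> mU mU' Ui Ui' gU gU' UU'.
  have := @same_law_integral U U' (fun x => (1 + cos x)%:E) mU mU'
    (centered_gaussian_law mU mU' Ui Ui' gU gU' UU') _ _.
  rewrite (itgE (itgD i1 (ic _ mU))) (itgE (itgD i1 (ic _ mU'))).
  rewrite !RintD//; [|exact: ic..] => h; apply: (@addrI _ (\int[P]_w (1 : R))); apply: EFin_inj; apply: h.
  - by apply/measurable_EFinP; exact: measurable_funD.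
  - by move=> x; rewrite lee_fin; have := cos_geN1 x; lra.
have c0 (U : T -> R) : measurable_fun setT U -> {ae P, forall w, U w = 0} ->
    \int[P]_w cos (U w) = 1 /\ \int[P]_w (U w ^+ 2) = 0.
  move=> mU U0; split; last by rewrite /Rintegral ae0_normal_sqr.
  rewrite -R1 /Rintegral; congr fine; apply: ae_eq_integral => //.
  - by apply/measurable_EFinP; exact: measurableT_comp.
  - by apply: filterS U0 => w + _ /=; move=> ->; rewrite cos0.
case: (gX) => [X0|[s s0 nX]].
  have [-> e] := c0 _ mX X0.
  by rewrite mul1r; apply: ec => //; rewrite ZXY e add0r.
case: (gY) => [Y0|[r r0 nY]].
  have [-> e] := c0 _ mY Y0.
  by rewrite mulr1; apply: ec => //; rewrite ZXY e addr0.
have e1 := normal_law_sqr s0 mX nX Xi; have e2 := normal_law_sqr r0 mY nY Yi.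
have X0 : \int[P]_w (X w ^+ 2) <> 0.
  move=> h; apply: (normal_law_neq0 s0 mX nX); apply: sqr_mean0 => //.
  by rewrite (itgE Xi) h.
have Y1 : 0 <= \int[P]_w (Y w ^+ 2) by apply: Rintegral_ge0 => w _; exact: sqr_ge0.
have X1 : 0 <= \int[P]_w (X w ^+ 2) by apply: Rintegral_ge0 => w _; exact: sqr_ge0.
case: (gZ) => [Z0|[q q0 nZ]].
  have [_ e] := c0 _ mZ Z0.
  by exfalso; apply: X0; move: ZXY; rewrite e; lra.
have e3 := normal_law_sqr q0 mZ nZ Zi.
rewrite (normal_law_cos s0 mX nX) (normal_law_cos r0 mY nY) (normal_law_cos q0 mZ nZ).
rewrite -(cosine_transformD (exprn_gt0 2 s0) (exprn_gt0 2 r0)); congr cosine_transform.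
move: e1 e2 e3; rewrite (itgE Xi) (itgE Yi) (itgE Zi) ZXY.
case: gauss_variance => [v| |].
+ rewrite -!EFinM => -[e1] [e2] [e3].
  apply: (@mulIf _ v); first by apply/eqP => v0; apply: X0; rewrite e1 v0 mulr0.
  by rewrite -e3 mulrDl e1 e2.
+ by rewrite mulry gtr0_sg ?exprn_gt0// mul1e.
+ by rewrite mulrNy gtr0_sg ?exprn_gt0// mul1e.
Qed.

End GaussianLaw.

Section SquareIntegrable.
Context d (T : measurableType d) (R : realType) (P : probability T R).
Implicit Types (X Y V : T -> R).

Lemma itg_cst (k : R) : itg P (fun=> k).
Proof.
apply: (itg_le _ _ (g := fun=> `|k|)) => //.
apply: itg_lty => //; rewrite integral_cst//= probability_setT mule1 ltry//.
Qed.

Lemma Rint_cst (k : R) : \int[P]_w k = k.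
Proof. by rewrite /Rintegral integral_cst//= probability_setT mule1. Qed.

Definition square_itg X := measurable_fun setT X /\ itg P (fun w => X w ^+ 2).

Lemma square_itgM X Y : square_itg X -> square_itg Y -> itg P (fun w => X w * Y w).
Proof.
move=> [mX Xi] [mY Yi]; apply: (itg_le _ _ (itgD Xi Yi)).
  exact: measurable_funM.
move=> w; rewrite ler_norml; have := sqr_ge0 (X w + Y w).
have := sqr_ge0 (X w - Y w); rewrite sqrrB sqrrD => h1 h2.
have := sqr_ge0 (X w); have := sqr_ge0 (Y w) => h3 h4.
by apply/andP; split; lra.
Qed.

Lemma square_itg_itg X : square_itg X -> itg P X.
Proof.
move=> [mX Xi]; apply: (itg_le _ _ (itgD (itg_cst 1) Xi)) => // w.
rewrite ler_norml; have := sqr_ge0 (X w + 1); have := sqr_ge0 (X w - 1).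
rewrite sqrrB sqrrD => h1 h2; have := sqr_ge0 (X w) => h3.
by apply/andP; split; lra.
Qed.

Lemma square_itgD X Y : square_itg X -> square_itg Y ->
  square_itg (fun w => X w + Y w).
Proof.
move=> hX hY; have XY := square_itgM hX hY; case: hX hY => [mX Xi] [mY Yi].
split; first exact: measurable_funD.
rewrite (_ : (fun w => _) = fun w => X w ^+ 2 + (2 * (X w * Y w) + Y w ^+ 2)).
  by apply: itgD => //; apply: itgD => //; exact: itgZ.
by apply/funext => w; ring.
Qed.

Lemma square_itgZ k X : square_itg X -> square_itg (fun w => k * X w).
Proof.
move=> [mX Xi]; split; first exact: measurable_funM.
rewrite (_ : (fun w => _) = fun w => k ^+ 2 * X w ^+ 2); first exact: itgZ.
by apply/funext => w; rewrite exprMn.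
Qed.

End SquareIntegrable.

(** * Uncorrelated jointly Gaussian pairs *)

Section GaussianPair.
Context d (T : measurableType d) (R : realType) (P : probability T R).
Variables V X : T -> R.
Hypotheses (iV : square_itg P V) (iX : square_itg P X)
  (VX : \int[P]_w (V w * X w) = 0)
  (gVX : forall a b : R, centered_gaussian P (fun w => a * V w + b * X w)).
Implicit Types a b t : R.

Let mcos t : measurable_fun setT (fun x : R => cos (x + t)).
Proof.
apply: measurableT_comp; first by apply: continuous_measurable_fun; exact: continuous_cos.
exact: measurable_funD.
Qed.

Let Z a b w := a * V w + b * X w.

Let iZ a b : square_itg P (Z a b).
Proof. by apply: square_itgD; exact: square_itgZ. Qed.

Let ic (U : T -> R) t : measurable_fun setT U -> itg P (fun w => cos (U w + t)).
Proof.
move=> mU; apply: (itg_le _ _ (itg_cst P 1)); first exact: (measurableT_comp (mcos t)).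
by move=> w; exact: cos_max.
Qed.

Let EZ a b : \int[P]_w (Z a b w ^+ 2) =
  a ^+ 2 * \int[P]_w (V w ^+ 2) + b ^+ 2 * \int[P]_w (X w ^+ 2).
Proof.
have i1 := iV.2; have i2 := iX.2; have i3 := square_itgM iV iX.
transitivity (\int[P]_w (a ^+ 2 * V w ^+ 2 + (2 * a * b * (V w * X w) + b ^+ 2 * X w ^+ 2))).
  by apply: eq_Rintegral => w _; rewrite /Z; ring.
rewrite RintD; [|exact: itgZ|by apply: itgD; exact: itgZ].
rewrite RintD; [|exact: itgZ|exact: itgZ].
by rewrite !RintZ// VX mulr0 add0r.
Qed.

Let law a b a' b' t : \int[P]_w (Z a b w ^+ 2) = \int[P]_w (Z a' b' w ^+ 2) ->
  \int[P]_w cos (Z a b w + t) = \int[P]_w cos (Z a' b' w + t).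
Proof.
move=> e; have [mU Ui] := iZ a b; have [mU' Ui'] := iZ a' b'.
have := same_law_integral (f := fun x => (1 + cos (x + t))%:E) mU mU'
  (centered_gaussian_law mU mU' Ui Ui' (gVX _ _) (gVX _ _) e).
rewrite (itgE (itgD (itg_cst P 1) (ic t mU))) (itgE (itgD (itg_cst P 1) (ic t mU'))).
rewrite (RintD (itg_cst P 1) (ic t mU)) (RintD (itg_cst P 1) (ic t mU')).
move=> h; apply: (@addrI _ (\int[P]_w (1 : R))); apply: EFin_inj; apply: h.
- by apply/measurable_EFinP; exact: measurable_funD.
- by move=> x; rewrite lee_fin; have := cos_geN1 (x + t); lra.
Qed.

Let cos_t a b t : \int[P]_w cos (Z a b w + t) = cos t * \int[P]_w cos (Z a b w).
Proof.
have [mU Ui] := iZ a b; have mU' := (iZ (- a) (- b)).1.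
have i0 : itg P (fun w => cos (Z a b w)).
  by have := ic 0 mU; under eq_fun do rewrite addr0.
have e : \int[P]_w cos (Z a b w + t) = \int[P]_w cos (Z (- a) (- b) w + t).
  by apply: law; rewrite !EZ !sqrrN.
have h : \int[P]_w cos (Z a b w + t) + \int[P]_w cos (Z (- a) (- b) w + t) =
    2 * cos t * \int[P]_w cos (Z a b w).
  rewrite -(RintD (ic t mU) (ic t mU')) -RintZ//.
  apply: eq_Rintegral => w _.
  have -> : Z (- a) (- b) w + t = - (Z a b w - t) by rewrite /Z; ring.
  by rewrite cosN cosD cosB; ring.
move: h; rewrite -e.
by move: (Rintegral _ _ _) (Rintegral _ _ _) (cos t) => x y z h; lra.
Qed.

(** V + k X and V - k X have the same variance, hence the same law, so that cos(V + t) is orthogonal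
    to sin(k X). Taking k = 1/n and multiplying by n, the sines tend to X. *)
Lemma cos_sinM t : \int[P]_w (cos (V w + t) * X w) = 0.
Proof.
have mV := iV.1; have mX := iX.1.
have h n : \int[P]_w (cos (V w + t) * (n.+1%:R * sin (n.+1%:R^-1 * X w))) = 0.
  pose k : R := n.+1%:R^-1.
  have m1 := (iZ 1 k).1; have m2 := (iZ 1 (- k)).1.
  have e : \int[P]_w cos (Z 1 (- k) w + (t - pi / 2)) =
           \int[P]_w cos (Z 1 k w + (t - pi / 2)).
    by apply: law; rewrite !EZ !sqrrN.
  transitivity (\int[P]_w (n.+1%:R / 2 * (cos (Z 1 k w + (t - pi / 2)) -
       cos (Z 1 (- k) w + (t - pi / 2))))).
    apply: eq_Rintegral => w _.
    have -> : Z 1 k w + (t - pi / 2) = (V w + t) + (k * X w - pi / 2).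
      by rewrite /Z; ring.
    have -> : Z 1 (- k) w + (t - pi / 2) = (V w + t) - (k * X w + pi / 2).
      by rewrite /Z; ring.
    rewrite (cosD (V w + t)) (cosB (V w + t)) cosBpihalf cosDpihalf sinBpihalf sinDpihalf.
    by rewrite -/k; field.
  rewrite RintZ; last by apply: itgB; exact: ic.
  rewrite RintB; [|exact: ic..].
  by rewrite e subrr mulr0.
have mc : measurable_fun setT (fun w => cos (V w + t)) by exact: (measurableT_comp (mcos t)).
have msin : measurable_fun setT (@sin R).
  by apply: continuous_measurable_fun; exact: continuous_sin.
have [_ cv] : itg P (fun w => cos (V w + t) * X w) /\
    (fun n => \int[P]_w (cos (V w + t) * (n.+1%:R * sin (n.+1%:R^-1 * X w)))) @ \oo -->
    \int[P]_w (cos (V w + t) * X w).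
  apply: (@Rint_dominated _ _ _ P _ _ (fun w => `|X w|)).
  - move=> n; apply: measurable_funM => //; apply: measurable_funM => //.
    by apply: measurableT_comp => //; exact: measurable_funM.
  - exact: measurable_funM.
  - by move=> w; apply: cvgM; [exact: cvg_cst|exact: cvg_mulr_sinV].
  - exact: (integrable_norm (square_itg_itg iX)).
  - move=> n w; rewrite normrM -[leRHS]mul1r ler_pM// ?cos_max//.
    rewrite normrM ger0_norm// mulrC -ler_pdivlMr//.
    rewrite (le_trans (normr_sin_le _))// normrM [leRHS]mulrC ler_wpM2r//.
    by rewrite ger0_norm// invr_ge0.
rewrite -(cvg_lim _ cv)//; apply: lim_near_cst => //.
exact: nearW.
Qed.

(** X^2 is the dominated limit of (n sin(X / n))^2 = n^2 / 2 (1 - cos(2 X / n)), and the mean of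
    cos(V + t) cos(k X) factors: the product is half the sum of cosines of V + k X and V - k X,
    whose variances add up. *)
Lemma cos_sqrM t : \int[P]_w (cos (V w + t) * (X w ^+ 2 - \int[P]_w' (X w' ^+ 2))) = 0.
Proof.
have [mV iV2] := iV; have [mX iX2] := iX.
have mc : measurable_fun setT (fun w => cos (V w + t)) by exact: (measurableT_comp (mcos t)).
have msin : measurable_fun setT (@sin R).
  by apply: continuous_measurable_fun; exact: continuous_sin.
have icX (k : R) : itg P (fun w => cos (k * X w)).
  have := @ic (fun w => k * X w) 0 (measurable_funM (measurable_cst k) mX).
  by under eq_fun do rewrite addr0.
have cc (k : R) : \int[P]_w (cos (V w + t) * cos (k * X w)) =
    \int[P]_w cos (V w + t) * \int[P]_w cos (k * X w).
  have m1 := (iZ 1 k).1; have m2 := (iZ 1 (- k)).1.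
  have z10 : Z 1 0 = V by apply/funext => w; rewrite /Z; ring.
  have z01 : Z 0 k = fun w => k * X w by apply/funext => w; rewrite /Z; ring.
  have eM l : l ^+ 2 = k ^+ 2 -> \int[P]_w cos (Z 1 l w) = \int[P]_w cos (V w) * \int[P]_w cos (k * X w).
    move=> lk; transitivity (\int[P]_w cos (Z 1 0 w) * \int[P]_w cos (Z 0 k w)).
      apply: centered_gaussian_cosM.
      - exact: (iZ 1 0).1.
      - exact: (iZ 0 k).1.
      - exact: (iZ 1 l).1.
      - exact: (iZ 1 0).2.
      - exact: (iZ 0 k).2.
      - exact: (iZ 1 l).2.
      - exact: gVX.
      - exact: gVX.
      - exact: gVX.
      - by rewrite !EZ lk; ring.
    by rewrite z10 z01.
  have eV : \int[P]_w cos (V w + t) = cos t * \int[P]_w cos (V w).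
    by rewrite -z10 cos_t.
  transitivity (\int[P]_w (2^-1 * (cos (Z 1 k w + t) + cos (Z 1 (- k) w + t)))).
    apply: eq_Rintegral => w _.
    have -> : Z 1 k w + t = (V w + t) + k * X w by rewrite /Z; ring.
    have -> : Z 1 (- k) w + t = (V w + t) - k * X w by rewrite /Z; ring.
    by rewrite (cosD (V w + t)) (cosB (V w + t)); field.
  rewrite RintZ; last by apply: itgD; exact: ic.
  rewrite RintD; [|exact: ic..].
  by rewrite !cos_t !eM ?sqrrN// eV; field.
pose S n w := (n.+1%:R * sin (n.+1%:R^-1 * X w)) ^+ 2.
have S0 n w : 0 <= S n w by exact: sqr_ge0.
have SX n w : S n w <= X w ^+ 2.
  rewrite /S -(real_normK (num_real (X w))) -(real_normK (num_real (_ * sin _))).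
  rewrite lerXn2r ?nnegrE// normrM ger0_norm// mulrC -ler_pdivlMr//.
  rewrite (le_trans (normr_sin_le _))// normrM [leRHS]mulrC ler_wpM2r//.
  by rewrite ger0_norm// invr_ge0.
have mS n : measurable_fun setT (S n).
  apply: measurable_funX; apply: measurable_funM => //.
  by apply: measurableT_comp => //; exact: measurable_funM.
have Sc w : S ^~ w @ \oo --> X w ^+ 2.
  rewrite /S; under eq_fun do rewrite expr2.
  by rewrite expr2; apply: cvgM; exact: cvg_mulr_sinV.
have iS n : itg P (S n).
  by apply: (itg_le _ _ iX2) => // w; rewrite ger0_norm.
have SE n : (fun w => S n w) = fun w => n.+1%:R ^+ 2 / 2 * (1 - cos (2 * n.+1%:R^-1 * X w)).
  apply/funext => w; rewrite /S exprMn.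
  have -> : 2 / n.+1%:R * X w = (n.+1%:R^-1 * X w) *+ 2 by rewrite mulr2n; ring.
  rewrite cos_mulr2n cos2sin2 mulr2n.
  by set si := sin _; field.
have eS n : \int[P]_w (cos (V w + t) * S n w) = \int[P]_w cos (V w + t) * \int[P]_w S n w.
  have e : \int[P]_w S n w = n.+1%:R ^+ 2 / 2 * (1 - \int[P]_w cos (2 * n.+1%:R^-1 * X w)).
    rewrite SE RintZ; last by apply: itgB; [exact: itg_cst|exact: icX].
    by rewrite RintB ?Rint_cst//; exact: itg_cst.
  rewrite e.
  transitivity (\int[P]_w (n.+1%:R ^+ 2 / 2 * (cos (V w + t) - cos (V w + t) * cos (2 * n.+1%:R^-1 * X w)))).
    by apply: eq_Rintegral => w _; rewrite [S n w](congr1 (fun f => f w) (SE n)); ring.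
  have i2 : itg P (fun w => cos (V w + t) * cos (2 * n.+1%:R^-1 * X w)).
    by apply: (itg_mule mc _ (icX _)) => w; exact: cos_max.
  rewrite RintZ; last by apply: itgB => //; exact: ic.
  by rewrite RintB//; [rewrite cc; ring|exact: ic].
have [iL cL] : itg P (fun w => cos (V w + t) * X w ^+ 2) /\
    (fun n => \int[P]_w (cos (V w + t) * S n w)) @ \oo -->
    \int[P]_w (cos (V w + t) * X w ^+ 2).
  apply: (@Rint_dominated _ _ _ P _ _ (fun w => X w ^+ 2)).
  - by move=> n; exact: measurable_funM.
  - by apply: measurable_funM => //; exact: measurable_funX.
  - by move=> w; apply: cvgM; [exact: cvg_cst|exact: Sc].
  - exact: iX2.
  - move=> n w; rewrite normrM -[leRHS]mul1r ler_pM// ?cos_max//.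
    by rewrite ger0_norm.
have [_ cR] : itg P (fun w => X w ^+ 2) /\
    (fun n => \int[P]_w S n w) @ \oo --> \int[P]_w (X w ^+ 2).
  apply: (@Rint_dominated _ _ _ P _ _ (fun w => X w ^+ 2)) => //.
  - exact: measurable_funX.
  - by move=> n w; rewrite ger0_norm.
have cR' : (fun n => \int[P]_w (cos (V w + t) * S n w)) @ \oo -->
    \int[P]_w cos (V w + t) * \int[P]_w (X w ^+ 2).
  by under eq_fun do rewrite eS; apply: cvgM => //; exact: cvg_cst.
have e : \int[P]_w (cos (V w + t) * X w ^+ 2) =
    \int[P]_w cos (V w + t) * \int[P]_w (X w ^+ 2).
  by rewrite -(cvg_lim _ cL)// -(cvg_lim _ cR').
transitivity (\int[P]_w (cos (V w + t) * X w ^+ 2 - \int[P]_w' (X w' ^+ 2) * cos (V w + t))).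
  by apply: eq_Rintegral => w _; ring.
rewrite RintB//; last by apply: itgZ; exact: ic.
rewrite RintZ; last exact: ic.
by rewrite e [X in X - _]mulrC subrr.
Qed.

End GaussianPair.

(** * Past and future of the white noise *)

Section WhiteNoise.
Context d (T : measurableType d) (R : realType) (P : probability T R).
Hypothesis (hP : measure_is_complete P).
Variables (W : set (R * R) -> {RV P >-> R}) (hW : space_time_white_noise W).
Implicit Types (A B : set (R * R)) (Q : set (set (R * R))) (f g : T -> R).

Definition noise_span Q f := exists (n : nat) (A : 'I_n -> set (R * R))
  (c : 'I_n -> R), (forall i, Q (A i)) /\ f = fun w => \sum_(i < n) c i * W (A i) w.

Lemma noise_spanD Q f g : noise_span Q f -> noise_span Q g ->
  noise_span Q (fun w => f w + g w).
Proof.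
move=> [m [A [a [QA ->]]]] [n [B [b [QB ->]]]].
exists (m + n)%N, (fun i => match fintype.split i with inl j => A j | inr j => B j end),
  (fun i => match fintype.split i with inl j => a j | inr j => b j end).
split; first by move=> i; case: fintype.split.
apply/funext => w; rewrite big_split_ord/=.
congr (_ + _); apply: eq_bigr => i _.
- by rewrite (unsplitK (inl i)).
- by rewrite (unsplitK (inr i)).
Qed.

Lemma noise_spanZ Q k f : noise_span Q f -> noise_span Q (fun w => k * f w).
Proof.
move=> [m [A [a [QA ->]]]]; exists m, A, (fun i => k * a i); split => //.
by apply/funext => w; rewrite mulr_sumr; apply: eq_bigr => i _; rewrite mulrA.
Qed.

Lemma noise_span0 Q : noise_span Q (cst 0).
Proof.
exists 0%N, (fun=> set0), (fun=> 0); split; first by case.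
by apply/funext => w; rewrite big_ord0.
Qed.

Lemma noise_span1 Q A : Q A -> noise_span Q (W A).
Proof.
move=> QA; exists 1%N, (fun=> A), (fun=> 1); split => //.
by apply/funext => w; rewrite big_ord1 mul1r.
Qed.

Lemma noise_spanS Q Q' f : (forall A, Q A -> Q' A) ->
  noise_span Q f -> noise_span Q' f.
Proof.
by move=> QQ [m [A [a [QA ->]]]]; exists m, A, a; split => // i; exact: QQ.
Qed.

Lemma noise_square_itg A : finite_borel A -> square_itg P (W A).
Proof.
move=> fA; split; first exact: measurable_funP.
apply: itg_lty; first by apply: measurable_funX; exact: measurable_funP.
  by move=> w; exact: sqr_ge0.
suff -> : (\int[P]_w (W A w ^+ 2)%:E = leb2 A)%E by case: fA.
by have := hW.2 A A fA fA; rewrite setIid unlock.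
Qed.

Lemma noise_covariance A B : finite_borel A -> finite_borel B ->
  (\int[P]_w (W A w * W B w))%:E = leb2 (A `&` B).
Proof.
move=> fA fB; rewrite -hW.2// unlock itgE//.
by apply: square_itgM; exact: noise_square_itg.
Qed.

Lemma noise_span_square_itg f : noise_span (@finite_borel R) f -> square_itg P f.
Proof.
move=> [n [A [a [fA ->]]]]; elim: n A a fA => [|n IH] A a fA.
  rewrite (_ : (fun w => _) = cst 0); last by apply/funext => w; rewrite big_ord0.
  split; first exact: measurable_cst.
  by rewrite (_ : (fun w => _) = cst 0); [exact: itg_cst|apply/funext => w; rewrite expr0n].
under eq_fun do rewrite big_ord_recr/=.
apply: square_itgD; first exact: (IH (fun i => A (widen_ord (leqnSn n) i))
  (fun i => a (widen_ord (leqnSn n) i))).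
by apply: square_itgZ; exact: noise_square_itg.
Qed.

Lemma noise_span_gaussian f : noise_span (@finite_borel R) f -> centered_gaussian P f.
Proof. by move=> [n [A [a [fA ->]]]]; exact: hW.1. Qed.

Lemma noise_span_orthogonal Q Q' f g :
  (forall A, Q A -> finite_borel A) -> (forall A, Q' A -> finite_borel A) ->
  (forall A B, Q A -> Q' B -> leb2 (A `&` B) = 0%E) ->
  noise_span Q f -> noise_span Q' g -> \int[P]_w (f w * g w) = 0.
Proof.
move=> Qb Qb' QQ [m [A [a [QA ->]]]] [n [B [b [QB ->]]]].
have iAB i j : itg P (fun w => a i * W (A i) w * (b j * W (B j) w)).
  by apply: square_itgM; apply: square_itgZ; apply: noise_square_itg; [exact: Qb|exact: Qb'].
transitivity (\int[P]_w \sum_(i < m) \sum_(j < n) (a i * W (A i) w * (b j * W (B j) w))).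
  apply: eq_Rintegral => w _; rewrite mulr_suml; apply: eq_bigr => i _.
  by rewrite mulr_sumr.
rewrite Rint_sum; last by move=> i; exact: itg_sum.
rewrite big1// => i _; rewrite Rint_sum// big1// => j _.
transitivity (\int[P]_w (a i * b j * (W (A i) w * W (B j) w))).
  by apply: eq_Rintegral => w _; ring.
rewrite RintZ; last by apply: square_itgM; apply: noise_square_itg; [exact: Qb|exact: Qb'].
suff -> : \int[P]_w (W (A i) w * W (B j) w) = 0 by rewrite mulr0.
apply: EFin_inj; rewrite noise_covariance; [exact: QQ|exact: Qb|exact: Qb'].
Qed.

(** The time a itself belongs to the past, in accordance with the supports ]a, b] x A of the
    elementary processes. *)
Definition past (a : R) A := finite_borel A /\ A `<=` [set z | z.1 <= a].
Definition future (a : R) A := finite_borel A /\ A `<=` [set z | a < z.1].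

Let past_future f g a : noise_span (past a) f -> noise_span (future a) g ->
  \int[P]_w (f w * g w) = 0.
Proof.
apply: noise_span_orthogonal => [A []|A []|A B [_ Aa] [_ Ba]] //.
rewrite (_ : _ `&` _ = set0) ?measure0//; apply/seteqP; split => // z [/Aa/= h1 /Ba/=].
by rewrite ltNge h1.
Qed.

(** It contains the filtration at time a, but admits every Borel set of finite measure before a, not
    just the rectangles [0, s] x A. Hence pieces cut from the support of an elementary process
    belong to it directly. *)
Definition past_generated (a : R) := generated P (noise_span (past a)).

Let pastS f a : noise_span (past a) f -> noise_span (@finite_borel R) f.
Proof. by apply: noise_spanS => A []. Qed.

Let futureS f a : noise_span (future a) f -> noise_span (@finite_borel R) f.
Proof. by apply: noise_spanS => A []. Qed.

Let past_measurable f a : noise_span (past a) f -> measurable_fun setT f.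
Proof. by move=> /pastS/noise_span_square_itg[]. Qed.

Lemma past_generated_measurable a (Y : T -> R) :
  (forall B : set R, measurable B -> past_generated a (Y @^-1` B)) ->
  measurable_fun setT Y.
Proof.
(* The conclusion does not involve [zeta], so that the zero function serves. *)
apply: (@measurable_generated _ _ _ P (noise_span (past a)) (fun=> 0)) => //.
- by move=> f g; exact: noise_spanD.
- by move=> k f; exact: noise_spanZ.
- by move=> f; exact: past_measurable.
- exact: itg_cst.
Qed.

Let gauss_pair V X a : noise_span (past a) V -> noise_span (future a) X ->
  forall b c : R, centered_gaussian P (fun w => b * V w + c * X w).
Proof.
move=> VP XF b c; apply: noise_span_gaussian; apply: noise_spanD.
- by apply: noise_spanZ; exact: pastS VP.
- by apply: noise_spanZ; exact: futureS XF.
Qed.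

Lemma past_future_mean a (Y X : T -> R) :
  (forall B : set R, measurable B -> past_generated a (Y @^-1` B)) ->
  noise_span (future a) X -> itg P (fun w => Y w * X w) ->
  \int[P]_w (Y w * X w) = 0.
Proof.
move=> hY XF; have iX := noise_span_square_itg (futureS XF).
apply: (@Rint_generated_fun _ _ _ P (noise_span (past a)) X) => //.
- exact: noise_span0.
- by move=> f g; exact: noise_spanD.
- by move=> k f; exact: noise_spanZ.
- by move=> f; exact: past_measurable.
- exact: square_itg_itg.
- move=> f t Vf; apply: cos_sinM => //.
  + exact: noise_span_square_itg (pastS Vf).
  + exact: past_future XF.
  + exact: gauss_pair XF.
Qed.

Lemma past_future_sqr a (Y X : T -> R) :
  (forall B : set R, measurable B -> past_generated a (Y @^-1` B)) ->
  noise_span (future a) X -> itg P Y -> itg P (fun w => Y w * X w ^+ 2) ->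
  \int[P]_w (Y w * X w ^+ 2) = \int[P]_w Y w * \int[P]_w (X w ^+ 2).
Proof.
move=> hY XF iY iYX; have iX := noise_span_square_itg (futureS XF).
set v := \int[P]_w (X w ^+ 2).
have i1 : itg P (fun w => Y w * (X w ^+ 2 - v)).
  rewrite (_ : (fun w => _) = fun w => Y w * X w ^+ 2 - v * Y w).
    by apply: itgB => //; exact: itgZ.
  by apply/funext => w; ring.
have : \int[P]_w (Y w * (X w ^+ 2 - v)) = 0.
  apply: (@Rint_generated_fun _ _ _ P (noise_span (past a)) (fun w => X w ^+ 2 - v)) => //.
  - exact: noise_span0.
  - by move=> f g; exact: noise_spanD.
  - by move=> k f; exact: noise_spanZ.
  - by move=> f; exact: past_measurable.
  - by apply: itgB; [exact: iX.2|exact: itg_cst].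
  - move=> f t Vf; apply: cos_sqrM => //.
    + exact: noise_span_square_itg (pastS Vf).
    + exact: past_future XF.
    + exact: gauss_pair XF.
rewrite (@eq_Rintegral _ _ _ P setT (fun w => Y w * X w ^+ 2 - v * Y w)); last first.
  by move=> w _; ring.
by rewrite RintB//; [rewrite RintZ// mulrC => /subr0_eq|exact: itgZ].
Qed.

(* By polarization, from the squares of [X + X'] and [X - X']. *)
Lemma past_future_mul a (Y X X' : T -> R) :
  (forall B : set R, measurable B -> past_generated a (Y @^-1` B)) ->
  noise_span (future a) X -> noise_span (future a) X' ->
  (exists k : R, forall w, `|Y w| <= k) ->
  \int[P]_w (Y w * (X w * X' w)) = \int[P]_w Y w * \int[P]_w (X w * X' w).
Proof.
move=> hY XF XF' [k Yk]; have mY := past_generated_measurable hY.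
have iY : itg P Y.
  by apply: (itg_le _ _ (itg_cst P k)).
have iq Z : noise_span (future a) Z -> itg P (fun w => Z w ^+ 2).
  by move=> /futureS/noise_span_square_itg[].
have sp := noise_spanD XF XF'; have sm := noise_spanD XF (noise_spanZ (-1) XF').
have ip := itg_mule mY Yk (iq _ sp); have im := itg_mule mY Yk (iq _ sm).
transitivity (\int[P]_w (4^-1 * (Y w * (X w + X' w) ^+ 2 - Y w * (X w + -1 * X' w) ^+ 2))).
  by apply: eq_Rintegral => w _; field.
rewrite RintZ ?RintB//; last exact: itgB.
rewrite !(past_future_sqr hY)// -mulrBr mulrCA -RintB//; [|exact: iq..].
rewrite -RintZ; last by apply: itgB; exact: iq.
by congr (_ * _); apply: eq_Rintegral => w _; field.
Qed.

End WhiteNoise.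

(** * The Ito isometry *)

Section Filtration.
Context d (T : measurableType d) (R : realType) (P : probability T R).
Hypothesis (hP : measure_is_complete P).
Variables (W : set (R * R) -> {RV P >-> R}) (hW : space_time_white_noise W).
Implicit Types (A B : set (R * R)) (Y Z : T -> R) (a : R) (e : elementary W).
Notation mu := (@lebesgue_measure R).

Definition past_fun a Y :=
  forall B : set R, measurable B -> past_generated W a (Y @^-1` B).

Let past_sigma a := g_sigma_algebraType
   ([set E | exists f (B : set R), [/\ noise_span W (past a) f, measurable B & E = f @^-1` B]] `|`
      [set N | P.-negligible N]).

Let past_funE a Y : past_fun a Y <-> measurable_fun [set: past_sigma a] (Y : past_sigma a -> R).
Proof.
split => [h _ B mB|h B mB]; first by rewrite setTI; exact: h.
by have := h measurableT B mB; rewrite setTI.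
Qed.

Lemma past_funM a Y Z : past_fun a Y -> past_fun a Z -> past_fun a (fun w => Y w * Z w).
Proof. by move=> /past_funE mY /past_funE mZ; apply/past_funE; exact: measurable_funM. Qed.

Lemma past_fun_noise a A : past a A -> past_fun a (W A).
Proof.
move=> pA B mB; apply: sub_gen_smallest; left; exists (W A), B; split => //.
exact: noise_span1.
Qed.

Lemma past_fun_le a b Y : a <= b -> past_fun a Y -> past_fun b Y.
Proof.
move=> ab hY B mB; apply: smallest_sub (hY B mB); first exact: smallest_sigma_algebra.
move=> E [[f [C [fP mC ->]]]|NE]; apply: sub_gen_smallest; last by right.
left; exists f, C; split => //; apply: noise_spanS fP => D [fD Da]; split => //.
by move=> z /Da /=; move/le_trans; exact.
Qed.

Lemma leb2X (I A : set R) : measurable I -> measurable A ->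
  leb2 (I `*` A) = (mu I * mu A)%E.
Proof. by move=> mI mA; rewrite /leb2 product_measure1E. Qed.

Lemma filtration_past_fun a Y : filtration_measurable W a Y -> past_fun a Y.
Proof.
move=> hY B mB; apply: smallest_sub (hY B mB); first exact: smallest_sigma_algebra.
move=> E [[s [A [C [/andP[s0 sa] mA Afin mC ->]]]]|NE]; last first.
  by apply: sub_gen_smallest; right.
apply: past_fun_noise => //; split; last by move=> z [/= /[!in_itv]/= /andP[_ /le_trans]]; move=> /(_ _ sa).
split.
- exact: measurableX.
- by move=> z [/=]; rewrite in_itv/= => /andP[].
- rewrite leb2X// lebesgue_measure_itv/=; case: ifP => _; last by rewrite mul0e.
  by rewrite -EFinD lte_mul_pinfty// lee_fin subr0.
Qed.

Lemma past_fun_measurable a Y : past_fun a Y -> measurable_fun setT Y.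
Proof. exact: past_generated_measurable. Qed.

(* The second moment of [W (A `|` B) - W A - W B] vanishes. *)
Lemma noise_additive A B : finite_borel A -> finite_borel B -> A `&` B = set0 ->
  {ae P, forall w, W (A `|` B) w = W A w + W B w}.
Proof.
move=> fA fB AB.
have [[mA A0 Afin] [mB B0 Bfin]] := (fA, fB).
have AUB : leb2 (A `|` B) = (leb2 A + leb2 B)%E.
  by rewrite /leb2 measureU.
have fAB : finite_borel (A `|` B).
  split; [exact: measurableU|by move=> z [/A0|/B0]|].
  by rewrite AUB lte_add_pinfty.
have sq C : finite_borel C -> square_itg P (W C) by exact: noise_square_itg.
have cv C D := @noise_covariance _ _ _ _ W hW C D.
have c1 := cv _ _ fAB fAB; have c2 := cv _ _ fAB fA; have c3 := cv _ _ fAB fB.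
have c4 := cv _ _ fA fA; have c5 := cv _ _ fB fB; have c6 := cv _ _ fA fB.
rewrite setIid in c1; rewrite setIid in c4; rewrite setIid in c5.
rewrite (_ : (A `|` B) `&` A = A) in c2; last by rewrite setIUl setIid setUidl//; apply: subIsetr.
rewrite (_ : (A `|` B) `&` B = B) in c3; last by rewrite setIUl setIid setUidr//; apply: subIsetr.
rewrite AB [RHS]measure0 in c6.
rewrite AUB -c4 -c5 in c1; rewrite -c4 in c2; rewrite -c5 in c3.
move: c1 c2 c3 c6; rewrite -EFinD => -[c1] [c2] [c3] [c6].
have iM C D : finite_borel C -> finite_borel D -> itg P (fun w => W C w * W D w).
  by move=> fC fD; apply: square_itgM; exact: sq.
pose f w := W (A `|` B) w - (W A w + W B w).
have mf : measurable_fun setT f.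
  by apply: measurable_funB => //; exact: measurable_funD.
suff : {ae P, forall w, f w = 0} by apply: filterS => w /subr0_eq.
apply: sqr_mean0 => //.
have e : (fun w => f w ^+ 2) = fun w =>
   (W (A `|` B) w * W (A `|` B) w + (W A w * W A w + W B w * W B w)) +
   (2 * (W A w * W B w) - 2 * (W (A `|` B) w * W A w + W (A `|` B) w * W B w)).
  by apply/funext => w; rewrite /f; ring.
have i1 := iM _ _ fAB fAB; have i2 := iM _ _ fAB fA; have i3 := iM _ _ fAB fB.
have i4 := iM _ _ fA fA; have i5 := iM _ _ fB fB; have i6 := iM _ _ fA fB.
have i7 := itgD i4 i5; have i8 := itgD i1 i7; have i9 := itgZ 2 i6.
have i10 := itgD i2 i3; have i11 := itgZ 2 i10; have i12 := itgB i9 i11.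
have i13 := itgD i8 i12.
have -> : (\int[P]_w (f w ^+ 2)%:E = (\int[P]_w (f w ^+ 2))%:E)%E.
  by rewrite itgE// e.
rewrite e (RintD i8 i12) (RintD i1 i7) (RintD i4 i5) (RintB i9 i11).
rewrite (RintZ 2 i6) (RintZ 2 i10) (RintD i2 i3) c1 c2 c3 c6.
by congr EFin; ring.
Qed.

Lemma el_support_finite e : finite_borel (el_support e).
Proof.
have /andP[a0 ab] := el_time e; have mA := el_set_measurable e.
split.
- exact: measurableX.
- by move=> z [/=]; rewrite in_itv/= => /andP[/ltW/(le_trans a0)].
- rewrite /el_support leb2X// lebesgue_measure_itv/=; case: ifP => _; last by rewrite mul0e.
  by rewrite -EFinD lte_mul_pinfty// ?lee_fin ?subr_ge0//; exact: el_set_finite.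
Qed.

Lemma el_support_future e : future (el_start e) (el_support e).
Proof.
split; first exact: el_support_finite.
by move=> z [/=]; rewrite in_itv/= => /andP[].
Qed.

Lemma el_coef_past e : past_fun (el_start e) (el_coef e).
Proof. by apply: filtration_past_fun; exact: el_coef_measurable. Qed.

Lemma el_coef_mbounded e : mbounded (el_coef e).
Proof.
split; last exact: el_coef_bounded.
exact: past_fun_measurable (@el_coef_past e).
Qed.

Lemma el_itg e e' :
  itg P (fun w => el_coef e w * W (el_support e) w * (el_coef e' w * W (el_support e') w)).
Proof.
have i1 : itg P (fun w => W (el_support e) w * W (el_support e') w).
  by apply: square_itgM; apply: noise_square_itg => //; exact: el_support_finite.
have := itg_mbounded (mboundedM (el_coef_mbounded e) (el_coef_mbounded e')) i1.
by congr itg; apply/funext => w; ring.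
Qed.

(** Let e' be the one that starts later, at time a, and cut the support of e at a. The part before a
    joins the coefficients as a factor from the past, with zero mean against the noise of e'. The
    part after a lies in the future like the support of e', and [past_future_mul] separates it from
    the coefficients. *)
Lemma el_product e e' :
  \int[P]_w (el_coef e w * W (el_support e) w * (el_coef e' w * W (el_support e') w)) =
  \int[P]_w (el_coef e w * el_coef e' w) * fine (leb2 (el_support e `&` el_support e')).
Proof.
wlog ee' : e e' / el_start e <= el_start e'.
  move=> h; have [|/ltW] := leP (el_start e) (el_start e'); first exact: h.
  move/h; rewrite setIC => h1.
  rewrite (_ : Rintegral _ _ _ = \int[P]_w (el_coef e' w * W (el_support e') w *
    (el_coef e w * W (el_support e) w))); last first.
    by apply: eq_Rintegral => w _; rewrite mulrC.
  rewrite h1; congr (_ * _); apply: eq_Rintegral => w _; exact: mulrC.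
set a := el_start e'.
have [mE E0 Efin] := el_support_finite e.
have mH : measurable [set z : R * R | z.1 <= a].
  rewrite (_ : [set z : R * R | _] = fst @^-1` `]-oo, a]%classic).
    by rewrite -[X in measurable X]setTI; exact: measurable_fst.
  by apply/seteqP; split => z /=; rewrite in_itv.
pose S1 := el_support e `&` [set z | z.1 <= a].
pose S2 := el_support e `&` ~` [set z | z.1 <= a].
have mS1 : measurable S1 by exact: measurableI.
have mS2 : measurable S2 by apply: measurableI => //; exact: measurableC.
have SE : el_support e = S1 `|` S2 by rewrite -setIUr setUCr setIT.
have S12 : S1 `&` S2 = set0.
  by apply/seteqP; split => // z [[_ h] [_ /=]].
have leS A : A `<=` el_support e -> measurable A -> finite_borel A.
  move=> sub mA; split => //; first by move=> z /sub/E0.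
  by apply: le_lt_trans Efin; apply: le_measure => //; rewrite inE.
have f1 : past a S1 by split; [apply: leS => // z []|move=> z []].
have f2 : future a S2.
  by split; [apply: leS => // z []|move=> z [_ /= /negP]; rewrite -ltNge].
have WE := noise_additive f1.1 f2.1 S12; rewrite -SE in WE.
pose Y w := el_coef e w * el_coef e' w.
have bY : mbounded Y by apply: mboundedM; exact: el_coef_mbounded.
have pY : past_fun a Y.
  by apply: past_funM; [exact: (past_fun_le ee' (@el_coef_past e))|exact: el_coef_past].
have f' := el_support_future e'.
have i1 : itg P (fun w => Y w * W S1 w * W (el_support e') w).
  have i : itg P (fun w => W S1 w * W (el_support e') w).
    by apply: square_itgM; apply: noise_square_itg => //; [exact: f1.1|exact: f'.1].
  by have := itg_mbounded bY i; congr itg; apply/funext => w; ring.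
have i2 : itg P (fun w => Y w * (W S2 w * W (el_support e') w)).
  apply: itg_mbounded bY _.
  by apply: square_itgM; apply: noise_square_itg => //; [exact: f2.1|exact: f'.1].
transitivity (\int[P]_w (Y w * W S1 w * W (el_support e') w +
    Y w * (W S2 w * W (el_support e') w))).
  rewrite /Rintegral; congr fine; apply: ae_eq_integral => //.
  - by apply/measurable_EFinP; exact: itg_measurable (el_itg _ _).
  - by apply/measurable_EFinP; apply: itg_measurable; exact: itgD i1 i2.
  - by apply: filterS WE => w + _ /=; rewrite /Y => ->; congr EFin; ring.
rewrite RintD//.
rewrite (@past_future_mean _ _ _ _ hP W hW a (fun w => Y w * W S1 w))//; last 2 first.
- by apply: past_funM => //; exact: past_fun_noise.
- exact: noise_span1.
rewrite add0r (@past_future_mul _ _ _ _ hP W hW a Y)//; last 3 first.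
- exact: noise_span1.
- exact: noise_span1.
- by case: bY.
congr (_ * _); apply: EFin_inj; rewrite (noise_covariance hW f2.1 f'.1) fineK; last first.
  rewrite ge0_fin_numE ?measure_ge0//; apply: le_lt_trans Efin; apply: le_measure; rewrite ?inE//.
  by apply: measurableI => //; case: f'.1.
congr leb2; apply/seteqP; split => z [] //=; first by move=> [].
move=> ze ze'; split => //; split => //= h.
by have := f'.2 _ ze'; rewrite /= ltNge h.
Qed.

Lemma el_mean e : \int[P]_w (el_coef e w * W (el_support e) w) = 0.
Proof.
apply: (@past_future_mean _ _ _ _ hP W hW (el_start e)) => //.
- exact: el_coef_past.
- by apply: noise_span1; exact: el_support_future.
- apply: itg_mbounded; first exact: el_coef_mbounded.
  by apply: square_itg_itg; apply: noise_square_itg => //; exact: el_support_finite.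
Qed.

End Filtration.

(** * Integrals over time, space and probability *)

Section EnergyIntegral.
Context d (T : measurableType d) (R : realType) (P : probability T R).
Notation mu := (@lebesgue_measure R).
Implicit Types (f g h : R -> R -> T -> R).
Local Open Scope ereal_scope.

Definition jmeasurable f :=
  measurable_fun [set: (R * R) * T] (fun z => f z.1.1 z.1.2 z.2).

Definition energy h : \bar R := \int[mu]_s \int[mu]_y \int[P]_w (h s y w)%:E.

Lemma measurable_mean h : jmeasurable h -> (forall s y w, 0 <= h s y w)%R ->
  measurable_fun [set: R * R] (fun z => \int[P]_w (h z.1 z.2 w)%:E).
Proof.
move=> mh h0; apply: (measurable_fun_fubini_tonelli_F (m2 := P)
  (fun z : (R * R) * T => (h z.1.1 z.1.2 z.2)%:E)).
- by apply/measurable_EFinP.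
- by move=> z; rewrite lee_fin.
Qed.

Lemma mean_ge0 h s y : (forall s y w, 0 <= h s y w)%R ->
  0 <= \int[P]_w (h s y w)%:E.
Proof. by move=> h0; apply: integral_ge0 => w _; rewrite lee_fin. Qed.

Lemma jmeasurable_slice h s y : jmeasurable h -> measurable_fun setT (h s y).
Proof.
move=> mh.
exact: (@measurableT_comp _ _ _ _ _ _ (fun z : (R * R) * T => h z.1.1 z.1.2 z.2) _
   (fun w => ((s, y), w)) mh (measurable_pair1 _)).
Qed.

Let measurable_mean_slice h s : jmeasurable h -> (forall s y w, 0 <= h s y w)%R ->
  measurable_fun setT (fun y : R => \int[P]_w (h s y w)%:E).
Proof.
move=> mh h0.
exact: (@measurableT_comp _ _ _ _ _ _ (fun z : R * R => \int[P]_w (h z.1 z.2 w)%:E) _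
   (fun y => (s, y)) (measurable_mean mh h0) (measurable_pair1 _)).
Qed.

Let measurable_mean_int h : jmeasurable h -> (forall s y w, 0 <= h s y w)%R ->
  measurable_fun setT (fun s : R => \int[mu]_y \int[P]_w (h s y w)%:E).
Proof.
move=> mh h0; apply: (measurable_fun_fubini_tonelli_F (m2 := mu)
  (fun z : R * R => \int[P]_w (h z.1 z.2 w)%:E)).
- exact: measurable_mean.
- by move=> z; exact: mean_ge0.
Qed.

Lemma energy_ge0 h : (forall s y w, 0 <= h s y w)%R -> 0 <= energy h.
Proof.
move=> h0; apply: integral_ge0 => s _; apply: integral_ge0 => y _.
exact: mean_ge0.
Qed.

Lemma eq_energy g h : (forall s y w, g s y w = h s y w) -> energy g = energy h.
Proof.
move=> gh; apply: eq_integral => s _; apply: eq_integral => y _.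
by apply: eq_integral => w _; rewrite gh.
Qed.

Lemma le_energy g h : jmeasurable g -> jmeasurable h ->
  (forall s y w, 0 <= g s y w)%R -> (forall s y w, g s y w <= h s y w)%R ->
  energy g <= energy h.
Proof.
move=> mg mh g0 gh.
have h0 s y w : (0 <= h s y w)%R by exact: le_trans (gh s y w).
apply: ge0_le_integral => //.
- by move=> s _; apply: integral_ge0 => y _; exact: mean_ge0.
- exact: measurable_mean_int.
- exact: measurable_mean_int.
move=> s _; apply: ge0_le_integral => //.
- by move=> y _; exact: mean_ge0.
- exact: measurable_mean_slice.
- exact: measurable_mean_slice.
move=> y _; apply: ge0_le_integral => //.
- by move=> w _; rewrite lee_fin.
- by apply/measurable_EFinP; exact: jmeasurable_slice.
- by apply/measurable_EFinP; exact: jmeasurable_slice.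
- by move=> w _; rewrite lee_fin.
Qed.

Lemma energyD g h : jmeasurable g -> jmeasurable h ->
  (forall s y w, 0 <= g s y w)%R -> (forall s y w, 0 <= h s y w)%R ->
  energy (fun s y w => g s y w + h s y w)%R = energy g + energy h.
Proof.
move=> mg mh g0 h0; rewrite -ge0_integralD//; first last.
- exact: measurable_mean_int.
- by move=> s _; apply: integral_ge0 => y _; exact: mean_ge0.
- exact: measurable_mean_int.
- by move=> s _; apply: integral_ge0 => y _; exact: mean_ge0.
apply: eq_integral => s _; rewrite -ge0_integralD//; first last.
- exact: measurable_mean_slice.
- by move=> y _; exact: mean_ge0.
- exact: measurable_mean_slice.
- by move=> y _; exact: mean_ge0.
apply: eq_integral => y _; rewrite -ge0_integralD//; first last.
- by apply/measurable_EFinP; exact: jmeasurable_slice.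
- by move=> w _; rewrite lee_fin.
- by apply/measurable_EFinP; exact: jmeasurable_slice.
- by move=> w _; rewrite lee_fin.
Qed.

Lemma energyZ (k : R) h : jmeasurable h -> (0 <= k)%R ->
  (forall s y w, 0 <= h s y w)%R ->
  energy (fun s y w => k * h s y w)%R = k%:E * energy h.
Proof.
move=> mh k0 h0; rewrite -ge0_integralZl//; first last.
- by move=> s _; apply: integral_ge0 => y _; exact: mean_ge0.
- exact: measurable_mean_int.
apply: eq_integral => s _; rewrite -ge0_integralZl//; first last.
- by move=> y _; exact: mean_ge0.
- exact: measurable_mean_slice.
apply: eq_integral => y _; rewrite -ge0_integralZl//.
- by apply/measurable_EFinP; exact: jmeasurable_slice.
- by move=> w _; rewrite lee_fin.
Qed.

Lemma jmeasurableD f g : jmeasurable f -> jmeasurable g ->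
  jmeasurable (fun s y w => f s y w + g s y w)%R.
Proof. by move=> mf mg; exact: measurable_funD. Qed.

Lemma jmeasurableB f g : jmeasurable f -> jmeasurable g ->
  jmeasurable (fun s y w => f s y w - g s y w)%R.
Proof. by move=> mf mg; exact: measurable_funB. Qed.

Lemma jmeasurableM f g : jmeasurable f -> jmeasurable g ->
  jmeasurable (fun s y w => f s y w * g s y w)%R.
Proof. by move=> mf mg; exact: measurable_funM. Qed.

Lemma jmeasurableX f : jmeasurable f -> jmeasurable (fun s y w => f s y w ^+ 2)%R.
Proof. by move=> mf; exact: measurable_funX. Qed.

Lemma energy_real (h : R -> R -> R) (u : R -> R -> T -> R) :
  measurable_fun [set: R * R] (fun z => h z.1 z.2) ->
  (forall s y, 0 <= h s y)%R ->
  (forall s y, \int[P]_w (u s y w)%:E = (h s y)%:E) ->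
  energy u = \int[mu \x mu]_z (h z.1 z.2)%:E.
Proof.
move=> mh h0 uh.
rewrite (fubini_tonelli1 (m1 := mu) (m2 := mu) (fun z : R * R => (h z.1 z.2)%:E)).
- by apply: eq_integral => s _; apply: eq_integral => y _; rewrite uh.
- exact/measurable_EFinP.
- by move=> z; rewrite lee_fin.
Qed.

End EnergyIntegral.

(** * The isometry for simple processes *)

Section SimpleIsometry.
Context d (T : measurableType d) (R : realType) (P : probability T R).
Hypothesis (hP : measure_is_complete P).
Variables (W : set (R * R) -> {RV P >-> R}) (hW : space_time_white_noise W).
Implicit Types (e : elementary W) (S : seq (elementary W)) (c : R).
Notation mu := (@lebesgue_measure R).

Lemma jmeasurable_simple_process S : jmeasurable (simple_process S).
Proof.
rewrite /jmeasurable /simple_process.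
apply: measurable_sum => e; apply: measurable_funM.
  apply: measurableT_comp => //; case: (el_coef_mbounded hP hW e) => m _; exact: m.
rewrite (_ : (fun z : R * R * T => _) = \1_(el_support e) \o (fun z : R * R * T => z.1)).
  apply: measurableT_comp; last exact: measurable_fst.
  by apply: measurable_indic; case: (el_support_finite e).
by apply/funext => z /=; rewrite -surjective_pairing.
Qed.

Let itg_support e e' k : itg (mu \x mu)%E
  (fun z : R * R => k * (\1_(el_support e) z * \1_(el_support e') z)).
Proof.
have mE (x : elementary W) : measurable (el_support x) by case: (el_support_finite x).
have mEE : measurable (el_support e `&` el_support e') by exact: measurableI.
apply: itgZ; rewrite (_ : (fun z => _) = \1_(el_support e `&` el_support e')).
  apply: itg_lty.
  - by apply: measurable_indic; exact: mEE.
  - by move=> z; rewrite indicE.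
  rewrite integral_indic//.
  rewrite setIT; have [_ _] := el_support_finite e; apply: le_lt_trans.
  apply: le_measure; rewrite ?inE; [exact: mEE|exact: mE|exact: subIsetl].
by apply/funext => z; rewrite indicI.
Qed.

(** Both sides expand into the same double sum, by [el_product] on the left. The constant c, which
    prepares for the deterministic term of the solution, gives a cross term of mean 0. *)
Lemma simple_isometry c S :
  (\int[P]_w ((c + simple_integral S w) ^+ 2)%:E =
   (c ^+ 2)%:E + energy P (fun s y w => (simple_process S s y w ^+ 2)%R))%E.
Proof.
have mE (x : elementary W) : measurable (el_support x) by case: (el_support_finite x).
pose v e e' := \int[P]_w (el_coef e w * el_coef e' w).
have iYY e e' : itg P (fun w => el_coef e w * el_coef e' w).
  have := itg_mbounded (mboundedM (el_coef_mbounded hP hW e) (el_coef_mbounded hP hW e'))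
     (itg_cst P 1).
  by congr itg; apply/funext => w; rewrite mulr1.
have iYW e : itg P (fun w => el_coef e w * W (el_support e) w).
  apply: itg_mbounded; first exact: el_coef_mbounded.
  by apply: square_itg_itg; apply: noise_square_itg => //; exact: el_support_finite.
have iYWYW e e' := el_itg hP hW e e'.
have i1 : itg P (fun w => \sum_(e <- S) (2 * c) * (el_coef e w * W (el_support e) w)).
  by apply: itg_sum => e; exact: itgZ.
have i2 : itg P (fun w => \sum_(e <- S) \sum_(e' <- S)
    (el_coef e w * W (el_support e) w * (el_coef e' w * W (el_support e') w))).
  by apply: itg_sum => e; exact: itg_sum.
have i3 : itg P (fun w => c ^+ 2 + \sum_(e <- S) (2 * c) * (el_coef e w * W (el_support e) w)).
  by apply: itgD => //; exact: itg_cst.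
have E1 : (\int[P]_w ((c + simple_integral S w) ^+ 2)%:E =
    (c ^+ 2 + \sum_(e <- S) \sum_(e' <- S)
       v e e' * fine (leb2 (el_support e `&` el_support e')))%:E)%E.
  transitivity (\int[P]_w ((c ^+ 2 + \sum_(e <- S) (2 * c) * (el_coef e w * W (el_support e) w))
    + \sum_(e <- S) \sum_(e' <- S)
    (el_coef e w * W (el_support e) w * (el_coef e' w * W (el_support e') w)))%:E)%E.
    apply: eq_integral => w _; congr EFin.
    rewrite -mulr_sumr -/(simple_integral S w).
    rewrite (_ : \sum_(e <- S) \sum_(e' <- S) _ = simple_integral S w * simple_integral S w).
      by ring.
    rewrite /simple_integral mulr_suml; apply: eq_bigr => e _.
    by rewrite mulr_sumr.
  rewrite itgE; last exact: itgD.
  rewrite RintD// RintD//; last exact: itg_cst.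
  rewrite Rint_cst Rint_sum; last by move=> e; exact: itgZ.
  rewrite big1 ?addr0; last by move=> e _; rewrite RintZ// el_mean ?mulr0.
  congr EFin; congr (_ + _); rewrite Rint_sum; last by move=> e; exact: itg_sum.
  apply: eq_bigr => e _; rewrite Rint_sum//; apply: eq_bigr => e' _.
  exact: el_product.
rewrite E1 EFinD; congr (_ + _)%E.
pose h (s y : R) := \sum_(e <- S) \sum_(e' <- S)
   v e e' * (\1_(el_support e) (s, y) * \1_(el_support e') (s, y)).
have mh : measurable_fun [set: R * R] (fun z => h z.1 z.2).
  apply: measurable_sum => e; apply: measurable_sum => e'.
  apply: measurable_funM => //.
  rewrite (_ : (fun z : R * R => _) = \1_(el_support e) \* \1_(el_support e')).
    by apply: measurable_funM; exact: measurable_indic.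
  by apply/funext => z /=; rewrite -surjective_pairing.
have iSS s y : itg P (fun w => \sum_(e <- S) \sum_(e' <- S)
     (\1_(el_support e) (s, y) * \1_(el_support e') (s, y)) * (el_coef e w * el_coef e' w)).
  by apply: itg_sum => e; apply: itg_sum => e'; exact: itgZ.
have SS s y w : simple_process S s y w ^+ 2 = \sum_(e <- S) \sum_(e' <- S)
     (\1_(el_support e) (s, y) * \1_(el_support e') (s, y)) * (el_coef e w * el_coef e' w).
  rewrite expr2 {1}/simple_process mulr_suml; apply: eq_bigr => e _.
  by rewrite mulr_sumr; apply: eq_bigr => e' _; ring.
have hE s y : (\int[P]_w (simple_process S s y w ^+ 2)%:E = (h s y)%:E)%E.
  under eq_integral do rewrite SS.
  rewrite itgE// Rint_sum; last by move=> e; apply: itg_sum => e'; exact: itgZ.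
  congr EFin; apply: eq_bigr => e _; rewrite Rint_sum; last by move=> e'; exact: itgZ.
  by apply: eq_bigr => e' _; rewrite RintZ// mulrC.
(* The single terms of the double sum may be negative; the sum is nonnegative because it is a mean
   square. *)
have h0 s y : 0 <= h s y.
  by rewrite -lee_fin -hE; apply: integral_ge0 => w _; rewrite lee_fin sqr_ge0.
rewrite (energy_real mh h0 hE).
have ih : itg (mu \x mu)%E (fun z => h z.1 z.2).
  apply: itg_sum => e; apply: itg_sum => e'.
  by have := itg_support e e' (v e e'); congr itg; apply/funext => z; rewrite -surjective_pairing.
rewrite (itgE ih); congr EFin.
rewrite (_ : Rintegral _ _ _ = \int[(mu \x mu)%E]_z \sum_(e <- S) \sum_(e' <- S)
   v e e' * (\1_(el_support e) z * \1_(el_support e') z)); last first.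
  by apply: eq_Rintegral => -[s y] _.
rewrite Rint_sum; last by move=> e; apply: itg_sum => e'; exact: itg_support.
apply: eq_bigr => e _; rewrite Rint_sum; last by move=> e'; exact: itg_support.
apply: eq_bigr => e' _.
have i4 : itg (mu \x mu)%E (fun z => \1_(el_support e) z * \1_(el_support e') z : R).
  by have := itg_support e e' 1; congr itg; apply/funext => z; rewrite mul1r.
rewrite RintZ//; congr (_ * _).
rewrite /Rintegral (_ : integral _ _ _ = leb2 (el_support e `&` el_support e'))//.
rewrite (_ : (fun z => _) = EFin \o \1_(el_support e `&` el_support e')).
  have mEE : measurable (el_support e `&` el_support e') by exact: measurableI.
  by rewrite integral_indic; [rewrite setIT|exact: measurableT|exact: mEE].
by apply/funext => z /=; rewrite indicI.
Qed.

End SimpleIsometry.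

(** * Comparison of square norms up to a small factor *)

Section AlmostBelow.
Context (R : realType).
Local Open Scope ereal_scope.
Implicit Types (x y z a b : \bar R) (e : R).

(* The form of [(u + v)^2 <= (1 + e) u^2 + (1 + 1/e) v^2], which passes to L^2
   limits without Minkowski's inequality. *)
Definition almost_below e x y a := x <= (1 + e)%:E * y + (1 + e^-1)%:E * a.

Lemma almost_below_trans e x y z a b : (0 < e)%R -> 0 <= y -> 0 <= z ->
  0 <= a -> 0 <= b -> almost_below e x y a -> almost_below e y z b ->
  x <= ((1 + e) ^+ 2)%:E * z + ((1 + e) * (1 + e^-1))%:E * (a + b).
Proof.
move=> e0 y0 z0 a0 b0 xy yz.
have i0 : (0 < e^-1)%R by rewrite invr_gt0.
apply: (le_trans xy).
apply: (@le_trans _ _ ((1 + e)%:E * ((1 + e)%:E * z + (1 + e^-1)%:E * b) + (1 + e^-1)%:E * a)).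
  by apply: leeD => //; apply: lee_wpmul2l => //; rewrite lee_fin; lra.
rewrite ge0_muleDr; last 2 first.
- by rewrite mule_ge0// lee_fin; lra.
- by rewrite mule_ge0// lee_fin; lra.
rewrite !muleA -!EFinM -expr2 -addeA leeD2l// ge0_muleDr// addeC leeD2r//.
apply: lee_wpmul2r; first exact: a0.
by rewrite lee_fin ler_peMl//; lra.
Qed.

Lemma almost_belowD e c x y a : (0 < e)%R -> 0 <= c -> 0 <= x -> 0 <= y -> 0 <= a ->
  almost_below e x y a -> almost_below e (c + x) (c + y) a.
Proof.
move=> e0 c0 x0 y0 a0; rewrite /almost_below => h.
rewrite ge0_muleDr// -addeA; apply: leeD => //.
by rewrite -[leLHS]mul1e; apply: lee_wpmul2r => //; rewrite lee_fin; lra.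
Qed.

(** The order of the limits matters: n tends to infinity at a fixed e, which removes the term with
    [k e], and only then e tends to 0, where [k] may blow up. *)
Lemma almost_below_limit x y (k : R -> R) (a : nat -> \bar R) : 0 <= y ->
  a @ \oo --> 0 ->
  (forall e n, (0 < e)%R -> x <= ((1 + e) ^+ 2)%:E * y + (k e)%:E * a n) -> x <= y.
Proof.
move=> y0 a0 h.
have h2 e : (0 < e)%R -> x <= ((1 + e) ^+ 2)%:E * y.
  move=> e0.
  have [->|yfin] := eqVneq y +oo.
    by rewrite mulry gtr0_sg ?mul1e ?leey// exprn_gt0//; lra.
  have : (fun n => ((1 + e) ^+ 2)%:E * y + (k e)%:E * a n) @ \oo --> ((1 + e) ^+ 2)%:E * y + (k e)%:E * 0.
    apply: cvgeD.
    - by rewrite mule0 fin_num_adde_defl.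
    - exact: cvg_cst.
    - by apply: cvgeZl.
  rewrite mule0 adde0 => cv.
  rewrite -(cvg_lim _ cv)//; apply: lime_ge; first by apply: cvgP cv.
  by apply: nearW => n; exact: h.
case: y y0 h2 {h} => [r| |//]; last by move=> _ _; rewrite leey.
rewrite lee_fin => r0 h2; apply/lee_addgt0Pr => e e0.
(* For d <= 1 one has (1 + d)^2 r <= r + 3 d r; the 1 in the denominator covers r = 0. *)
pose d := Num.min 1%R (e / (3 * r + 1))%R.
have r1 : (0 < 3 * r + 1)%R by lra.
have d0 : (0 < d)%R by rewrite lt_min ltr01 divr_gt0.
have d1 : (d <= 1)%R by rewrite ge_min lexx.
have de : (d * (3 * r + 1) <= e)%R by rewrite -ler_pdivlMr// ge_min lexx orbT.
apply: (le_trans (h2 d d0)); rewrite -EFinM -EFinD lee_fin.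
have -> : ((1 + d) ^+ 2 * r = r + (2 * d * r + d * (d * r)))%R by ring.
rewrite lerD2l (le_trans _ de)//.
have : (d * (d * r) <= 1 * (d * r))%R by rewrite ler_wpM2r// mulr_ge0// ltW.
lra.
Qed.

Lemma sqrr_almost e (u v : R) : (0 < e)%R ->
  (u ^+ 2 <= (1 + e) * v ^+ 2 + (1 + e^-1) * (u - v) ^+ 2)%R.
Proof.
move=> e0; rewrite -subr_ge0.
have -> : ((1 + e) * v ^+ 2 + (1 + e^-1) * (u - v) ^+ 2 - u ^+ 2 =
  (e * v - (u - v)) ^+ 2 / e)%R by field; rewrite gt_eqF.
by rewrite divr_ge0 ?sqr_ge0// ltW.
Qed.

End AlmostBelow.

(** * Passage of the isometry to L^2 limits *)

Section ItoIntegral.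
Context d (T : measurableType d) (R : realType) (P : probability T R).
Hypothesis (hP : measure_is_complete P).
Variables (W : set (R * R) -> {RV P >-> R}) (hW : space_time_white_noise W).
Implicit Types (f g : R -> R -> T -> R) (X Y : T -> R) (S : seq (elementary W)).
Notation mu := (@lebesgue_measure R).

Definition square_mean X : \bar R := (\int[P]_w (X w ^+ 2)%:E)%E.
Definition square_energy f : \bar R := energy P (fun s y w => f s y w ^+ 2).

Lemma square_mean_ge0 X : (0 <= square_mean X)%E.
Proof. by apply: integral_ge0 => w _; rewrite lee_fin sqr_ge0. Qed.

Lemma square_energy_ge0 f : (0 <= square_energy f)%E.
Proof. by apply: energy_ge0 => s y w; exact: sqr_ge0. Qed.

Lemma square_mean_almost e X Y : 0 < e -> measurable_fun setT X -> measurable_fun setT Y ->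
  almost_below e (square_mean X) (square_mean Y) (square_mean (fun w => X w - Y w)).
Proof.
move=> e0 mX mY; have i0 : 0 < e^-1 by rewrite invr_gt0.
have mX2 : measurable_fun setT (fun w => (X w ^+ 2)%:E).
  by apply/measurable_EFinP; exact: measurable_funX.
have mY2 : measurable_fun setT (fun w => (Y w ^+ 2)%:E).
  by apply/measurable_EFinP; exact: measurable_funX.
have mXY : measurable_fun setT (fun w => ((X w - Y w) ^+ 2)%:E).
  by apply/measurable_EFinP; apply: measurable_funX; exact: measurable_funB.
rewrite /almost_below /square_mean.
rewrite -ge0_integralZl//; [|by move=> w _; rewrite lee_fin sqr_ge0|by rewrite lee_fin; lra].
rewrite -ge0_integralZl//; [|by move=> w _; rewrite lee_fin sqr_ge0|by rewrite lee_fin; lra].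
rewrite -ge0_integralD//.
- apply: ge0_le_integral => //.
  + by move=> w _; rewrite lee_fin sqr_ge0.
  + by apply: emeasurable_funD; exact: measurable_funeM.
  + by move=> w _; rewrite -!EFinM -EFinD lee_fin; exact: sqrr_almost.
- by move=> w _; rewrite -EFinM lee_fin mulr_ge0 ?sqr_ge0//; lra.
- exact: measurable_funeM.
- by move=> w _; rewrite -EFinM lee_fin mulr_ge0 ?sqr_ge0//; lra.
- exact: measurable_funeM.
Qed.

Lemma square_energy_almost e f g : 0 < e -> jmeasurable f -> jmeasurable g ->
  almost_below e (square_energy f) (square_energy g)
    (square_energy (fun s y w => f s y w - g s y w)).
Proof.
move=> e0 mf mg; have i0 : 0 < e^-1 by rewrite invr_gt0.
have mf2 := jmeasurableX mf; have mg2 := jmeasurableX mg.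
have mfg := jmeasurableX (jmeasurableB mf mg).
have mc (k : R) : jmeasurable (fun _ _ _ => k : R) by exact: measurable_cst.
rewrite /almost_below /square_energy.
rewrite -(energyZ P mg2); [|lra|by move=> s y w; exact: sqr_ge0].
rewrite -(energyZ P mfg); [|lra|by move=> s y w; exact: sqr_ge0].
rewrite -energyD.
- apply: le_energy.
  + exact: mf2.
  + by apply: jmeasurableD; apply: jmeasurableM.
  + by move=> s y w; exact: sqr_ge0.
  + by move=> s y w; exact: sqrr_almost.
- exact: jmeasurableM.
- exact: jmeasurableM.
- by move=> s y w; rewrite mulr_ge0 ?sqr_ge0//; lra.
- by move=> s y w; rewrite mulr_ge0 ?sqr_ge0//; lra.
Qed.

Definition ito f X := [/\ jmeasurable f, measurable_fun setT X &
  exists S : nat -> seq (elementary W),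
    ((fun n => square_energy (fun s y w => f s y w - simple_process (S n) s y w))
       @ \oo --> 0%E) /\
    ((fun n => square_mean (fun w => X w - simple_integral (S n) w)) @ \oo --> 0%E)].

Lemma measurable_simple_integral S : measurable_fun setT (simple_integral S).
Proof.
apply: measurable_sum => e; apply: measurable_funM => //.
by case: (el_coef_mbounded hP hW e).
Qed.

(** Each of the two inequalities passes through the isometry of the n-th simple process: one
    comparison on the side of the random variables and one on the side of the integrands, with both
    errors tending to 0. *)
Lemma ito_isometry f X (c : R) : ito f X ->
  square_mean (fun w => c + X w) = ((c ^+ 2)%:E + square_energy f)%E.
Proof.
move=> [mf mX [S [Sf SX]]].
have mS n : jmeasurable (simple_process (S n)) by exact: jmeasurable_simple_process.
have mI n := measurable_simple_integral (S n).
have mc (Y : T -> R) : measurable_fun setT Y -> measurable_fun setT (fun w => c + Y w).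
  by move=> mY; exact: measurable_funD.
have c0 : (0 <= (c ^+ 2)%:E)%E by rewrite lee_fin sqr_ge0.
pose A n := square_mean (fun w => X w - simple_integral (S n) w).
pose B n := square_energy (fun s y w => f s y w - simple_process (S n) s y w).
have A0 n : (0 <= A n)%E by exact: square_mean_ge0.
have B0 n : (0 <= B n)%E by exact: square_energy_ge0.
have AB : (fun n => A n + B n)%E @ \oo --> 0%E.
  by rewrite -[X in _ --> X]adde0; apply: cvgeD.
have BA : (fun n => B n + A n)%E @ \oo --> 0%E.
  by rewrite -[X in _ --> X]adde0; apply: cvgeD.
have iso n : square_mean (fun w => c + simple_integral (S n) w) =
    ((c ^+ 2)%:E + square_energy (simple_process (S n)))%E by exact: simple_isometry.
have eA n : A n = square_mean (fun w => (c + X w) - (c + simple_integral (S n) w)).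
  by congr square_mean; apply/funext => w; ring.
have eA' n : A n = square_mean (fun w => (c + simple_integral (S n) w) - (c + X w)).
  by rewrite eA; apply: eq_integral => w _; congr EFin; ring.
have eB n : B n = square_energy (fun s y w => simple_process (S n) s y w - f s y w).
  by apply: eq_energy => s y w; ring.
have q0 := square_energy_ge0 f; have L0 := square_mean_ge0 (fun w => c + X w).
pose M n := square_mean (fun w => c + simple_integral (S n) w).
have M0 n : (0 <= M n)%E by exact: square_mean_ge0.
have Q0 n : (0 <= square_energy (simple_process (S n)))%E by exact: square_energy_ge0.
have h1 e n : 0 < e -> almost_below e (square_mean (fun w => c + X w)) (M n) (A n).
  by move=> e0; rewrite eA; apply: square_mean_almost e0 _ _; exact: mc.
have h2 e n : 0 < e -> almost_below e (M n) (square_mean (fun w => c + X w)) (A n).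
  by move=> e0; rewrite eA'; apply: square_mean_almost e0 _ _; exact: mc.
have h3 e n : 0 < e -> almost_below e (M n) ((c ^+ 2)%:E + square_energy f)%E (B n).
  move=> e0; rewrite /M iso; apply: (almost_belowD e0 c0 (Q0 n) q0 (B0 n)).
  by rewrite eB; exact: (square_energy_almost e0 (mS n) mf).
have h4 e n : 0 < e -> almost_below e ((c ^+ 2)%:E + square_energy f)%E (M n) (B n).
  move=> e0; rewrite /M iso; apply: (almost_belowD e0 c0 q0 (Q0 n) (B0 n)).
  exact: (square_energy_almost e0 mf (mS n)).
have z0 : (0 <= (c ^+ 2)%:E + square_energy f)%E by exact: adde_ge0.
apply/eqP; rewrite eq_le; apply/andP; split.
- apply: (@almost_below_limit _ _ _ (fun e => (1 + e) * (1 + e^-1)) _ z0 AB) => e n e0.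
  exact: (almost_below_trans e0 (M0 n) z0 (A0 n) (B0 n) (h1 e n e0) (h3 e n e0)).
- apply: (@almost_below_limit _ _ _ (fun e => (1 + e) * (1 + e^-1)) _ L0 BA) => e n e0.
  exact: (almost_below_trans e0 (M0 n) L0 (B0 n) (A0 n) (h4 e n e0) (h2 e n e0)).
Qed.

(** Concatenation adds simple processes and their integrals; the error is controlled by the
    comparison with e = 1, which is (u + v)^2 <= 2 u^2 + 2 v^2. *)
Lemma itoD f g X Y : ito f X -> ito g Y ->
  ito (fun s y w => f s y w + g s y w) (fun w => X w + Y w).
Proof.
move=> [mf mX [S [Sf SX]]] [mg mY [S' [Sg SY]]].
split; [exact: jmeasurableD|exact: measurable_funD|].
have lim0 (u v : nat -> \bar R) : u @ \oo --> 0%E -> v @ \oo --> 0%E ->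
    (fun n => (1 + 1)%:E * u n + (1 + 1^-1)%:E * v n)%E @ \oo --> 0%E.
  move=> u0 v0; have -> : (0 = (1 + 1)%:E * 0 + (1 + 1^-1)%:E * 0 :> \bar R)%E.
    by rewrite !mule0 adde0.
  apply: cvgeD; first by rewrite !mule0.
  - exact: cvgeZl.
  - exact: cvgeZl.
exists (fun n => S n ++ S' n); split.
- apply: (squeeze_cvge _ (cvg_cst 0%E) (lim0 _ _ Sf Sg)); apply: nearW => n.
  rewrite square_energy_ge0/=.
  have m1 := jmeasurableB mf (jmeasurable_simple_process hP hW (S n)).
  have m2 := jmeasurableB (jmeasurableD mf mg)
    (jmeasurable_simple_process hP hW (S n ++ S' n)).
  have h := square_energy_almost ltr01 m2 m1.
  have e : square_energy (fun s y w => f s y w + g s y w -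
      simple_process (S n ++ S' n) s y w - (f s y w - simple_process (S n) s y w)) =
      square_energy (fun s y w => g s y w - simple_process (S' n) s y w).
    apply: eq_energy => s y w; rewrite /simple_process big_cat/=; ring.
  by rewrite e in h; exact: h.
- apply: (squeeze_cvge _ (cvg_cst 0%E) (lim0 _ _ SX SY)); apply: nearW => n.
  rewrite square_mean_ge0/=.
  have m1 := measurable_funB mX (measurable_simple_integral (S n)).
  have m2 := measurable_funB (measurable_funD mX mY) (measurable_simple_integral (S n ++ S' n)).
  have h := square_mean_almost ltr01 m2 m1.
  have e : square_mean (fun w => (X w + Y w - simple_integral (S n ++ S' n) w) -
      (X w - simple_integral (S n) w)) =
      square_mean (fun w => Y w - simple_integral (S' n) w).
    apply: eq_integral => w _; congr EFin.
    rewrite /simple_integral big_cat/=; ring.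
  by rewrite -e; exact: h.
Qed.

End ItoIntegral.

(** * The solution *)

Section Solution.
Context (R : realType) (d : measure_display)
    (T : measurableType d) (P : probability T R).
Hypothesis (hP : measure_is_complete P).
Variables (W : set (R * R) -> {RV P >-> R}) (hW : space_time_white_noise W).
Notation mu := (@lebesgue_measure R).

Lemma walsh_ito t (f : R -> R -> T -> R) (X : T -> R) : walsh_integral W t f X ->
  ito W (fun s y w => f s y w * \1_(`]0, t]%classic) s) X.
Proof.
move=> [mf mX [S [Sf SX]]].
have mD : measurable [set z : (R * R) * T | 0 < z.1.1 <= t].
  rewrite (_ : [set z : (R * R) * T | _] = (fun z => z.1.1) @^-1` `]0, t]%classic).
    by rewrite -[X in measurable X]setTI; apply: measurableT_comp => //; exact: measurable_fst.
  by apply/seteqP; split => z /=; rewrite in_itv.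
split => //.
  move/(measurable_restrictT _ mD) : mf; rewrite /jmeasurable; congr measurable_fun.
  apply/funext => z; rewrite patchE indicE.
  have -> : (z \in [set z : (R * R) * T | 0 < z.1.1 <= t]) = (z.1.1 \in `]0, t]%classic).
    apply/idP/idP => /set_mem /= h; apply/mem_set => /=; by move: h; rewrite in_itv.
  by case: ifPn => _; rewrite ?mulr1 ?mulr0.
exists S; split; last first.
  by move: SX; rewrite unlock.
suff e n : square_energy P (fun s y w =>
    f s y w * \1_(`]0, t]%classic) s - simple_process (S n) s y w) =
    (\int[mu]_(s in `]0%R, +oo[) \int[mu]_y
       'E_P[fun w => ((f s y w * \1_(`]0, t]%classic) s -
          simple_process (S n) s y w) ^+ 2)%R])%E.
  by rewrite (funext e).
rewrite unlock.
(* At times s <= 0 the truncated integrand and all elementary processes vanish, the latter because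
   they start at nonnegative times and leave out the starting time. *)
rewrite [RHS]integral_mkcond; apply: eq_integral => s _.
rewrite patchE; case: ifPn => // s0.
apply: integral0_eq => y _; apply: integral0_eq => w _.
have s1 : s <= 0 by rewrite leNgt; apply/negP => h; move: s0; rewrite notin_setE/= in_itv/= h.
rewrite indicE memNset/=; last by rewrite in_itv/= ltNge s1.
rewrite mulr0 sub0r sqrrN /simple_process big1 ?expr0n// => e _.
rewrite indicE memNset ?mulr0//= => -[/=]; rewrite in_itv/= => /andP[+ _] _.
have /andP[a0 _] := el_time e.
by move=> /(le_lt_trans a0); rewrite ltNge s1.
Qed.

Variables (nu : R) (hnu : 0 < nu) (lambda vsigma : R) (hlambda : lambda != 0).
Variables (rho : R -> R) (hrho : forall v : R,
       `|rho v| ^+ 2 = lambda ^+ 2 * (vsigma ^+ 2 + v ^+ 2)).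
Variables (u : R -> R -> T -> R)
    (hu : random_field_solution nu rho (dirac (0 : R)) W u).

Let G := @heat_kernel R nu.

(** The square of [rho (u s y w)] divided by lambda^2, with the value 0 at nonpositive times, where
    [u] is unspecified. *)
Definition field_energy (s y : R) (w : T) : R := if 0 < s then vsigma ^+ 2 + u s y w ^+ 2 else 0.
Definition phi (s y : R) : \bar R := (\int[P]_w (field_energy s y w)%:E)%E.

Let fe := field_energy.

Let fe_ge0 s y w : 0 <= fe s y w.
Proof. by rewrite /fe /field_energy; case: ifP => // _; rewrite addr_ge0 ?sqr_ge0. Qed.

Let jm_fe : jmeasurable fe.
Proof.
have [_ mu_ _ _] := hu.
have mD : measurable [set z : (R * R) * T | 0 < z.1.1].
  rewrite (_ : [set z : (R * R) * T | _] = (fun z => z.1.1) @^-1` `]0, +oo[%classic).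
    by rewrite -[X in measurable X]setTI; apply: measurableT_comp => //; exact: measurable_fst.
  by apply/seteqP; split => z /=; rewrite in_itv/= andbT.
have : measurable_fun [set z : (R * R) * T | 0 < z.1.1]
    (fun z => vsigma ^+ 2 + u z.1.1 z.1.2 z.2 ^+ 2).
  by apply: measurable_funD => //; exact: measurable_funX.
move/(measurable_restrictT _ mD); rewrite /jmeasurable; congr measurable_fun.
apply/funext => z; rewrite patchE /fe /field_energy.
have -> : (z \in [set z : (R * R) * T | 0 < z.1.1]) = (0 < z.1.1).
  by apply/idP/idP => [/set_mem//|h]; exact/mem_set.
by case: ifP.
Qed.

Let rho2 v : rho v ^+ 2 = lambda ^+ 2 * (vsigma ^+ 2 + v ^+ 2).
Proof. by rewrite -hrho real_normK// num_real. Qed.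

Let g t x s y w := G (t - s) (x - y) * rho (u s y w) * \1_(`]0, t]%classic) s.

(** [rho] enters only through its square, so the product is nonnegative and Tonelli's theorem
    applies to covariances too. The indicator disappears: [fe] is 0 for s <= 0 and the heat kernels
    are 0 for s >= t. *)
Let gg t x x' s y w : g t x s y w * g t x' s y w =
  lambda ^+ 2 * heat_kernel (2 * nu) (t - s) `|x - x'|
    * heat_kernel (nu / 2) (t - s) ((x + x') / 2 - y) * fe s y w.
Proof.
have -> : (x + x') / 2 - y = ((x - y) + (x' - y)) / 2 by field.
have -> : x - x' = (x - y) - (x' - y) by ring.
rewrite heat_kernel_norm -[_ * _ * heat_kernel _ _ _]mulrA -heat_kernel_mul//.
rewrite /g /fe /field_energy indicE; have [|s0] := boolP (s \in `]0, t]%classic).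
  rewrite inE/= in_itv/= => /andP[-> _]; rewrite -/(G _ _).
  transitivity (G (t - s) (x - y) * G (t - s) (x' - y) * rho (u s y w) ^+ 2); first by ring.
  by rewrite rho2 /G; ring.
rewrite !mulr0; case: ifPn => [s1|_]; last by rewrite mulr0.
rewrite /G heat_kernel0 ?mul0r ?mulr0 ?mul0r//.
by rewrite subr_le0 leNgt; apply/negP => st; move: s0; rewrite notin_setE/= in_itv/= s1 (ltW st).
Qed.

Let C t x x' := energy P (fun s y w => g t x s y w * g t x' s y w).

Let gg0 t x x' s y w : 0 <= g t x s y w * g t x' s y w.
Proof. rewrite gg; apply: mulr_ge0; last exact: fe_ge0.
apply: mulr_ge0; last exact: heat_kernel_ge0.
by apply: mulr_ge0; [exact: sqr_ge0|exact: heat_kernel_ge0]. Qed.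

Lemma measurable_phi : measurable_fun setT (fun z : R * R => phi z.1 z.2).
Proof. exact: (measurable_mean P jm_fe fe_ge0). Qed.

Lemma phi_ge0 s y : (0 <= phi s y)%E.
Proof. by apply: integral_ge0 => w _; rewrite lee_fin; exact: fe_ge0. Qed.

Lemma phi_le0 s y : s <= 0 -> phi s y = 0%E.
Proof.
by move=> s0; apply: integral0_eq => w _; rewrite /field_energy ltNge s0.
Qed.

Let energy_weight (k : R -> R -> R) : (forall s y, 0 <= k s y) ->
  (energy P (fun s y w => (k s y * fe s y w)%R) =
   \int[mu]_s \int[mu]_y ((k s y)%:E * phi s y))%E.
Proof.
move=> k0; apply: eq_integral => s _; apply: eq_integral => y _.
rewrite /phi -ge0_integralZl//.
- by apply/measurable_EFinP; exact: (jmeasurable_slice _ _ jm_fe).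
- by move=> w _; rewrite lee_fin; exact: fe_ge0.
- by rewrite lee_fin.
Qed.

Let CE t x x' : C t x x' = ((lambda ^+ 2)%:E * \int[mu]_s \int[mu]_y
  ((heat_kernel (2 * nu) (t - s) `|x - x'|)%:E * (heat_kernel (nu / 2) (t - s) ((x + x') / 2 - y))%:E *
   phi s y))%E.
Proof.
pose k (s y : R) := heat_kernel (2 * nu) (t - s) `|x - x'| *
  heat_kernel (nu / 2) (t - s) ((x + x') / 2 - y).
have k0 s y : 0 <= k s y by rewrite mulr_ge0 ?heat_kernel_ge0.
have mk : jmeasurable (fun s y (_ : T) => k s y).
  have m1 : measurable_fun setT (fun z : (R * R) * T => t - z.1.1).
    by apply: measurable_funB => //; apply: measurableT_comp => //; exact: measurable_fst.
  have m2 : measurable_fun setT (fun z : (R * R) * T => (x + x') / 2 - z.1.2).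
    apply: measurable_funB => //; apply: (measurableT_comp measurable_snd).
    exact: measurable_fst.
  by apply: measurable_funM; apply: measurable_heat_kernel_comp => //; exact: measurable_cst.
transitivity (energy P (fun s y w => lambda ^+ 2 * (k s y * fe s y w))).
  by apply: eq_energy => s y w; rewrite gg /k; ring.
rewrite energyZ.
- rewrite energy_weight//; congr (_ * _)%E.
- exact: jmeasurableM mk jm_fe.
- exact: sqr_ge0.
- by move=> s y w; rewrite mulr_ge0//; exact: fe_ge0.
Qed.

Let C_kern t x : C t x x = (\int[mu]_s \int[mu]_y
  (kern (2 * nu) (lambda ^+ 2) (t - s) * (heat_kernel (nu / 2) (t - s) (x - y))%:E *
   phi s y))%E.
Proof.
transitivity (energy P (fun s y w => (lambda ^+ 2 * heat_kernel (2 * nu) (t - s) 0 *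
  heat_kernel (nu / 2) (t - s) (x - y)) * fe s y w)).
  apply: eq_energy => s y w; rewrite gg subrr normr0.
  by have -> : (x + x) / 2 = x by field.
rewrite energy_weight.
  by apply: eq_integral => s _; apply: eq_integral => y _; rewrite /kern -EFinM.
move=> s y; apply: mulr_ge0; last exact: heat_kernel_ge0.
by apply: mulr_ge0; [exact: sqr_ge0|exact: heat_kernel_ge0].
Qed.

Let measurable_rho_u s y : 0 < s -> measurable_fun setT (fun w => rho (u s y w) ^+ 2).
Proof.
move=> s0; rewrite (_ : (fun w => _) = fun w => lambda ^+ 2 * fe s y w).
  by apply: measurable_funM => //; exact: (jmeasurable_slice _ _ jm_fe).
by apply/funext => w; rewrite rho2 /fe /field_energy s0.
Qed.

(** Reflecting time and space identifies the energy of the Walsh integrand with the quantity whose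
    finiteness belongs to the definition of a solution. *)
Let C_star t x : 0 < t -> C t x x =
  star (fun s y => (heat_kernel nu s y ^+ 2)%:E)
               (fun s y => 'E_P[fun w => (rho (u s y w) ^+ 2)%R]%E) t x.
Proof.
move=> t0.
have jmgg : jmeasurable (fun s y w => g t x s y w * g t x s y w).
  have [_ _ _ [I [hI _ _]]] := hu; have [mg _ _] := walsh_ito (hI t x t0).
  exact: jmeasurableM.
pose F (r : R) := (\int[mu]_z \int[P]_w (g t x r z w * g t x r z w)%:E)%E.
have mM := measurable_mean P jmgg (gg0 t x x).
have mF : measurable_fun setT F.
  apply: (measurable_fun_fubini_tonelli_F (m2 := mu) (fun z : R * R =>
    \int[P]_w (g t x z.1 z.2 w * g t x z.1 z.2 w)%:E)%E).
  - exact: mM.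
  - by move=> z; exact: (mean_ge0 P _ _ (gg0 t x x)).
have F0 r : (0 <= F r)%E.
  by apply: integral_ge0 => z _; exact: (mean_ge0 P _ _ (gg0 t x x)).
have mFt : measurable_fun setT (fun s : R => F (t - s)).
  by apply: measurableT_comp => //; exact: measurable_funB.
pose H (s : R) := (\int[mu]_y ((heat_kernel nu s y ^+ 2)%:E *
   'E_P[fun w => (rho (u (t - s) (x - y) w) ^+ 2)%R]))%E.
(* The end point t is left out: there the field is taken at time 0, where nothing is known about it.
   A single point does not change the integral. *)
have FH s : s \in (`[0, t[%classic : set R) -> F (t - s) = H s.
  rewrite inE/= in_itv/= => /andP[s0 st].
  have ts0 : 0 < t - s by rewrite subr_gt0.
  rewrite /F -(@ge0_integral_reflect R x); first last.
  - by move=> z; exact: (mean_ge0 P _ _ (gg0 t x x)).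
  - exact: (@measurableT_comp _ _ _ _ _ _ (fun z : R * R =>
      \int[P]_w (g t x z.1 z.2 w * g t x z.1 z.2 w)%:E)%E _ (fun z : R => (t - s, z))
      mM (measurable_pair1 _)).
  apply: eq_integral => y _; rewrite unlock -ge0_integralZl//.
  - apply: eq_integral => w _; rewrite -EFinM; congr EFin.
    rewrite /g indicE mem_set/=; last by rewrite in_itv/= ts0; lra.
    rewrite (_ : t - (t - s) = s); last by ring.
    rewrite (_ : x - (x - y) = y); last by ring.
    by rewrite /G; ring.
  - by apply/measurable_EFinP; exact: measurable_rho_u.
  - by move=> w _; rewrite lee_fin sqr_ge0.
  - by rewrite lee_fin sqr_ge0.
rewrite /star -/(H _) -(integral_itv_bndo_bndc (a := BLeft 0) (r := t) (f := H)); last first.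
  apply: (eq_measurable_fun (fun s : R => F (t - s))); first exact: FH.
  exact: measurable_funTS.
transitivity (\int[mu]_s F s)%E; first by [].
rewrite -(@ge0_integral_reflect R t F)//.
rewrite [RHS](_ : _ = \int[mu]_(s in `[0%R, t[) F (t - s)%R)%E; last first.
  by apply: eq_integral => s /FH.
rewrite [RHS]integral_mkcond; apply: eq_integral => s _.
rewrite patchE; case: ifPn => // s0.
apply: integral0_eq => y _; apply: integral0_eq => w _.
rewrite /g indicE memNset ?mulr0 ?mul0r//= in_itv/= => /andP[h1 h2].
by move: s0; rewrite notin_setE/= in_itv/=; apply; apply/andP; split; lra.
Qed.

Let measurable_u s y : 0 < s -> measurable_fun setT (u s y).
Proof.
move=> s0; have [hf _ _ _] := hu.
apply: (past_fun_measurable hP hW (a := s)); apply: filtration_past_fun.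
exact: hf.
Qed.

Let phiE s y : 0 < s ->
  phi s y = ((vsigma ^+ 2)%:E + \int[P]_w (u s y w ^+ 2)%:E)%E.
Proof.
move=> s0; rewrite /phi /field_energy s0.
under eq_integral do rewrite EFinD.
rewrite ge0_integralD//; first last.
- by apply/measurable_EFinP; apply: measurable_funX; exact: measurable_u.
- by move=> w _; rewrite lee_fin sqr_ge0.
- by move=> w _; rewrite lee_fin sqr_ge0.
by rewrite integral_cst//= probability_setT mule1.
Qed.

Let J0E t x : J0 nu (dirac (0 : R)) t x = G t x.
Proof.
rewrite /J0 /Rintegral integral_dirac//; last first.
  apply/measurable_EFinP; apply: measurable_heat_kernel_comp => //.
  exact: measurable_funB.
by rewrite diracT mul1e subr0.
Qed.

Let C_ge0 t x x' : (0 <= C t x x')%E.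
Proof. by apply: energy_ge0 => s y w; exact: gg0. Qed.

Let C_fin t x : 0 < t -> (C t x x < +oo)%E.
Proof. by move=> t0; rewrite C_star//; have [_ _ + _] := hu; exact. Qed.

(** Polarization of the isometry, applied at x, at x' and to the sum of the two integrals.
    Finiteness of the diagonal terms, from [C_fin], allows them to be subtracted. *)
Let mean_product t x x' : 0 < t ->
  (\int[P]_w (u t x w * u t x' w)%:E = (G t x * G t x')%:E + C t x x')%E.
Proof.
move=> t0; have [_ _ _ [I [hI _ uI]]] := hu.
have i1 := walsh_ito (hI t x t0); have i2 := walsh_ito (hI t x' t0).
have i12 := itoD hP hW i1 i2.
pose A w := G t x + I t x w; pose B w := G t x' + I t x' w.
have mA : measurable_fun setT A by apply: measurable_funD => //; case: i1.
have mB : measurable_fun setT B by apply: measurable_funD => //; case: i2.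
have jg z (h : ito W (fun s y w => g t z s y w) (I t z)) : jmeasurable (g t z) by case: h.
have j1 : jmeasurable (g t x) by exact: jg i1.
have j2 : jmeasurable (g t x') by exact: jg i2.
have EA : (\int[P]_w (A w ^+ 2)%:E = (G t x ^+ 2)%:E + C t x x)%E.
  exact: (ito_isometry hP hW (G t x) i1).
have EB : (\int[P]_w (B w ^+ 2)%:E = (G t x' ^+ 2)%:E + C t x' x')%E.
  exact: (ito_isometry hP hW (G t x') i2).
have EAB : (\int[P]_w ((A w + B w) ^+ 2)%:E =
    ((G t x + G t x') ^+ 2)%:E + (C t x x + C t x' x' + 2%:E * C t x x'))%E.
  transitivity (square_mean P (fun w => (G t x + G t x') + (I t x w + I t x' w))).
    by apply: eq_integral => w _; rewrite /A /B addrACA.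
  rewrite (ito_isometry hP hW (G t x + G t x') i12); congr (_ + _)%E.
  have m1 := jmeasurableM j1 j1; have m2 := jmeasurableM j2 j2; have m3 := jmeasurableM j1 j2.
  have mc : jmeasurable (fun _ _ (_ : T) => 2 : R) by exact: measurable_cst.
  have two0 : 0 <= 2 :> R by [].
  have g2 s y w : 0 <= 2 * (g t x s y w * g t x' s y w) by exact: mulr_ge0 two0 (gg0 _ _ _ _ _ _).
  transitivity (energy P (fun s y w => g t x s y w * g t x s y w +
      g t x' s y w * g t x' s y w + 2 * (g t x s y w * g t x' s y w))).
    by apply: eq_energy => s y w; rewrite /g /G; ring.
  rewrite (energyD P (jmeasurableD m1 m2) (jmeasurableM mc m3)); last 2 first.
  - by move=> s y w; apply: addr_ge0; exact: gg0.
  - exact: g2.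
  rewrite (energyD P m1 m2 (gg0 t x x) (gg0 t x' x')).
  by rewrite (energyZ P m3 two0 (gg0 t x x')).
have iA : square_itg P A.
  split=> //; apply: itg_lty.
  - exact: measurable_funX.
  - by move=> w; exact: sqr_ge0.
  - by rewrite EA; apply: lte_add_pinfty; [exact: ltry|exact: C_fin].
have iB : square_itg P B.
  split=> //; apply: itg_lty.
  - exact: measurable_funX.
  - by move=> w; exact: sqr_ge0.
  - by rewrite EB; apply: lte_add_pinfty; [exact: ltry|exact: C_fin].
have iAB := square_itgM iA iB.
have -> : (\int[P]_w (u t x w * u t x' w)%:E = \int[P]_w (A w * B w)%:E)%E.
  apply: ae_eq_integral => //.
  - by apply/measurable_EFinP; apply: measurable_funM; exact: measurable_u.
  - by apply/measurable_EFinP; exact: measurable_funM.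
  - have h1 := uI t x t0; have h2 := uI t x' t0.
    by apply: filterS2 h1 h2 => w + + _; rewrite !J0E => -> ->.
have sAB := (square_itgD iA iB).2.
have e : \int[P]_w ((A w + B w) ^+ 2) = \int[P]_w (A w ^+ 2) +
    (2 * \int[P]_w (A w * B w) + \int[P]_w (B w ^+ 2)).
  transitivity (\int[P]_w (A w ^+ 2 + (2 * (A w * B w) + B w ^+ 2))).
    by apply: eq_Rintegral => w _; ring.
  have k := itgZ 2 iAB.
  by rewrite (RintD iA.2 (itgD k iB.2)) (RintD k iB.2) (RintZ 2 iAB).
move: EA EB EAB; rewrite (itgE iA.2) (itgE iB.2) (itgE sAB) (itgE iAB) e.
have := C_ge0 t x x'; have := C_fin x t0; have := C_fin x' t0.
have := C_ge0 t x x; have := C_ge0 t x' x'.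
move: (C t x x) (C t x' x') (C t x x') => [a| |//] [b| |//] [c'| |//]//= _ _ _ _ _.
- rewrite -!EFinM -!EFinD => -[->] [->] [h]; congr EFin.
  have h' : 2 * (\int[P]_w (A w * B w)) = 2 * (G t x * G t x' + c').
    have -> : 2 * (\int[P]_w (A w * B w)) = (G t x ^+ 2 + a +
      (2 * \int[P]_w (A w * B w) + (G t x' ^+ 2 + b))) - (G t x ^+ 2 + a + (G t x' ^+ 2 + b)) by ring.
    by rewrite h; ring.
  by apply: (@mulfI _ 2) => //; rewrite pnatr_eq0.
- by rewrite mulry gtr0_sg// mul1e.
Qed.

(** On the diagonal [mean_product] is the closed equation for [phi]; off the diagonal it expresses
    the covariance through the same [phi], averaged at m = (x + x') / 2 with the weight of the
    distance q = |x - x'|. *)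
Let covariance t x x' : 0 < t ->
  (\int[P]_w (u t x w * u t x' w)%:E + (2 * vsigma ^+ 2)%:E * expo_mix (2 * nu) 0 t `|x - x'|%R =
   (G t x * G t x' )%:E + (heat_kernel (nu / 2) t ((x + x') / 2) * (lambda ^+ 2 / (2 * nu)) + 2 * vsigma ^+ 2)%:E *
     expo_mix (2 * nu) (lambda ^+ 2 / (2 * nu)) t `|x - x'|%R)%E.
Proof.
move=> t0; rewrite (mean_product _ _ t0) CE -addeA; congr (_ + _)%E.
apply: (second_moment_volterra hnu hlambda t0 measurable_phi phi_ge0).
- by move=> s y; exact: phi_le0.
- move=> s y /andP[s0 st]; rewrite phiE//.
  under eq_integral do rewrite expr2.
  rewrite mean_product// addeA -EFinD C_kern; congr (_ + _)%E.
  rewrite heat_kernel_mul// subrr.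
  by have -> : (y + y) / 2 = y by field.
- rewrite -C_kern; exact: C_fin.
- exact: normr_ge0.
Qed.

Let expo_mix_two_nu b t r : 0 < t -> expo_mix (2 * nu) b t r =
  (2^-1 * (expR (b ^+ 2 * nu * t - b * r) *
     erfc ((r - b * (2 * nu) * t) / (2 * Num.sqrt (nu * t)))))%:E.
Proof.
move=> t0; have c0 : 0 < 2 * nu by rewrite mulr_gt0.
rewrite (expo_mixE c0 b r t0); congr (_ * (expR _ * erfc (_ / _)))%:E.
  by field.
have -> : 2 * (2 * nu) * t = 2 ^+ 2 * (nu * t) by ring.
by rewrite (sqrtrM _ (sqr_ge0 2)) sqrtr_sqr ger0_norm.
Qed.

Lemma solution_covariance t x y : 0 < t ->
  'E_P[fun w => (u t x w * u t y w)%R]%E =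
     (heat_kernel nu t x * heat_kernel nu t y
      - vsigma ^+ 2 * erfc (`|x - y| / (2 * Num.sqrt (nu * t)))
      + (lambda ^+ 2 / (4 * nu) * heat_kernel (nu / 2) t ((x + y) / 2)
         + vsigma ^+ 2)
        * expR ((lambda ^+ 4 * t - 2 * lambda ^+ 2 * `|x - y|) / (4 * nu))
        * erfc ((`|x - y| - lambda ^+ 2 * t) / (2 * Num.sqrt (nu * t))))%:E.
Proof.
move=> t0; have nu0 : nu != 0 by rewrite gt_eqF.
have := covariance x y t0; rewrite unlock !expo_mix_two_nu//.
(* At beta = 0 the mixture is half of a bare erfc, and at beta = lambda^2 / (2 nu) it carries the
   exponential of the statement. The halves turn 2 varsigma^2 into varsigma^2 and lambda^2 / (2 nu)
   into lambda^2 / (4 nu). *)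
have -> : 0 ^+ 2 * nu * t - 0 * `|x - y| = 0 :> R by ring.
have -> : `|x - y| - 0 * (2 * nu) * t = `|x - y| by ring.
have -> : (lambda ^+ 2 / (2 * nu)) ^+ 2 * nu * t - lambda ^+ 2 / (2 * nu) * `|x - y| =
    (lambda ^+ 4 * t - 2 * lambda ^+ 2 * `|x - y|) / (4 * nu) by field.
have -> : lambda ^+ 2 / (2 * nu) * (2 * nu) * t = lambda ^+ 2 * t by field.
rewrite expR0 mul1r.
move: (integral _ _ _) (expR _) (erfc _) (erfc _) => [m| |] E e1 e2 //=.
rewrite -!EFinM -!EFinD => -[h]; congr EFin.
have -> : m = m + 2 * vsigma ^+ 2 * (2^-1 * e2) - 2 * vsigma ^+ 2 * (2^-1 * e2) by ring.
by rewrite h /G; field.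
Qed.

Lemma solution_second_moment t x : 0 < t ->
  'E_P[fun w => (`|u t x w| ^+ 2)%R]%E =
     ((lambda ^- 2)%:E * calK nu lambda t x
      + (vsigma ^+ 2)%:E * calH nu lambda t)%E.
Proof.
move=> t0; have nu0 : nu != 0 by rewrite gt_eqF.
have c0 : 0 < 2 * nu by rewrite mulr_gt0.
have := covariance x x t0.
rewrite subrr normr0 (_ : (x + x) / 2 = x); last by field.
rewrite unlock (_ : integral _ _ _ = \int[P]_w (`|u t x w| ^+ 2)%:E)%E; last first.
  by apply: eq_integral => w _; rewrite real_normK ?num_real// expr2.
(* With D the mixture at r = 0, [calHE] gives H = 2 D - 1 and K is affine in D, so that the claim
   becomes an identity between affine functions of D. *)
rewrite calKE// /time_kernel.
have := calHE hnu hlambda t0.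
rewrite (expo_mix0 c0 t0).
rewrite /G heat_kernel_mul// subrr (_ : (x + x) / 2 = x); last by field.
rewrite -(fineK (expo_mix_fin (lambda ^+ 2 / (2 * nu)) t 0 c0)).
move: (fine _) (integral _ _ _) (calH _ _ _) (heat_kernel (nu / 2) t x) (heat_kernel (2 * nu) t 0).
move=> D [m| |] [h| |] g1 g2 //=.
rewrite -!EFinM -!EFinD => -[hD] -[mD]; congr EFin.
have -> : h = 2 * D - 1 by rewrite -hD; ring.
have -> : m = m + 2 * vsigma ^+ 2 * 2^-1 - vsigma ^+ 2 by field.
by rewrite mD; field; rewrite hlambda nu0.
Qed.

End Solution.

Theorem corollary2p8 (R : realType) (d : measure_display)
    (T : measurableType d) (P : probability T R)
    (hP : measure_is_complete P)
    (W : set (R * R) -> {RV P >-> R}) (hW : space_time_white_noise W)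
    (nu : R) (hnu : 0 < nu)
    (lambda vsigma : R) (hlambda : lambda != 0) (hvsigma : 0 <= vsigma)
    (rho : R -> R) (hlip : exists k : R, k.-lipschitz rho)
    (hrho : forall v : R,
       `|rho v| ^+ 2 = lambda ^+ 2 * (vsigma ^+ 2 + v ^+ 2))
    (u : R -> R -> T -> R)
    (hu : random_field_solution nu rho (dirac (0 : R)) W u) :
  (forall t x y : R, 0 < t ->
     'E_P[fun w => (u t x w * u t y w)%R]%E =
     (heat_kernel nu t x * heat_kernel nu t y
      - vsigma ^+ 2 * erfc (`|x - y| / (2 * Num.sqrt (nu * t)))
      + (lambda ^+ 2 / (4 * nu) * heat_kernel (nu / 2) t ((x + y) / 2)
         + vsigma ^+ 2)
        * expR ((lambda ^+ 4 * t - 2 * lambda ^+ 2 * `|x - y|) / (4 * nu))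
        * erfc ((`|x - y| - lambda ^+ 2 * t) / (2 * Num.sqrt (nu * t))))%:E)
  /\
  (forall t x : R, 0 < t ->
     'E_P[fun w => (`|u t x w| ^+ 2)%R]%E =
     ((lambda ^- 2)%:E * calK nu lambda t x
      + (vsigma ^+ 2)%:E * calH nu lambda t)%E).
Proof.
split=> [t x y|t x].
- exact: (solution_covariance hP hW hnu hlambda hrho hu).
- exact: (solution_second_moment hP hW hnu hlambda hrho hu).
Qed.
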